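(* Let $\nu\ge 0$, $d\ge 1$, $0\le \gamma\le 2$, $\beta\ge 0$, $\lambda>1$. There is a constant $C>0$ depending only on $(\nu,d,\gamma,\beta,\lambda)$ such that the following holds. Let $v=v(t,x):[0,\infty)\times\mathbb R^d\to\mathbb R^d$ be a given vector field (not necessarily divergence-free), and let $\theta=\theta(t,x)$ be a smooth solution of $$\partial_t\theta+v\cdot\nabla\theta+\nu\,\mathcal A_1\theta=0,\quad (t,x)\in(0,\infty)\times\mathbb R^d,\qquad \theta(0,x)=\theta_0(x),$$ where $\mathcal A_1=|\nabla|^{\gamma}\log^{-\beta}(\lambda-\Delta)$, and assume that $\theta$ decays at spatial infinity, i.e. for any fixed $t\ge 0$, $$\lim_{|x|\to\infty}\theta(t,x)=0.$$ Then $$\|\theta(t)\|_{\infty}\le e^{Ct}\,\|\theta_0\|_{\infty},\qquad \forall\, t\ge 0.$$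
   Context: $\theta$ is a scalar function. The operator $\mathcal A_1$ is the Fourier multiplier acting in the space variable $x\in\mathbb R^d$ given by $$\widehat{\mathcal A_1 f}(\xi)=\frac{|\xi|^{\gamma}}{\log^{\beta}(\lambda+|\xi|^2)}\,\hat f(\xi),\qquad \xi\in\mathbb R^d,$$ where $\log^\beta(y)=(\log y)^\beta$ and $\hat f(\xi)=\int_{\mathbb R^d}f(x)e^{-i\xi\cdot x}\,dx$. $\|\cdot\|_\infty$ denotes the $L^\infty(\mathbb R^d)$ norm in $x$.
   Formalization: ''Smooth solution'' also requires that t ↦ θ(t) be continuous on [0,∞) in the sup norm; otherwise the claim fails: d=1, ν=0, θ=φ(x−1/t) for t>0, θ_0=0 (φ a bump) is smooth, decays for each t and is transported by a smooth v. *)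

(* Defs.v *)
From HB Require Import structures.
From mathcomp Require Import all_boot all_order all_algebra.
From mathcomp Require Import complex.
From mathcomp Require Import all_classical all_reals all_analysis.

Set Implicit Arguments.
Unset Strict Implicit.
Unset Printing Implicit Defensive.

Import Order.TTheory GRing.Theory Num.Theory.
Import numFieldNormedType.Exports.

Local Open Scope classical_set_scope.
Local Open Scope ring_scope.
Local Open Scope complex_scope.

(* R^d is 'rV[R]_d, with the product (= Borel) sigma-algebra generated by the
   coordinates, as the library does for n-tuples. *)
Definition measure_rV_display : measure_display.
Proof. exact: default_measure_display. Qed.

Section measurable_rV.
Context {R : realType} {n : nat}.

Definition rV_coord (i : 'I_n) (x : 'rV[R]_n) : R := x ord0 i.

Let rV_set0 : g_sigma_preimage rV_coord set0.
Proof. exact: sigma_algebra0. Qed.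

Let rV_setC A : g_sigma_preimage rV_coord A -> g_sigma_preimage rV_coord (~` A).
Proof. exact: sigma_algebraC. Qed.

Let rV_bigcup (F : (set 'rV[R]_n)^nat) :
  (forall i, g_sigma_preimage rV_coord (F i)) ->
  g_sigma_preimage rV_coord (\bigcup_i (F i)).
Proof. exact: sigma_algebra_bigcup. Qed.

HB.instance Definition _ := @isMeasurable.Build measure_rV_display
  'rV[R]_n (g_sigma_preimage rV_coord) rV_set0 rV_setC rV_bigcup.

Lemma measurable_rV_coord (i : 'I_n) : measurable_fun [set: 'rV[R]_n] (rV_coord i).
Proof.
move=> _ Y mY; rewrite setTI; apply: sub_sigma_algebra => /=.
rewrite -bigcup_seq/=; exists i => /=; first by rewrite mem_index_enum.
by exists Y => //; rewrite setTI.
Qed.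

End measurable_rV.

Lemma measurable_fun_rV (R : realType) n d (T : measurableType d) (f : T -> 'rV[R]_n) :
  (forall i, measurable_fun [set: T] (rV_coord i \o f)) ->
  measurable_fun [set: T] f.
Proof.
move=> mf _ A mA; rewrite setTI.
suff H : g_sigma_preimage (fun i => @rV_coord R n i \o f) `<=` measurable.
  by apply: H; rewrite g_sigma_preimage_comp; exists A => //; rewrite setTI.
apply: smallest_sub; first exact: sigma_algebra_measurable.
case: n f mf {A mA} => [|m] f mf; first by rewrite big_ord0.
rewrite -bigcup_mkord_ord; apply: bigcup_sub => i Ii.
by move=> A [B mB <-]; exact: mf.
Qed.

Section lebesgue_rV.
Context {R : realType}.

Definition rV_cons n (p : measurableTypeR R * 'rV[R]_n) : 'rV[R]_n.+1 :=
  \row_i (if unlift ord0 i is Some j then p.2 ord0 j else p.1).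

Definition rV_uncons n (x : 'rV[R]_n.+1) : measurableTypeR R * 'rV[R]_n :=
  (x ord0 ord0, \row_j x ord0 (lift ord0 j)).

Lemma rV_consK n : cancel (@rV_cons n) (@rV_uncons n).
Proof.
case=> a y; rewrite /rV_cons /rV_uncons /=; congr pair.
  by rewrite mxE unlift_none.
by apply/rowP => j; rewrite !mxE liftK.
Qed.

Lemma measurable_rV_cons n : measurable_fun setT (@rV_cons n).
Proof.
apply: measurable_fun_rV => i.
case: (unliftP ord0 i) => [j|] ->.
  rewrite (_ : _ \o _ = rV_coord j \o snd).
    by apply: measurableT_comp => //; exact: measurable_rV_coord.
  by apply/funext => p /=; rewrite /rV_coord mxE liftK.
rewrite (_ : _ \o _ = fst)//.
by apply/funext => p /=; rewrite /rV_coord mxE unlift_none.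
Qed.

Lemma measurable_rV_uncons n : measurable_fun setT (@rV_uncons n).
Proof.
apply/measurable_fun_pairP; split.
  exact: (@measurable_rV_coord R n.+1 ord0).
apply: measurable_fun_rV => j.
rewrite (_ : _ \o _ = rV_coord (lift ord0 j)); first exact: measurable_rV_coord.
by apply/funext => x /=; rewrite /rV_coord mxE.
Qed.

Section step.
Variables (n : nat) (mu : {sigma_finite_measure set 'rV[R]_n -> \bar R}).

Definition lebesgue_rV_step : set 'rV[R]_n.+1 -> \bar R :=
  pushforward (lebesgue_measure \x mu)%E (@rV_cons n).

Let mcons := @measurable_rV_cons n.

Let step0 : lebesgue_rV_step set0 = 0%E.
Proof. by rewrite /lebesgue_rV_step /pushforward preimage_set0 measure0. Qed.

Let step_ge0 A : (0 <= lebesgue_rV_step A)%E.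
Proof. by rewrite /lebesgue_rV_step /pushforward; exact: measure_ge0. Qed.

Let step_sigma_additive : semi_sigma_additive lebesgue_rV_step.
Proof.
move=> F mF tF mUF; rewrite /lebesgue_rV_step /pushforward preimage_bigcup.
apply: measure_semi_sigma_additive.
- by move=> k; rewrite -[X in measurable X]setTI; exact: mcons.
- apply/trivIsetP => /= i j _ _ ij; rewrite -preimage_setI.
  by move/trivIsetP : tF => /(_ _ _ _ _ ij) ->//; rewrite preimage_set0.
- by rewrite -preimage_bigcup -[X in measurable X]setTI; exact: mcons.
Qed.

HB.instance Definition _ := isMeasure.Build _ _ _
  lebesgue_rV_step step0 step_ge0 step_sigma_additive.

Let step_sigma_finite : sigma_finite setT lebesgue_rV_step.
Proof.
have /sigma_finiteP[F [TF ndF Foo]] := sigma_finiteT (@lebesgue_measure R).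
have /sigma_finiteP[G [TG ndG Goo]] := sigma_finiteT mu.
exists (fun k => @rV_uncons n @^-1` (F k `*` G k)).
  apply/esym; rewrite -subTset => x _.
  have [k _ Fk] : (\bigcup_i F i) (@rV_uncons n x).1 by rewrite -TF.
  have [l _ Gl] : (\bigcup_i G i) (@rV_uncons n x).2 by rewrite -TG.
  exists (maxn k l) => //; split.
  - by move: Fk; exact/subsetPset/ndF/leq_maxl.
  - by move: Gl; exact/subsetPset/ndG/leq_maxr.
move=> k; have [mF Fk] := Foo k; have [mG Gk] := Goo k; split.
  rewrite -[X in measurable X]setTI; apply: measurable_rV_uncons => //.
  exact: measurableX.
rewrite /lebesgue_rV_step /pushforward -comp_preimage.
rewrite (_ : @rV_uncons n \o @rV_cons n = id) ?preimage_id.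
  by rewrite product_measure1E// lte_mul_pinfty// ge0_fin_numE.
by apply/funext => p /=; rewrite rV_consK.
Qed.

HB.instance Definition _ := Measure_isSigmaFinite.Build _ _ _
  lebesgue_rV_step step_sigma_finite.

End step.

Fixpoint lebesgue_rV n : {sigma_finite_measure set 'rV[R]_n -> \bar R} :=
  match n with
  | 0 => dirac (0 : 'rV[R]_0)
  | m.+1 => lebesgue_rV_step (lebesgue_rV m)
  end.

End lebesgue_rV.

Section fourier_multiplier.
Context {R : realType} {d : nat}.
Implicit Types (x y xi : 'rV[R]_d) (f g psi h : 'rV[R]_d -> R).

Definition dotrV x y : R := \sum_(i < d) x ord0 i * y ord0 i.

(* The Euclidean norm; the library's `|x| on 'rV[R]_d is the max norm. *)
Definition enorm x : R := Num.sqrt (dotrV x x).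

(* \int f(x) e^{-i xi.x} dx, for a real-valued integrable f. *)
Definition fourier f xi : R[i] :=
  (\int[lebesgue_rV d]_x (f x * cos (dotrV xi x)))
  +i* (- \int[lebesgue_rV d]_x (f x * sin (dotrV xi x))).

Definition fourier_multiplier_L1 (m : 'rV[R]_d -> R) f g : Prop :=
  [/\ (lebesgue_rV d).-integrable setT (EFin \o f),
      (lebesgue_rV d).-integrable setT (EFin \o g) &
      forall xi, fourier g xi = (m xi)%:C * fourier f xi].

End fourier_multiplier.

Section smooth.
Context {R : realType} {V : normedModType R}.

(* On an open set U: all iterated directional derivatives of f of order <= k
   exist and are continuous. *)
Fixpoint Ck_on (k : nat) (U : set V) (f : V -> R) : Prop :=
  {in U, continuous f} /\
  if k is j.+1 then
    forall w : V, (forall p, U p -> derivable f p w) /\ Ck_on j U ('D_w f)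
  else True.

Definition smooth_on (U : set V) (f : V -> R) : Prop := forall k, Ck_on k U f.

Definition test_function (f : V -> R) : Prop :=
  smooth_on setT f /\
  exists2 K : set V, compact K & forall x, ~ K x -> f x = 0.

End smooth.

Section evolution.
Context {R : realType} {d : nat}.

(* g is the Fourier multiplier with symbol m applied to f, for f bounded and
   continuous (so that f need not have a Fourier integral) and m real and even.
   The relation \hat g = m \hat f is meant in the sense of distributions: the
   operator is transposed to a test function psi, on which it is given by the
   formula with Fourier integrals. For m = A1_symbol gamma beta lambda with
   0 <= gamma, 0 <= beta and 1 < lambda, the integrable function h exists, and
   it is unique up to a null set. *)
Definition fourier_multiplier (m : 'rV[R]_d -> R) (f g : 'rV[R]_d -> R) : Prop :=
  continuous g /\
  forall psi h : 'rV[R]_d -> R,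
    test_function psi -> fourier_multiplier_L1 m psi h ->
    \int[lebesgue_rV d]_x (g x * psi x) = \int[lebesgue_rV d]_x (f x * h x).

(* The symbol of |nabla|^gamma log^{-beta}(lambda - Delta). *)
Definition A1_symbol (gamma beta lambda : R) (xi : 'rV[R]_d) : R :=
  enorm xi `^ gamma / ln (lambda + enorm xi ^+ 2) `^ beta.

Definition advection (v : 'rV[R]_d -> 'rV[R]_d) (f : 'rV[R]_d -> R)
    (x : 'rV[R]_d) : R :=
  \sum_(i < d) v x ord0 i * 'D_(delta_mx ord0 i) f x.

(* theta is C^oo for t > 0, and t |-> theta(t) is continuous for the sup norm
   on [0, +oo[. Without the latter, the decay of each theta(t) would allow a
   bump to come in from infinity at time 0: for d = 1, nu = 0, phi a bump
   supported in [-1, 1], theta(t, x) = phi(x - 1/t) for t > 0 and theta(0) = 0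
   is smooth up to t = 0 and is transported by a smooth v. *)
Record smooth_solution (nu gamma beta lambda : R)
    (v : R -> 'rV[R]_d -> 'rV[R]_d) (theta : R -> 'rV[R]_d -> R)
    (theta0 : 'rV[R]_d -> R) : Prop := SmoothSolution {
  solution_smooth :
    smooth_on [set p : R * 'rV[R]_d | 0 < p.1] (fun p => theta p.1 p.2) ;
  solution_continuous : forall t : R, 0 <= t -> forall e : R, 0 < e ->
    \forall s \near t, 0 <= s -> forall x, `|theta s x - theta t x| <= e ;
  solution_equation : exists2 A1theta : R -> 'rV[R]_d -> R,
    (forall t : R, 0 < t ->
      fourier_multiplier (A1_symbol gamma beta lambda) (theta t) (A1theta t)) &
    forall (t : R) x, 0 < t ->
      derive1 (theta ^~ x) t + advection (v t) (theta t) x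
        + nu * A1theta t x = 0 ;
  solution_initial : forall x, theta 0 x = theta0 x }.

Definition vanishes_at_infinity (f : 'rV[R]_d -> R) : Prop :=
  forall e : R, 0 < e -> exists M : R, forall x, M <= enorm x -> `|f x| < e.

Definition Linfty_norm (f : 'rV[R]_d -> R) : \bar R :=
  ('N[lebesgue_rV d]_+oo [EFin \o f])%E.

End evolution.

(* Main.v *)
Require Import Defs.
From HB Require Import structures.
From mathcomp Require Import all_boot all_order all_algebra.
From mathcomp Require Import complex.
From mathcomp Require Import all_classical all_reals all_analysis.
From mathcomp Require Import measurable_realfun lebesgue_integral_under ess_sup_inf.
From mathcomp Require Import ring lra.

Set Implicit Arguments.
Unset Strict Implicit.
Unset Printing Implicit Defensive.

Import Order.TTheory GRing.Theory Num.Theory.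
Import numFieldNormedType.Exports.

Local Open Scope classical_set_scope.
Local Open Scope ring_scope.

(** The estimate is a maximum principle for the nonlocal operator A_1, up to a
    bounded error.  Suppose that |theta(t0)| is maximal at x1, with value M,
    and let sg be the sign of theta(t0, x1).  The advection term vanishes at
    x1, so that the time derivative of sg * theta at (t0, x1) is
    - nu * sg * A_1 theta.  If sg * A_1 theta >= - C1 * M there, the supremum
    norm of theta cannot grow faster than e^{nu C1 t}: the maximum over
    [0, T] of e^{-Ct} times the norm, with C = nu * C1 + 1, is at time 0,
    because at a positive time it would contradict the sign of the derivative
    from the left (weighted_norm_not_maximal, sup_norm_growth).  The continuity
    of theta in time for the sup norm makes that maximum exist.

    The lower bound on A_1 comes from a decomposition of its symbol as
    m1 + m2 - m3 (A1_symbol_decomposition).  The multipliers m2 and m3 are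
    averaging symbols, that is they preserve positivity; they act as finite
    positive measures of mass m2(0) and m3(0), so that they are bounded by
    m2(0) * M and m3(0) * M.  The multiplier m1 is an extremal symbol: it is
    nonnegative at a nonnegative maximum, like minus the Laplacian.  Hence
    C1 = m2(0) + m3(0).

    To decompose, let s = |xi|^2, y = lambda + s > 1 and a = gamma / 2.  For
    beta > 0,

      s^a (ln y)^{-beta} = y^a (ln y)^{-beta} - (y^a - s^a) (ln y)^{-beta}.

    By the Gamma integral, (ln y)^{-beta} is a positive superposition of the
    powers y^{-u} with u > 0, so that y^a (ln y)^{-beta} is a positive
    superposition of powers y^c with c = a - u < 1.  A power with c < 0 is a
    positive superposition of the e^{-ky} = e^{-k lambda} e^{-ks}, the
    symbols of Gaussian averages: these go into m2.  A power with 0 < c < 1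
    is a positive superposition of the 1 - e^{-ky}, and the identity minus
    e^{-k lambda} times an average is nonnegative at a nonnegative maximum:
    these go into m1.  In the same way y^a - s^a is a positive superposition
    of the (1 - e^{-k lambda}) e^{-ks} if 0 < a < 1, and it is the constant 0 or
    lambda if a = 0 or a = 1; its product with (ln y)^{-beta} is m3.  For beta = 0 the power s^a is y^a - (y^a - s^a) when 0 < a < 1, and
    s itself comes from second derivatives when a = 1, and the symbol is 1 when
    a = 0.

    Since A_1 theta is defined by duality with test functions, the maximum
    principle is first proved for local averages, against translates of a
    smooth cutoff psi of radius r
    (multiplier_at_local_average_max): the symbol m1 is applied to psi rather
    than to theta, and what enters is a maximum over z of the integral of
    theta(t0) against psi centred at z.  Decay at infinity keeps the
    maximisers z in a compact set; letting r tend to 0 then gives an actual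
    maximum point with the required bound (multiplier_at_max). *)

(** * Integrals of real-valued functions *)

Section real_integrals.
Context {R : realType} {dT : measure_display} {T : measurableType dT}
  (mu : {measure set T -> \bar R}).
Local Notation L1 f := (mu.-integrable setT (EFin \o f)).

Lemma integrable_measurable (f : T -> R) : L1 f -> measurable_fun setT f.
Proof. by move=> /measurable_int/measurable_EFinP. Qed.

Lemma integrable_dominated (f g : T -> R) : measurable_fun setT f ->
  (forall x, `|f x| <= g x) -> L1 g -> L1 f.
Proof.
move=> mf fg; apply: le_integrable => //; first exact/measurable_EFinP.
by move=> x _ /=; rewrite lee_fin (le_trans (fg x))// ler_norm.
Qed.

Lemma integrable_add (f g : T -> R) : L1 f -> L1 g -> L1 (fun x => f x + g x).
Proof.
move=> Lf Lg; have := integrableD measurableT Lf Lg.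
by apply: eq_integrable => // x _ /=; rewrite EFinD.
Qed.

Lemma integrable_sub (f g : T -> R) : L1 f -> L1 g -> L1 (fun x => f x - g x).
Proof.
move=> Lf Lg; have := integrableB measurableT Lf Lg.
by apply: eq_integrable => // x _ /=; rewrite EFinB.
Qed.

Lemma integrable_scale (c : R) (f : T -> R) : L1 f -> L1 (fun x => c * f x).
Proof.
move=> Lf; have := integrableZl measurableT c Lf.
by apply: eq_integrable => // x _ /=; rewrite EFinM.
Qed.

Lemma integrable_bounded_mul (M : R) (f g : T -> R) : measurable_fun setT f ->
  (forall x, `|f x| <= M) -> L1 g -> L1 (fun x => f x * g x).
Proof.
move=> mf fM Lg.
have M0 : 0 <= M by rewrite (le_trans _ (fM point)).
have LMg : L1 (fun x => M * `|g x|).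
  exact: (integrable_scale M (integrable_norm Lg)).
apply: integrable_dominated LMg.
  exact: measurable_funM mf (integrable_measurable Lg).
by move=> x; rewrite normrM ler_wpM2r.
Qed.

Lemma integrable_finite_support (f : T -> R) (A : set T) (M : R) :
  measurable A -> (mu A < +oo)%E -> measurable_fun setT f ->
  (forall x, `|f x| <= M) -> (forall x, ~ A x -> f x = 0) -> L1 f.
Proof.
move=> mA muA mf fM f0.
have LA : L1 \1_A.
  apply/integrableP; split; first exact/measurable_EFinP.
  by under eq_integral do rewrite /= ger0_norm//; rewrite integral_indic// setIT.
have := integrable_scale M LA.
apply: integrable_dominated => // x; rewrite indicE.
have [_|] := boolP (x \in A); first by rewrite mulr1.
by rewrite notin_setE => /f0 ->; rewrite normr0 mulr0.
Qed.

Lemma EFin_Rintegral (f : T -> R) : L1 f ->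
  (\int[mu]_x f x)%:E = (\int[mu]_x (f x)%:E)%E.
Proof. by move=> Lf; rewrite fineK//; exact: integrable_fin_num. Qed.

Lemma Rintegral_of_EFin (f : T -> R) (c : R) :
  (\int[mu]_x (f x)%:E)%E = c%:E -> \int[mu]_x f x = c.
Proof. by rewrite /Rintegral => ->. Qed.

Lemma ge0_integrable (f : T -> R) : measurable_fun setT f ->
  (forall x, 0 <= f x) -> (\int[mu]_x (f x)%:E < +oo)%E -> L1 f.
Proof.
move=> mf f0 foo; apply/integrableP; split; first exact/measurable_EFinP.
rewrite (_ : (fun x => _) = (fun x => (f x)%:E))//.
by apply/funext => x /=; rewrite ger0_norm.
Qed.

End real_integrals.

Lemma measurable_fun_fine {R : realType} :
  measurable_fun [set: \bar R] (@fine R).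
Proof.
move=> _ A mA; rewrite setTI; have [A0|A0] := pselect (A 0).
  exists A => //; exists [set -oo; +oo]%E; first by constructor.
  apply/seteqP; split=> [_ [[r Ar <-//]|[] ->//]|[r| |] Ar].
  - by left; exists r.
  - by right; right.
  - by right; left.
exists A => //; exists set0; first by constructor.
rewrite setU0; apply/seteqP; split=> [_ [r Ar <-//]|[r| |] Ar //].
Qed.

Section superposition.
Context {R : realType} {d1 d2 : measure_display}
  {X : measurableType d1} {T : measurableType d2}
  (mu : {sigma_finite_measure set X -> \bar R})
  (P : {sigma_finite_measure set T -> \bar R}).

(** The inner integral is finite for almost every x only; elsewhere [fine] makes
    it 0, which is harmless since the extended-real integral dominates it. *)
Lemma integrable_superposition (k : X * T -> R) :
  (mu \x P)%E.-integrable setT (EFin \o k) ->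
  mu.-integrable setT (EFin \o (fun x => \int[P]_t k (x, t))).
Proof.
move=> Lk; have LF := integrable_fubini_F Lk.
have mF := measurable_fubini_F Lk.
apply: le_integrable LF => //.
  apply/measurable_EFinP; rewrite /Rintegral.
  exact: (measurableT_comp (@measurable_fun_fine R) mF).
move=> x _; rewrite /= /Rintegral /fubini_F.
by case: (\int[P]_t _)%E => [r| |] //=; rewrite normr0 ?leey.
Qed.

Lemma integral_superposition (k : X * T -> R) :
  (mu \x P)%E.-integrable setT (EFin \o k) ->
  \int[mu]_x (\int[P]_t k (x, t)) = \int[P]_t (\int[mu]_x k (x, t)).
Proof.
move=> Lk; rewrite [LHS]/Rintegral [RHS]/Rintegral; congr fine.
transitivity (\int[mu]_x \int[P]_t (k (x, t))%:E)%E.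
  apply: ae_eq_integral => //.
  - apply/measurable_EFinP.
    exact: integrable_measurable (integrable_superposition Lk).
  - exact: measurable_fubini_F Lk.
  - have := ae_integrable1 Lk; apply: filterS => x Lx _ /=.
    by rewrite EFin_Rintegral.
rewrite (Fubini Lk); apply: ae_eq_integral => //.
- exact: measurable_fubini_G Lk.
- apply/measurable_EFinP; rewrite /Rintegral.
  exact: (measurableT_comp (@measurable_fun_fine R)
    (measurable_fubini_G Lk)).
- have := ae_integrable2 Lk; apply: filterS => x Lx _ /=.
  by rewrite EFin_Rintegral.
Qed.

(** A bounded factor depending on the outer variable passes through Fubini's
    theorem: this is how a superposition of kernels is tested against a bounded
    function. *)
Lemma integral_superposition_mul (k : X * T -> R) (f : X -> R) (M : R) :
  (mu \x P)%E.-integrable setT (EFin \o k) ->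
  measurable_fun setT f -> (forall x, `|f x| <= M) ->
  \int[mu]_x (f x * \int[P]_t k (x, t)) =
  \int[P]_t (\int[mu]_x (f x * k (x, t))).
Proof.
move=> Lk mf fM.
pose k' := fun p : X * T => f p.1 * k p.
have Lk' : (mu \x P)%E.-integrable setT (EFin \o k').
  apply: (integrable_bounded_mul (M := M)) Lk => //.
  exact: measurableT_comp.
rewrite -(integral_superposition Lk').
rewrite [LHS]/Rintegral [RHS]/Rintegral; congr fine.
apply: ae_eq_integral => //.
- apply/measurable_EFinP/measurable_funM => //.
  exact: integrable_measurable (integrable_superposition Lk).
- apply/measurable_EFinP.
  exact: integrable_measurable (integrable_superposition Lk').
- have := ae_integrable1 Lk; apply: filterS => x Lx _ /=.
  by rewrite -RintegralZl.
Qed.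

End superposition.

(** * Translation invariance of Lebesgue measure on row vectors *)

Section shift1.
Context {R : realType}.
Local Notation leb := (@lebesgue_measure R).

Lemma measurable_shift1 (a : R) :
  @measurable_fun _ _ (measurableTypeR R) (measurableTypeR R) setT
    (fun x : R => x + a).
Proof. exact: measurable_funD. Qed.

(** Lebesgue measure is the only measure that gives intervals their length, and a
    translation preserves lengths. *)
Lemma lebesgue_measure_shift (a : R) (A : set (measurableTypeR R)) :
  measurable A ->
  pushforward leb ((fun x => x + a) : measurableTypeR R -> measurableTypeR R) A
  = leb A.
Proof.
pose phi_mixin := @isMeasurableFun.Build _ _ (measurableTypeR R)
  (measurableTypeR R) (fun x : R => x + a) (measurable_shift1 a).
pose phi : {mfun measurableTypeR R >-> measurableTypeR R} :=
  HB.pack (fun x : R => x + a) phi_mixin.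
move=> mA; apply/esym.
apply: (@lebesgue_measure_unique R (pushforward leb phi)) => // _ [[b c]] _ <-.
have H : pushforward leb phi `](b, c).1, (b, c).2]%classic =
    leb [set` `](b - a), (c - a)]].
  congr (leb _); apply/seteqP.
  by split => x /=; rewrite !in_itv/= ltrBlDr lerBrDr.
apply: (etrans _ (esym H)); rewrite /= !lebesgue_measure_itv/= !lte_fin ltrD2r.
by case: ifPn => // _; rewrite -!EFinB; congr EFin; ring.
Qed.

Lemma ge0_integral_shift1 (a : R) (f : R -> \bar R) :
  measurable_fun setT f -> (forall x, (0 <= f x)%E) ->
  (\int[leb]_x f ((x : R) + a)%R = \int[leb]_x f x)%E.
Proof.
move=> mf f0.
have := @ge0_integral_pushforward _ _ (measurableTypeR R) (measurableTypeR R) R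
  (fun x => x + a) (measurable_shift1 a) leb setT f measurableT.
rewrite preimage_setT => <- //.
apply: eq_measure_integral => [|? A mA _]; first exact: measurable_shift1.
exact: lebesgue_measure_shift.
Qed.

End shift1.

Section rV_integrals.
Context {R : realType}.
Local Notation leb := (@lebesgue_measure R).

Lemma measurable_rV_consr n (a : measurableTypeR R) :
  measurable_fun setT (fun y : 'rV[R]_n => rV_cons (a, y)).
Proof. exact: measurableT_comp (@measurable_rV_cons R n) _. Qed.

(** Lebesgue measure on row vectors is defined by adding one coordinate at a
    time, so Tonelli's theorem gives the recursion that the inductions on the
    dimension below use. *)
Lemma ge0_integral_rVS n (F : 'rV[R]_n.+1 -> \bar R) :
  measurable_fun setT F -> (forall x, (0 <= F x)%E) ->
  (\int[lebesgue_rV n.+1]_x F x =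
   \int[leb]_a \int[lebesgue_rV n]_y F (rV_cons (a, y)))%E.
Proof.
move=> mF F0; rewrite /=.
have := @ge0_integral_pushforward _ _ _ _ R
  (@rV_cons R n) (@measurable_rV_cons R n) (leb \x lebesgue_rV n)%E
  setT F measurableT mF.
rewrite preimage_setT => -> //; rewrite fubini_tonelli1//.
  exact: measurableT_comp mF (@measurable_rV_cons R n).
by move=> x; exact: F0.
Qed.

Lemma measurable_rVD n (v : 'rV[R]_n) :
  measurable_fun setT (fun x : 'rV[R]_n => x + v).
Proof.
apply: measurable_fun_rV => i.
rewrite (_ : _ \o _ = fun x => rV_coord i x + v ord0 i); last first.
  by apply/funext => x; rewrite /rV_coord /= mxE.
by apply: measurable_funD => //; exact: measurable_rV_coord.
Qed.

Lemma ge0_integral_rV_shift n (v : 'rV[R]_n) (F : 'rV[R]_n -> \bar R) :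
  measurable_fun setT F -> (forall x, (0 <= F x)%E) ->
  (\int[lebesgue_rV n]_x F (x + v)%R = \int[lebesgue_rV n]_x F x)%E.
Proof.
elim: n v F => [v F mF F0|n IH v F mF F0].
  by rewrite (_ : (fun x => F (x + v)) = F)//; apply/funext => x; rewrite (thinmx0 v) addr0.
have mFv : measurable_fun setT (fun x : 'rV[R]_n.+1 => F (x + v)).
  exact: measurableT_comp mF (measurable_rVD v).
rewrite (ge0_integral_rVS mFv (fun x => F0 _)) (ge0_integral_rVS mF F0).
(* translate the tail by induction, then the first coordinate *)
pose w := (rV_uncons v).2.
have consD a y : rV_cons (a, y) + v = rV_cons (a + v ord0 ord0, y + w).
  apply/rowP => i; rewrite !mxE; case: unliftP => [j ->|->] //=.
  by rewrite !mxE.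
transitivity (\int[leb]_a \int[lebesgue_rV n]_y
    F (rV_cons (a + v ord0 ord0, y)%R))%E.
  apply: eq_integral => a _.
  under eq_integral do rewrite consD.
  rewrite (IH w (fun y => F (rV_cons (a + v ord0 ord0, y))))//.
  exact: (measurableT_comp mF (measurable_rV_consr ((a : R) + v ord0 ord0))).
rewrite (ge0_integral_shift1 (v ord0 ord0) (f := fun a : R => \int[lebesgue_rV n]_y F (rV_cons (a, y)))%E)//.
- apply: (measurable_fun_fubini_tonelli_F (fun p => F (rV_cons p))) => //.
  exact: measurableT_comp mF (@measurable_rV_cons R n).
- by move=> a; exact: integral_ge0.
Qed.

Lemma integral_rV_shift n (v : 'rV[R]_n) (F : 'rV[R]_n -> R) :
  measurable_fun setT F ->
  \int[lebesgue_rV n]_x F (x + v) = \int[lebesgue_rV n]_x F x.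
Proof.
move=> mF; rewrite /Rintegral; congr fine.
rewrite integralE [RHS]integralE; congr (_ - _)%E.
- rewrite -(ge0_integral_rV_shift v (F := ((EFin \o F)^\+)%E))//.
    by apply: eq_integral => x _; rewrite !funeposE.
  by apply: measurable_funepos; exact/measurable_EFinP.
- rewrite -(ge0_integral_rV_shift v (F := ((EFin \o F)^\-)%E))//.
    by apply: eq_integral => x _; rewrite !funenegE.
  by apply: measurable_funeneg; exact/measurable_EFinP.
Qed.

Lemma integrable_rV_shift n (v : 'rV[R]_n) (F : 'rV[R]_n -> R) :
  (lebesgue_rV n).-integrable setT (EFin \o F) ->
  (lebesgue_rV n).-integrable setT (EFin \o (fun x => F (x + v))).
Proof.
move=> LF; have mF := integrable_measurable LF.
have /integrableP[_ Foo] := LF.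
apply/integrableP; split.
  apply/measurable_EFinP; exact: measurableT_comp mF (measurable_rVD v).
rewrite (ge0_integral_rV_shift v (F := fun x => `|(EFin \o F) x|%E))//.
by apply: measurableT_comp => //; exact/measurable_EFinP.
Qed.

End rV_integrals.

(** * Boxes, measurability and products on row vectors *)

Section rV_topology.
Context {R : realType} {n : nat}.
Implicit Types x c : 'rV[R]_n.

Lemma rV_norm_ltP x (r : R) : 0 < r ->
  `|x| < r <-> forall i, `|x ord0 i| < r.
Proof.
move=> r0; rewrite [X in X < _]/Num.norm /= mx_normrE; split.
  by move=> /bigmax_ltP[_ H] i; exact: (H (ord0, i)).
by move=> H; apply/bigmax_ltP; split => // -[i j] _ /=; rewrite (ord1 i).
Qed.

Lemma rV_norm_leP x (r : R) : 0 <= r ->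
  `|x| <= r <-> forall i, `|x ord0 i| <= r.
Proof.
move=> r0; rewrite [X in X <= _]/Num.norm /= mx_normrE; split.
  by move=> /bigmax_leP[_ H] i; exact: (H (ord0, i)).
by move=> H; apply/bigmax_leP; split => // -[i j] _ /=; rewrite (ord1 i).
Qed.

Lemma rV_coord_le_norm x i : `|x ord0 i| <= `|x|.
Proof. by move: i; apply/(rV_norm_leP x (normr_ge0 x)). Qed.

Definition rV_box c (r : R) : set 'rV[R]_n :=
  [set x | forall i, `|x ord0 i - c ord0 i| < r].

(** The norm on row vectors is the maximum norm, so that its balls are boxes. *)
Lemma rV_boxE c (r : R) : 0 < r -> rV_box c r = ball c r.
Proof.
move=> r0; rewrite -ball_normE; apply/seteqP; split => x.
  move=> H; apply/(rV_norm_ltP _ r0) => i.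
  by rewrite !mxE distrC; exact: H.
by move=> /(rV_norm_ltP _ r0) H i; have := H i; rewrite !mxE distrC.
Qed.

Lemma compact_rV_ball c (r : R) : compact (closed_ball c r).
Proof.
have [r0|r0] := leP r 0; first by rewrite closed_ball0//; exact: compact0.
apply: bounded_closed_compact; last exact: closed_ball_closed.
exists (`|c| + r); split; first exact: num_real.
move=> M HM y; rewrite closed_ballE// /closed_ball_ /= => cy.
rewrite -[y](addrNK c) (le_trans (ler_normD _ _))// addrC.
by rewrite (le_trans _ (ltW HM))// lerD2l distrC.
Qed.

Lemma measurable_rV_box c (r : R) : measurable (rV_box c r).
Proof.
rewrite (_ : rV_box c r = \bigcap_(i in [set: 'I_n])
    (rV_coord i @^-1` [set` `](c ord0 i - r), (c ord0 i + r)[])); last first.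
  apply/seteqP; split => x.
    by move=> H i _; have := H i; rewrite /rV_coord /= in_itv /= ltr_distl.
  by move=> H i; have := H i I; rewrite /rV_coord /= in_itv /= ltr_distl.
apply: fin_bigcap_measurable => // i _.
rewrite -[X in measurable X]setTI.
exact: (measurable_rV_coord i).
Qed.

(** The sigma-algebra is generated by the coordinates; an open set is the union
    of the countably many boxes with rational centre and radius 1/(k+1) that it
    contains. *)
Lemma open_measurable_rV (U : set 'rV[R]_n) : open U -> measurable U.
Proof.
move=> oU.
pose q (p : 'rV[rat]_n) : 'rV[R]_n := map_mx (@ratr R) p.
pose B (p : 'rV[rat]_n * nat) : set 'rV[R]_n := rV_box (q p.1) (p.2.+1%:R^-1).
pose good (p : 'rV[rat]_n * nat) := `[< B p `<=` U >].
rewrite (_ : U = \bigcup_p (if good p then B p else set0)); last first.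
  apply/seteqP; split => [x Ux|x [p _]]; last first.
    by case: ifPn => // /asboolP; exact.
  have /nbhs_ballP[e /= e0 eU] : nbhs x U by apply: open_nbhs_nbhs; split.
  have [k ke] : exists k : nat, k.+1%:R^-1 < e / 2.
    exists (Num.truncn (e / 2)^-1).
    by rewrite -[ltRHS]invrK ltf_pV2 ?posrE ?invr_gt0 ?divr_gt0// Num.Theory.truncnS_gt.
  have k0 : 0 < (k.+1%:R^-1 : R) by rewrite invr_gt0.
  have /choice[p Hp] : forall i, exists p : rat,
      `|x ord0 i - ratr p| < k.+1%:R^-1.
    move=> i; have [] := @dense_rat R (ball (x ord0 i) k.+1%:R^-1).
    - by exists (x ord0 i); exact: ballxx.
    - exact: ball_open.
    - by move=> _ [] /[swap] -[p _ <-] /= xp; exists p.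
  pose pv : 'rV[rat]_n := \row_i p i.
  have Bx : B (pv, k) x by move=> i; rewrite !mxE; exact: Hp.
  exists (pv, k) => //; rewrite /good; case: ifPn => // /asboolP[] y By.
  apply: eU; rewrite -rV_boxE// => i.
  have := By i; have := Bx i; rewrite /= !mxE => h1 h2.
  rewrite (_ : y ord0 i - _ = (y ord0 i - ratr (p i)) - (x ord0 i - ratr (p i))).
    rewrite (le_lt_trans (ler_normB _ _))// (splitr e) ltrD// (lt_trans _ ke)//.
  by rewrite opprB addrA subrK.
apply: countable_bigcupT_measurable => // p.
by case: ifPn => // _; exact: measurable_rV_box.
Qed.

Lemma continuous_measurable_rV (f : 'rV[R]_n -> R) :
  continuous f -> measurable_fun setT f.
Proof.
move=> /continuousP cf; apply: (measurability _ (RGenOpens.measurableE R)).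
move=> _ [_ [a [b ->] <-]]; rewrite setTI; apply: open_measurable_rV.
exact/cf/interval_open.
Qed.

End rV_topology.

Section box_measure.
Context {R : realType}.

Lemma lebesgue_rV_box n (c : 'rV[R]_n) (r : R) : 0 < r ->
  lebesgue_rV n (rV_box c r) = ((r *+ 2) ^+ n)%:E.
Proof.
move=> r0; elim: n c => [c|n IH c].
  rewrite expr0 (_ : rV_box c r = setT) /= ?diracT//.
  by apply/seteqP; split => // x _ [].
rewrite /= /lebesgue_rV_step /pushforward.
pose I : set (measurableTypeR R) := [set` `](c ord0 ord0 - r), (c ord0 ord0 + r)[].
rewrite (_ : @rV_cons R n @^-1` rV_box c r = I `*` rV_box (rV_uncons c).2 r); last first.
  apply/seteqP; split => -[a y]; rewrite /rV_cons /I /=.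
    move=> H; split.
      by have := H ord0; rewrite !mxE unlift_none /= in_itv/= ltr_distl.
    by move=> i; have := H (lift ord0 i); rewrite !mxE liftK.
  move=> [/= + H] i; rewrite in_itv/= -ltr_distl => Ha.
  by rewrite mxE; case: unliftP => [j ->|->] //=; have := H j; rewrite !mxE.
have mI : measurable I by exact: measurable_itv.
rewrite product_measure1E//; last exact: measurable_rV_box.
rewrite IH /I /= lebesgue_measure_itv/= lte_fin.
rewrite ltrD2l gtrN// -EFinB -EFinM exprS; congr EFin; congr (_ * _); ring.
Qed.

End box_measure.

Section product_integrals.
Context {R : realType}.
Local Notation leb := (@lebesgue_measure R).

(** Separation of the first variable, for computing integrals of products by
    induction on the dimension. *)
Lemma integrable_rV_mul n (u : R -> R) (w : 'rV[R]_n -> R) :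
  leb.-integrable setT (EFin \o u) ->
  (lebesgue_rV n).-integrable setT (EFin \o w) ->
  (lebesgue_rV n.+1).-integrable setT
    (EFin \o (fun x => u (rV_uncons x).1 * w (rV_uncons x).2)) /\
  \int[lebesgue_rV n.+1]_x (u (rV_uncons x).1 * w (rV_uncons x).2) =
  \int[leb]_a u a * \int[lebesgue_rV n]_y w y.
Proof.
move=> Lu Lw.
pose F := fun x : 'rV[R]_n.+1 => u (rV_uncons x).1 * w (rV_uncons x).2.
have mu := integrable_measurable Lu.
have mw := integrable_measurable Lw.
have mF : measurable_fun setT F.
  apply: measurable_funM.
    apply: measurableT_comp mu _.
    exact: measurableT_comp (@measurable_rV_uncons R n).
  apply: measurableT_comp mw _.
  exact: measurableT_comp (@measurable_rV_uncons R n).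
pose k := fun p : measurableTypeR R * 'rV[R]_n => u p.1 * w p.2.
have FK p : F (rV_cons p) = k p by rewrite /F rV_consK.
have mk : measurable_fun setT k.
  by apply: measurable_funM; [exact: measurableT_comp mu _|exact: measurableT_comp mw _].
have Lk : (leb \x lebesgue_rV n)%E.-integrable setT (EFin \o k).
  apply/integrable12ltyP; first exact/measurable_EFinP.
  rewrite (_ : (\int[leb]_a _)%E =
      (\int[leb]_a (`|(u a)%:E| * \int[lebesgue_rV n]_y `|(w y)%:E|))%E); last first.
    apply: eq_integral => a _; rewrite -ge0_integralZl//.
      by apply: eq_integral => y _; rewrite -EFinM -normrM.
    by apply/measurable_EFinP; exact: measurableT_comp.
  have /integrableP[_ wy] := Lw; have /integrableP[_ uy] := Lu.
  rewrite ge0_integralZr//.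
  - by rewrite lte_mul_pinfty ?ge0_fin_numE ?integral_ge0.
  - by apply/measurable_EFinP; exact: measurableT_comp.
  - exact: integral_ge0.
have LF : (lebesgue_rV n.+1).-integrable setT (EFin \o F).
  apply/integrableP; split; first exact/measurable_EFinP.
  rewrite (ge0_integral_rVS (F := fun x => `|(EFin \o F) x|%E))//; last first.
    by apply: measurableT_comp => //; exact/measurable_EFinP.
  have /integrable12ltyP := Lk; move=> /(_ ((measurable_EFinP _ _).2 mk)).
  under eq_integral => a _ do under eq_integral do rewrite /= -FK.
  by [].
split => //.
have -> : \int[lebesgue_rV n.+1]_x F x =
    fine (\int[leb \x lebesgue_rV n]_p (k p)%:E)%E.
  rewrite /Rintegral; congr fine.
  transitivity (\int[leb \x lebesgue_rV n]_p (F (rV_cons p))%:E)%E; last first.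
    by apply: eq_integral => p _; rewrite FK.
  apply: (integral_pushforward (@measurable_rV_cons R n) (D := setT)
    (f := EFin \o F)) => //; first exact/measurable_EFinP.
  rewrite preimage_setT (_ : _ \o _ = EFin \o k)//.
  by apply/funext => p /=; rewrite FK.
rewrite -(integral12_prod_meas1 Lk) -RintegralZr//.
rewrite /Rintegral; congr fine; apply: eq_integral => a _.
by rewrite /fubini_F EFinM EFin_Rintegral// -integralZl.
Qed.

End product_integrals.

(** * Integrals of derivatives *)

Section integral_of_derivative.
Context {R : realType}.
Local Notation leb := (@lebesgue_measure R).

(** The integral over [-n, n] is a difference of boundary values, which vanishes
    in the limit; it converges to the whole integral by dominated convergence. *)
Lemma Rintegral_derive0 (F f : R -> R) : continuous f ->
  (forall x : R, is_derive x (1 : R) F (f x)) -> leb.-integrable setT (EFin \o f) ->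
  F n%:R @[n --> \oo] --> 0 -> F (- n%:R) @[n --> \oo] --> 0 ->
  \int[leb]_x f x = 0.
Proof.
move=> cf dF Lf Fy FNy; rewrite /Rintegral.
have mf := integrable_measurable Lf.
pose fn n : R -> \bar R := (EFin \o f) \_ `[- n%:R, n%:R].
have cF : continuous F.
  move=> x; apply: differentiable_continuous; apply/derivable1_diffP.
  by case: (dF x).
have fnE n : (\int[leb]_x fn n.+1 x = (F n.+1%:R - F (- n.+1%:R))%:E)%E.
  rewrite -integral_mkcond /= EFinB; apply: continuous_FTC2 => //.
  - by rewrite gtrN.
  - exact: continuous_subspaceT.
  - split.
    + by move=> x _; case: (dF x).
    + by apply: cvg_at_right_filter; exact: cF.
    + by apply: cvg_at_left_filter; exact: cF.
  - by move=> x _; rewrite derive1E; exact: derive_val.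
have h1 : (\int[leb]_x fn n.+1 x)%E @[n --> \oo] --> (\int[leb]_x (f x)%:E)%E.
  apply: (@dominated_cvg _ _ _ leb setT measurableT (fun n => fn n.+1)
    (EFin \o f) (abse \o (EFin \o f))) => //.
  - move=> n; apply/(measurable_restrictT _ _).1 => //.
    by apply/measurable_EFinP; exact: measurable_funTS.
  - move=> x _; apply: cvg_near_cst; near=> n.
    rewrite /fn patchE ifT// inE /= in_itv/= -ler_norml.
    apply: ltW; apply: (lt_le_trans (Num.Theory.truncnS_gt _)).
    by rewrite ler_nat ltnS; near: n; exact: nbhs_infty_ge.
  - exact: integrable_abse.
  - move=> n x _; rewrite /fn patchE; case: ifPn => //=.
    by rewrite normr0 lee_fin.
have h2 : (\int[leb]_x fn n.+1 x)%E @[n --> \oo] --> 0%E.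
  under eq_fun do rewrite fnE.
  apply: cvg_EFin; first exact: nearW.
  rewrite -[X in _ --> X](subr0 0).
  apply: cvgB; [by rewrite (cvg_shiftS (fun n => F n%:R))|].
  by rewrite (cvg_shiftS (fun n => F (- n%:R))).
by rewrite (cvg_unique _ h1 h2).
Unshelve. all: end_near. Qed.

End integral_of_derivative.

(** * The Gaussian on the line *)

Section gauss1.
Context {R : realType}.
Local Notation leb := (@lebesgue_measure R).
Implicit Types x xi phi z : R.

Lemma is_derive_gauss_sin (xi phi z : R) :
  is_derive z (1 : R) (fun z => gauss_fun z * sin (xi * z + phi))
   (xi * (gauss_fun z * cos (xi * z + phi)) -
    2 * (z * gauss_fun z * sin (xi * z + phi))).
Proof.
apply: trigger_derive; rewrite /GRing.scale /= /gauss_fun.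
by ring.
Qed.

Lemma is_derive_gauss_cos (z phi xi : R) :
  is_derive xi (1 : R) (fun xi => gauss_fun z * cos (xi * z + phi))
   (- (z * gauss_fun z * sin (xi * z + phi))).
Proof.
apply: trigger_derive; rewrite /GRing.scale /= /gauss_fun.
by ring.
Qed.

(** Since t e^{-t} <= 1 for t = z^2/2, the second moment density is bounded by a
    multiple of a Gaussian that is twice as wide. *)
Lemma integrable_sqr_gauss :
  leb.-integrable setT (EFin \o (fun z => z ^+ 2 * gauss_fun z)).
Proof.
have := @integrable_normal_pdf R 0 1.
move=> /(integrable_scale (2 / normal_peak 1)).
have m1 : measurable_fun setT (fun z : R => z ^+ 2 * gauss_fun z).
  by apply: measurable_funM => //; exact: measurable_gauss_fun.
apply: integrable_dominated => // z.
have -> : normal_pdf 0 1 z = normal_peak 1 * expR (- (z ^+ 2 / 2)).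
  rewrite normal_pdfE ?oner_neq0//; congr (_ * expR _).
  by rewrite subr0 expr1n mulNr.
rewrite mulrA divfK; last by rewrite gt_eqF// normal_peak_gt0 ?oner_neq0.
rewrite ger0_norm ?(mulr_ge0 (sqr_ge0 _) (gauss_fun_ge0 _))// /gauss_fun.
set t := z ^+ 2 / 2; have -> : z ^+ 2 = 2 * t by rewrite /t; field.
have -> : - (2 * t) = - t + - t by ring.
have et : t * expR (- t) <= 1.
  rewrite expRN ler_pdivrMr ?expR_gt0// mul1r.
  by rewrite (le_trans _ (expR_ge1Dx _))// lerDr ler01.
by rewrite expRD mulrA ler_wpM2r ?expR_ge0// -mulrA; lra.
Qed.

Lemma integrable_id_gauss :
  leb.-integrable setT (EFin \o (fun z => z * gauss_fun z)).
Proof.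
have := integrable_add integrableT_gauss integrable_sqr_gauss.
have m1 : measurable_fun setT (fun z : R => z * gauss_fun z).
  by apply: measurable_funM => //; exact: measurable_gauss_fun.
apply: integrable_dominated => // z.
rewrite normrM (ger0_norm (gauss_fun_ge0 _)) -{2}(mul1r (gauss_fun z)) -mulrDl.
rewrite ler_wpM2r ?gauss_fun_ge0//.
rewrite -(real_normK (num_real z)); nra.
Qed.

Lemma measurable_phase (g : R -> R) xi phi : measurable_fun setT g ->
  measurable_fun setT (fun z : R => g (xi * z + phi)).
Proof.
by move=> mg; apply: measurableT_comp mg _; apply: measurable_funD.
Qed.

Lemma integrable_gauss_cos xi phi : leb.-integrable setT
  (EFin \o (fun z => gauss_fun z * cos (xi * z + phi))).
Proof.
apply: integrable_dominated integrableT_gauss.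
  apply: measurable_funM; first exact: measurable_gauss_fun.
  by apply: measurable_phase; apply: continuous_measurable_fun; exact: continuous_cos.
move=> z; rewrite normrM (ger0_norm (gauss_fun_ge0 _)).
by rewrite ler_piMr ?gauss_fun_ge0 ?cos_max.
Qed.

Lemma integrable_gauss_sin xi phi : leb.-integrable setT
  (EFin \o (fun z => z * gauss_fun z * sin (xi * z + phi))).
Proof.
apply: integrable_dominated (integrable_norm integrable_id_gauss).
  apply: measurable_funM; first exact: integrable_measurable integrable_id_gauss.
  by apply: measurable_phase; apply: continuous_measurable_fun; exact: continuous_sin.
by move=> z; rewrite normrM ler_piMr ?sin_max.
Qed.

(** Integration by parts: the two sides differ by the integral of the derivative
    of e^{-z^2} sin(xi z + phi). *)
Lemma integral_gauss_ode xi phi :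
  xi * \int[leb]_z (gauss_fun z * cos (xi * z + phi)) =
  2 * \int[leb]_z (z * gauss_fun z * sin (xi * z + phi)).
Proof.
have L1 := integrable_gauss_cos xi phi.
have L2 := integrable_gauss_sin xi phi.
have sin_gauss_le (z : R) : `|gauss_fun z * sin (xi * z + phi)| <= gauss_fun z.
  by rewrite normrM (ger0_norm (gauss_fun_ge0 _)) ler_piMr ?gauss_fun_ge0 ?sin_max.
have gauss_n0 : gauss_fun (n%:R : R) @[n --> \oo] --> (0 : R).
  exact: (cvg_comp _ _ cvgr_idn cvg_gauss_fun).
apply/eqP; rewrite -subr_eq0 -!RintegralZl// -RintegralB//; last 2 first.
- exact: integrable_scale.
- exact: integrable_scale.
apply/eqP; apply: (Rintegral_derive0 (F := fun z => gauss_fun z * sin (xi * z + phi))).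
- move=> z; apply: differentiable_continuous; apply/derivable1_diffP.
  rewrite /gauss_fun; exact: ex_derive.
- by move=> z; exact: is_derive_gauss_sin.
- exact: integrable_sub (integrable_scale _ L1) (integrable_scale _ L2).
- apply: norm_cvg0; apply: (squeeze_cvgr _ (cvg_cst 0) gauss_n0).
  by near=> n; rewrite /= normr_ge0 sin_gauss_le.
- apply: norm_cvg0; apply: (squeeze_cvgr _ (cvg_cst 0) gauss_n0).
  near=> n; rewrite /= normr_ge0 (le_trans (sin_gauss_le _))//.
  by rewrite /gauss_fun sqrrN.
Unshelve. all: end_near. Qed.

(** As a function T of xi, the integral satisfies T' = - xi/2 T, by
    differentiation under the integral sign and integration by parts; hence
    T(xi) e^{xi^2/4} is constant. *)
Lemma integral_gauss_cos xi phi :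
  \int[leb]_z (gauss_fun z * cos (xi * z + phi)) =
  Num.sqrt pi * cos phi * expR (- (xi ^+ 2 / 4)).
Proof.
pose T x := \int[leb]_z (gauss_fun z * cos (x * z + phi)).
have dT x : is_derive x (1 : R) T (- (x / 2 * T x)).
  have Ia : `]x - 1, x + 1[%classic x by rewrite /= in_itv/= gtrBl ltrDl ltr01.
  have d1 y z : is_derive y (1 : R) (fun xi => gauss_fun z * cos (xi * z + phi))
    (- (z * gauss_fun z * sin (y * z + phi))) := is_derive_gauss_cos z phi y.
  have p1 y z : partial1of2 (fun x z => gauss_fun z * cos (x * z + phi)) y z =
      - (z * gauss_fun z * sin (y * z + phi)).
    by rewrite partial1of2E; have := d1 y z => ?; exact: derive_val.
  have D1 : forall y z, `]x - 1, x + 1[%classic y -> [set: R] z ->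
      derivable ((fun x z => gauss_fun z * cos (x * z + phi)) ^~ z) y 1.
    by move=> y z _ _; case: (d1 y z).
  have G0 z : 0 <= `|z * gauss_fun z| by [].
  have D2 : forall y z, `]x - 1, x + 1[%classic y -> [set: R] z ->
      `|partial1of2 (fun x z => gauss_fun z * cos (x * z + phi)) y z|
      <= `|z * gauss_fun z|.
    by move=> y z _ _; rewrite p1 normrN normrM ler_piMr ?sin_max.
  have L1 y : `]x - 1, x + 1[%classic y ->
    leb.-integrable setT (EFin \o (fun z => gauss_fun z * cos (y * z + phi))).
    by move=> _; exact: integrable_gauss_cos.
  have LG := integrable_norm (integrable_id_gauss).
  have HD := derivable_under_integral measurableT Ia L1 D1 G0 LG D2.
  have HE := differentiation_under_integral measurableT Ia L1 D1 G0 LG D2.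
  apply: DeriveDef => //; rewrite -derive1E HE.
  have -> : x / 2 * T x = \int[leb]_z (z * gauss_fun z * sin (x * z + phi)).
    by rewrite mulrAC /T integral_gauss_ode mulrAC divff// mul1r.
  rewrite -mulN1r -RintegralZl//; last exact: integrable_gauss_sin.
  by apply: eq_Rintegral => z _; rewrite p1 mulN1r.
pose E (x : R) := expR (x ^+ 2 / 4).
have dE x : is_derive x (1 : R) E (x / 2 * E x).
  apply: trigger_derive; by rewrite /E /GRing.scale /=; field.
have T0 : T 0 = Num.sqrt pi * cos phi.
  rewrite /T; under eq_Rintegral do rewrite mul0r add0r.
  rewrite RintegralZr//; last exact: integrableT_gauss.
  by congr (_ * _); apply: Rintegral_of_EFin; exact: integralT_gauss.
have H : T xi * E xi = Num.sqrt pi * cos phi.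
  have E0 : E 0 = 1 by rewrite /E expr0n mul0r expR0.
  rewrite -T0 -[RHS]mulr1 -E0.
  apply: (@is_derive_0_is_cst R (fun x => T x * E x)) => x.
  apply: (is_derive_eq (is_deriveM (dT x) (dE x))).
  by rewrite /GRing.scale /=; ring.
by rewrite -H /E -mulrA -expRD subrr expR0 mulr1.
Qed.

End gauss1.

(** * The Gaussian on row vectors *)

Section gauss_rV.
Context {R : realType}.
Local Notation leb := (@lebesgue_measure R).

Lemma dotrV_uncons n (x y : 'rV[R]_n.+1) : dotrV x y =
  (rV_uncons x).1 * (rV_uncons y).1 + dotrV (rV_uncons x).2 (rV_uncons y).2.
Proof.
by rewrite /dotrV big_ord_recl; congr (_ + _); apply: eq_bigr => i _; rewrite !mxE.
Qed.

Lemma measurable_dotrV n (xi : 'rV[R]_n) : measurable_fun setT (dotrV xi).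
Proof.
apply: measurable_sum => i; apply: measurable_funM => //.
exact: (measurable_rV_coord i).
Qed.

Lemma dotrV_ge0 n (x : 'rV[R]_n) : 0 <= dotrV x x.
Proof. by apply: sumr_ge0 => i _; rewrite -expr2 sqr_ge0. Qed.

Definition gauss_pdf (z : R) : R := (Num.sqrt pi)^-1 * gauss_fun z.

(** Normalised so that its Fourier transform is e^{-|xi|^2/4}: it is the heat
    kernel at time 1/4. *)
Definition gauss_rV n (x : 'rV[R]_n) : R := \prod_(i < n) gauss_pdf (x ord0 i).

Lemma gauss_pdf_ge0 z : 0 <= gauss_pdf z.
Proof. by rewrite mulr_ge0 ?invr_ge0 ?sqrtr_ge0 ?gauss_fun_ge0. Qed.

Lemma gauss_rV_ge0 n (x : 'rV[R]_n) : 0 <= gauss_rV x.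
Proof. by apply: prodr_ge0 => i _; exact: gauss_pdf_ge0. Qed.

Lemma gauss_rV_uncons n (x : 'rV[R]_n.+1) :
  gauss_rV x = gauss_pdf (rV_uncons x).1 * gauss_rV (rV_uncons x).2.
Proof.
by rewrite /gauss_rV big_ord_recl; congr (_ * _); apply: eq_bigr => i _; rewrite mxE.
Qed.

Lemma integrable_gauss_pdf : leb.-integrable setT (EFin \o gauss_pdf).
Proof. exact: integrable_scale _ integrableT_gauss. Qed.

Lemma integrable_gauss_pdf_cos (xi phi : R) : leb.-integrable setT
  (EFin \o (fun z => gauss_pdf z * cos (xi * z + phi))).
Proof.
have := integrable_scale (Num.sqrt pi)^-1 (integrable_gauss_cos xi phi).
by apply: eq_integrable => // z _ /=; rewrite /gauss_pdf mulrA.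
Qed.

Lemma integral_gauss_pdf_cos (xi phi : R) :
  \int[leb]_z (gauss_pdf z * cos (xi * z + phi)) =
  cos phi * expR (- (xi ^+ 2 / 4)).
Proof.
under eq_Rintegral do rewrite /gauss_pdf -mulrA.
rewrite RintegralZl//; last exact: integrable_gauss_cos.
rewrite integral_gauss_cos !mulrA mulVf ?mul1r//.
by rewrite gt_eqF// sqrtr_gt0 pi_gt0.
Qed.

(** Real phases replace complex exponentials: the addition formula splits the
    cosine of a sum into products of one-dimensional factors, so that induction
    on the dimension needs the statement for every phase phi. *)
Lemma integrable_gauss_rV_cos n (xi : 'rV[R]_n) (phi : R) :
  (lebesgue_rV n).-integrable setT
    (EFin \o (fun z => gauss_rV z * cos (dotrV xi z + phi))) /\
  \int[lebesgue_rV n]_z (gauss_rV z * cos (dotrV xi z + phi)) =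
  cos phi * expR (- (dotrV xi xi / 4)).
Proof.
elim: n xi phi => [xi phi|n IH xi phi].
  have E z : gauss_rV (z : 'rV[R]_0) * cos (dotrV xi z + phi) = cos phi.
    by rewrite /gauss_rV /dotrV !big_ord0 mul1r add0r.
  split.
    under eq_fun do rewrite /= E.
    rewrite /=; exact: finite_measure_integrable_cst.
  under eq_Rintegral do rewrite E.
  rewrite Rintegral_cst//. rewrite [X in fine X](_ : _ = 1%E); last by rewrite /= diracT.
  by rewrite mulr1 /dotrV big_ord0 mul0r oppr0 expR0 mulr1.
set xi0 := (rV_uncons xi).1; set xi' := (rV_uncons xi).2.
have E z : gauss_rV z * cos (dotrV xi z + phi) =
   (gauss_pdf (rV_uncons z).1 * cos (xi0 * (rV_uncons z).1 + phi)) *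
   (gauss_rV (rV_uncons z).2 * cos (dotrV xi' (rV_uncons z).2 + 0)) -
   (gauss_pdf (rV_uncons z).1 * cos (xi0 * (rV_uncons z).1 + (phi - pi / 2))) *
   (gauss_rV (rV_uncons z).2 * cos (dotrV xi' (rV_uncons z).2 + - (pi / 2))).
  rewrite gauss_rV_uncons dotrV_uncons -/xi0 -/xi' addr0.
  by rewrite addrA !cosBpihalf addrAC cosD; ring.
have [L1 I1] := IH xi' 0; have [L2 I2] := IH xi' (- (pi / 2)).
have [L3 I3] := integrable_rV_mul (integrable_gauss_pdf_cos xi0 phi) L1.
have [L4 I4] := integrable_rV_mul (integrable_gauss_pdf_cos xi0 (phi - pi / 2)) L2.
split.
  under eq_fun do rewrite /= E.
  exact: integrable_sub L3 L4.
under eq_Rintegral do rewrite E.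
rewrite RintegralB// I3 I4 I1 I2 !integral_gauss_pdf_cos.
rewrite cosN cos_pihalf cos0 mul0r mulr0 subr0 mul1r -mulrA -expRD.
by rewrite dotrV_uncons -expr2; congr (_ * expR _); rewrite -opprD -mulrDl.
Qed.

Lemma integrable_gauss_rV n :
  (lebesgue_rV n).-integrable setT (EFin \o (@gauss_rV n)).
Proof.
have [+ _] := @integrable_gauss_rV_cos n 0 0.
apply: eq_integrable => // x _ /=.
rewrite [dotrV _ _]big1 ?addr0 ?cos0 ?mulr1// => i _.
by rewrite mxE mul0r.
Qed.

Lemma integral_gauss_rV n : \int[lebesgue_rV n]_z (@gauss_rV n) z = 1.
Proof.
have [_] := @integrable_gauss_rV_cos n 0 0.
have E x : dotrV (0 : 'rV[R]_n) x = 0.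
  by rewrite [dotrV _ _]big1// => i _; rewrite mxE mul0r.
under eq_Rintegral do rewrite E addr0 cos0 mulr1.
by rewrite E mul0r oppr0 expR0 cos0 mulr1.
Qed.

Lemma integrable_gauss_rV_sqr n : (lebesgue_rV n).-integrable setT
  (EFin \o (fun z => dotrV z z * @gauss_rV n z)).
Proof.
elim: n => [|n IH].
  have := @integrable0 _ _ _ (lebesgue_rV 0 : {measure set 'rV[R]_0 -> \bar R}) setT.
  by apply: eq_integrable => // x _ /=; rewrite /dotrV big_ord0 mul0r.
have L1 : leb.-integrable setT (EFin \o (fun z => z ^+ 2 * gauss_pdf z)).
  have := integrable_scale (Num.sqrt pi)^-1 (@integrable_sqr_gauss R).
  by apply: eq_integrable => // z _ /=; rewrite /gauss_pdf mulrCA.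
have [L2 _] := integrable_rV_mul L1 (@integrable_gauss_rV n).
have [L3 _] := integrable_rV_mul integrable_gauss_pdf IH.
have := integrable_add L2 L3; apply: eq_integrable => // x _.
by rewrite /= dotrV_uncons gauss_rV_uncons /=; congr EFin; ring.
Qed.

End gauss_rV.

(** * The flat exponential and mean value estimates *)

Section flat_exponential.
Context {R : realType}.

(** For x > 0, flat_exp n x = x^{-n} e^{-1/x}.  The family is closed under
    differentiation up to linear combinations, which makes smoothness an
    induction. *)
Definition flat_exp (n : nat) (x : R) : R :=
  if 0 < x then x^-1 ^+ n * expR (- x^-1) else 0.

Lemma flat_exp_npos n x : x <= 0 -> flat_exp n x = 0.
Proof. by move=> x0; rewrite /flat_exp ltNge x0. Qed.

Lemma flat_exp_ge0 n x : 0 <= flat_exp n x.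
Proof.
rewrite /flat_exp; case: ifPn => // x0.
by rewrite mulr_ge0 ?expR_ge0// exprn_ge0// invr_ge0 ltW.
Qed.

Lemma flat_exp_gt0 n x : 0 < x -> 0 < flat_exp n x.
Proof.
by move=> x0; rewrite /flat_exp x0 mulr_gt0 ?expR_gt0// exprn_gt0// invr_gt0.
Qed.

(** y^n / n! is a term of the exponential series. *)
Lemma exprn_expRN_le (y : R) n : 0 <= y -> y ^+ n * expR (- y) <= n`!%:R.
Proof.
move=> y0; rewrite expRN ler_pdivrMr ?expR_gt0//.
case: n => [|n]; first by rewrite expr0 fact0 mul1r -expR0 ler_expR.
have := expR_ge1Dxn n y0; set e := expR y => H.
have f0 : 0 < n.+1`!%:R :> R by rewrite ltr0n fact_gt0.
rewrite mulrC -ler_pdivrMr//; apply: le_trans H; lra.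
Qed.

Lemma flat_exp_le n k x : flat_exp n x <= (n + k)`!%:R * `|x| ^+ k.
Proof.
have [x0|x0] := leP x 0.
  by rewrite flat_exp_npos// mulr_ge0// exprn_ge0.
rewrite /flat_exp x0 gtr0_norm// -ler_pdivrMr ?exprn_gt0//.
rewrite mulrAC -exprVn -exprD; apply: exprn_expRN_le.
by rewrite invr_ge0 ltW.
Qed.

Lemma flat_exp_bounded n x : `|flat_exp n x| <= n`!%:R.
Proof.
rewrite ger0_norm ?flat_exp_ge0//.
by have := flat_exp_le n 0 x; rewrite addn0 expr0 mulr1.
Qed.

(** At 0 the difference quotient from the right is O(h), because
    flat_exp n x <= (n + 2)! x^2. *)
Lemma is_derive_flat_exp n (x : R) : is_derive x (1 : R) (flat_exp n)
  (flat_exp n.+2 x - n%:R * flat_exp n.+1 x).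
Proof.
have [x0|x0|->] := ltgtP x 0.
- rewrite !flat_exp_npos ?ltW// mulr0 subr0.
  apply: (@near_eq_is_derive _ _ _ (cst 0)) => //.
  near=> y; rewrite flat_exp_npos//; apply/ltW; near: y; exact: lt_nbhsl.
- pose f (x : R) := x^-1 ^+ n * expR (- x^-1).
  have df : is_derive x (1 : R) f (flat_exp n.+2 x - n%:R * flat_exp n.+1 x).
    have xn0 : x != 0 by rewrite gt_eqF.
    have dV := is_deriveV xn0 (is_derive_id x (1 : R)).
    pose F (y : R) := y ^+ n * expR (- y).
    have dF : is_derive (x^-1) (1 : R) F
        (n%:R * x^-1 ^+ n.-1 * expR (- x^-1) - x^-1 ^+ n * expR (- x^-1)).
      have d1 := is_deriveX n (is_derive_id (x^-1) (1 : R)).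
      have d2 : is_derive (x^-1) (1 : R) (fun y : R => expR (- y)) (- expR (- x^-1)).
        by apply: trigger_derive; rewrite mulrN1.
      have -> : F = (id ^+ n) * (fun y : R => expR (- y)).
        by apply/funext => y; rewrite exprfctE.
      apply: (is_derive_eq (is_deriveM d1 d2)).
      by rewrite exprfctE /GRing.scale /=; ring.
    apply: (is_derive_eq (is_derive1_comp dF dV)).
    rewrite /GRing.scale /= /flat_exp x0 -exprVn.
    by case: n {f F dF} => [|n] /=; rewrite !exprS ?expr0; ring.
  apply: near_eq_is_derive df.
  near=> y; rewrite /flat_exp /f ifT//; near: y; exact: lt_nbhsr.
- rewrite !flat_exp_npos// mulr0 subr0.
  have H : (fun h => h^-1 *: ((flat_exp n \o shift 0) (h *: (1 : R)) - flat_exp n 0))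
      @ 0^' --> (0 : R).
    apply: norm_cvg0; pose C : R := (n + 2)`!%:R.
    have C0 : (fun h : R => C * `|h|) @ 0^' --> (0 : R).
      rewrite -[X in _ --> X](mulr0 C); apply: cvgMr.
      rewrite -[X in _ --> X](normr0 R); apply: cvg_norm.
      exact: cvg_within_filter.
    apply: (squeeze_cvgr _ (cvg_cst 0) C0).
    near=> h; rewrite normr_ge0 /= /shift /= addr0.
    rewrite [_ *: 1]mulr1 (flat_exp_npos n (lexx 0)) subr0.
    have h0 : h != 0 by near: h; exact: nbhs_dnbhs_neq.
    rewrite normrM normfV ler_pdivrMl ?normr_gt0// ger0_norm ?flat_exp_ge0//.
    by rewrite mulrCA -expr2; exact: flat_exp_le.
  apply: DeriveDef; first by apply/cvg_ex; exists 0.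
  exact: cvg_lim H.
Unshelve. all: end_near. Qed.

Lemma continuous_flat_exp n : continuous (flat_exp n).
Proof.
move=> x; apply: differentiable_continuous; apply/derivable1_diffP.
by case: (is_derive_flat_exp n x).
Qed.

End flat_exponential.

Section mvt.
Context {R : realType}.

Lemma MVT_from0 (f df : R -> R) (u : R) :
  (forall x, is_derive x (1 : R) f (df x)) ->
  exists2 c, `|c| <= `|u| & f u - f 0 = df c * u.
Proof.
move=> dF; have cf : continuous f.
  move=> x; apply: differentiable_continuous; apply/derivable1_diffP.
  by case: (dF x).
have [u0|u0] := leP 0 u.
  have [c] := MVT_segment u0 (fun x _ => dF x) (continuous_subspaceT cf).
  rewrite in_itv/= subr0 => /andP[c0 cu] ->; exists c => //.
  by rewrite !ger0_norm.
have [c] := MVT_segment (ltW u0) (fun x _ => dF x) (continuous_subspaceT cf).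
rewrite in_itv/= sub0r => /andP[uc c0] H; exists c.
  by rewrite !ler0_norm ?lerN2 ?(ltW u0).
by rewrite -[LHS]opprB H mulrN opprK.
Qed.

Lemma is_derive_addl (f : R -> R) (x t a : R) :
  is_derive (x + t) (1 : R) f a -> is_derive t (1 : R) (fun t => f (x + t)) a.
Proof.
move=> df; have dg : is_derive t (1 : R) (fun t : R => x + t) 1.
  apply: (is_derive_eq (is_deriveD (is_derive_cst x t 1) (is_derive_id t 1))).
  by rewrite add0r.
by apply: (is_derive_eq (is_derive1_comp df dg)); rewrite mulr1.
Qed.

Lemma is_derive_subl (f : R -> R) (x t a : R) :
  is_derive (x - t) (1 : R) f a -> is_derive t (1 : R) (fun t => f (x - t)) (- a).
Proof.
move=> df; have dg : is_derive t (1 : R) (fun t : R => x - t) (-1).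
  apply: (is_derive_eq (is_deriveB (is_derive_cst x t 1) (is_derive_id t 1))).
  by rewrite sub0r.
by have := @is_derive1_comp _ f (fun t => x - t) t _ _ df dg; rewrite mulrN1.
Qed.

Lemma derive_lipschitz (f df : R -> R) (K : R) :
  (forall x, is_derive x (1 : R) f (df x)) -> (forall x, `|df x| <= K) ->
  forall x u, `|f (x + u) - f x| <= K * `|u|.
Proof.
move=> dF dK x u.
have dG t : is_derive t (1 : R) (fun t => f (x + t)) (df (x + t)).
  exact: is_derive_addl.
have [c _] := MVT_from0 u dG; rewrite addr0 => ->.
by rewrite normrM ler_wpM2r.
Qed.

(** Mean value theorem for u |-> f(x + u) + f(x - u), followed by the Lipschitz
    bound on f'. *)
Lemma derive_second_difference (f df ddf : R -> R) (K : R) :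
  (forall x, is_derive x (1 : R) f (df x)) ->
  (forall x, is_derive x (1 : R) df (ddf x)) -> (forall x, `|ddf x| <= K) ->
  forall x u, `|f (x + u) + f (x - u) - 2 * f x| <= 2 * K * `|u| ^+ 2.
Proof.
move=> dF dG dK x u.
have dH t : is_derive t (1 : R) (fun t => f (x + t) + f (x - t))
    (df (x + t) - df (x - t)).
  exact: is_deriveD (is_derive_addl (dF _)) (is_derive_subl (dF _)).
have [c cu] := MVT_from0 u dH; rewrite addr0 subr0 => H.
have -> : f (x + u) + f (x - u) - 2 * f x = (df (x + c) - df (x - c)) * u.
  by rewrite -H; ring.
have := derive_lipschitz dG dK (x - c) (c + c).
rewrite addrA subrK => H2.
have K0 : 0 <= K by exact: le_trans (dK 0).
rewrite normrM expr2 mulrA ler_wpM2r// (le_trans H2)//.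
have h : `|c + c| <= 2 * `|u| by apply: le_trans (ler_normD _ _) _; lra.
by have := ler_wpM2l K0 h; lra.
Qed.

End mvt.

(** * Smooth functions and second differences *)

Section lines.
Context {R : realType} {V : normedModType R}.

(** Directional derivatives are ordinary derivatives along a line, so that
    one-variable calculus applies to functions of a vector. *)
Lemma is_derive_line (f : V -> R) (x w : V) (s df : R) :
  is_derive s (1 : R) (fun h => f (x + h *: w)) df <->
  is_derive (x + s *: w) w f df.
Proof.
pose A := fun h : R => h^-1 *: (((fun h => f (x + h *: w)) \o shift s)
  (h *: (1 : R)) - f (x + s *: w)).
pose B := fun h : R => h^-1 *: ((f \o shift (x + s *: w)) (h *: w) - f (x + s *: w)).
have AB : A = B.
  apply/funext => h; rewrite /A /B /= /shift; congr (_ *: (f _ - _)).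
  by rewrite [h *: 1]mulr1 scalerDl addrCA.
split => -[D E]; apply: DeriveDef.
- by rewrite /derivable -/B -AB.
- by rewrite /derive -/B -AB.
- by rewrite /derivable -/A AB.
- by rewrite /derive -/A AB.
Qed.

End lines.

Section Ck.
Context {R : realType} {V : normedModType R}.
Implicit Types (f g : V -> R) (k : nat).

Lemma Ck_onS k f : Ck_on k.+1 setT f -> Ck_on k setT f.
Proof.
elim: k f => [f [cf _]|k IH f [cf H]]; first by split.
by split => // w; have [D C] := H w; split => //; exact: IH.
Qed.

Lemma Ck_on_cst k (c : R) : Ck_on k setT (cst c : V -> R).
Proof.
elim: k c => [c|k IH c]; (split; first by move=> x _; exact: cvg_cst) => //.
move=> w; split => [x _|]; first exact: derivable_cst.
rewrite (_ : 'D_w _ = cst 0); last by apply/funext => x; rewrite derive_cst.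
exact: IH.
Qed.

Lemma Ck_onD k f g : Ck_on k setT f -> Ck_on k setT g ->
  Ck_on k setT (fun x => f x + g x).
Proof.
elim: k f g => [f g [cf _] [cg _]|k IH f g [cf Hf] [cg Hg]].
  by split => // x Tx; apply: cvgD; [exact: cf|exact: cg].
split => [x Tx|w]; first by apply: cvgD; [exact: cf|exact: cg].
have [Df Cf] := Hf w; have [Dg Cg] := Hg w; split.
  by move=> x _; apply: derivableD; [exact: Df|exact: Dg].
rewrite (_ : 'D_w _ = fun x => 'D_w f x + 'D_w g x); first exact: IH.
by apply/funext => x; rewrite -deriveD; [|exact: Df|exact: Dg].
Qed.

Lemma Ck_onM k f g : Ck_on k setT f -> Ck_on k setT g ->
  Ck_on k setT (fun x => f x * g x).
Proof.
elim: k f g => [f g [cf _] [cg _]|k IH f g Cf Cg].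
  by split => // x Tx; apply: cvgM; [exact: cf|exact: cg].
have [[cf Hf] [cg Hg]] := (Cf, Cg).
split => [x Tx|w]; first by apply: cvgM; [exact: cf|exact: cg].
have [Df Ckf] := Hf w; have [Dg Ckg] := Hg w; split.
  by move=> x _; apply: derivableM; [exact: Df|exact: Dg].
rewrite (_ : 'D_w _ = fun x => f x * 'D_w g x + g x * 'D_w f x); last first.
  by apply/funext => x; apply: (deriveM (Df _ _) (Dg _ _)).
by apply: Ck_onD; apply: IH => //; exact: Ck_onS.
Qed.

End Ck.

Section flat_exp_coordinate.
Context {R : realType} {d : nat}.
Implicit Types (i : 'I_d) (a c : R).

Lemma is_derive_flat_exp_coord n i (a c : R) (x w : 'rV[R]_d) :
  is_derive x w (fun x => flat_exp n (c + a * x ord0 i))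
   (a * w ord0 i * (flat_exp n.+2 (c + a * x ord0 i) -
                    n%:R * flat_exp n.+1 (c + a * x ord0 i))).
Proof.
rewrite -{1}[x]addr0 -(scale0r w); apply/is_derive_line.
have dg : is_derive (0 : R) (1 : R)
    (fun h => (c + a * x ord0 i) + h * (a * w ord0 i)) (a * w ord0 i).
  apply: (is_derive_eq (is_deriveD (is_derive_cst (c + a * x ord0 i) (0 : R) 1)
    (is_deriveM (is_derive_id (0 : R) 1) (is_derive_cst (a * w ord0 i) (0 : R) 1)))).
  by rewrite /GRing.scale /=; ring.
have := @is_derive1_comp _ (flat_exp n) _ 0 _ _ (is_derive_flat_exp n _) dg.
rewrite mul0r addr0 [X in is_derive _ _ _ X]mulrC.
congr (is_derive _ _ _ _); apply/funext => h /=; congr flat_exp.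
by rewrite !mxE; ring.
Qed.

Lemma Ck_on_flat_exp_coord k n i (a c : R) :
  Ck_on k setT (fun x : 'rV[R]_d => flat_exp n (c + a * x ord0 i)).
Proof.
have cont m : {in setT, continuous (fun x : 'rV[R]_d => flat_exp m (c + a * x ord0 i))}.
  move=> x _; apply: (@continuous_comp _ _ _
    (fun x : 'rV[R]_d => c + a * x ord0 i) (flat_exp m)); last first.
    exact: continuous_flat_exp.
  have cx := @coord_continuous R 1 d ord0 i x.
  exact: (cvgD (cvg_cst c) (cvgM (cvg_cst a) cx)).
elim: k n => [n|k IH n]; (split; first by move=> x xT; exact: (cont _ x xT)) => //.
move=> w; split.
  by move=> x _; case: (is_derive_flat_exp_coord n i a c x w).
rewrite (_ : 'D_w _ = fun x => cst (a * w ord0 i) x *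
    (flat_exp n.+2 (c + a * x ord0 i) +
     cst (- n%:R) x * flat_exp n.+1 (c + a * x ord0 i))).
  apply: Ck_onM; first exact: Ck_on_cst.
  by apply: Ck_onD => //; apply: Ck_onM; first exact: Ck_on_cst.
apply/funext => x /=; have := is_derive_flat_exp_coord n i a c x w => ?.
by rewrite derive_val mulNr.
Qed.

End flat_exp_coordinate.

Section second_order.
Context {R : realType} {d : nat}.
Implicit Types (f g : 'rV[R]_d -> R).

(** One constant for the function, its first and its second differences: this
    form is stable under products, and it is all the regularity of the cutoff
    that the integral estimates use. *)
Definition second_order_bounded (K : R) f :=
  [/\ 0 <= K, forall x, `|f x| <= K, forall x v, `|f (x + v) - f x| <= K * `|v| &
   forall x v, `|f (x + v) + f (x - v) - 2 * f x| <= K * `|v| ^+ 2].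

Lemma second_order_bounded_cst (c : R) : second_order_bounded `|c| (cst c).
Proof.
split => //= x v; first by rewrite subrr normr0 mulr_ge0.
by rewrite (_ : _ - _ = 0) ?normr0 ?mulr_ge0 ?exprn_ge0//; ring.
Qed.

(** The second difference of a product is the second difference of each factor
    times the other, plus products of first differences. *)
Lemma second_order_boundedM K1 K2 f g :
  second_order_bounded K1 f -> second_order_bounded K2 g ->
  second_order_bounded (4 * (K1 * K2)) (fun x => f x * g x).
Proof.
move=> [K10 f0 f1 f2] [K20 g0 g1 g2].
have K0 : 0 <= K1 * K2 by rewrite mulr_ge0.
split.
- by rewrite mulr_ge0.
- move=> x; rewrite normrM (le_trans (ler_pM _ _ (f0 x) (g0 x)))//; lra.
- move=> x v.
  have -> : f (x + v) * g (x + v) - f x * g x =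
     (f (x + v) - f x) * g (x + v) + f x * (g (x + v) - g x) by ring.
  rewrite (le_trans (ler_normD _ _))// !normrM.
  have h1 := ler_pM (normr_ge0 _) (normr_ge0 _) (f1 x v) (g0 (x + v)).
  have h2 := ler_pM (normr_ge0 _) (normr_ge0 _) (f0 x) (g1 x v).
  have h3 := mulr_ge0 K0 (normr_ge0 v).
  by lra.
- move=> x v.
  set fp := f (x + v); set fm := f (x - v); set gp := g (x + v); set gm := g (x - v).
  have -> : fp * gp + fm * gm - 2 * (f x * g x) =
     (fp + fm - 2 * f x) * g x + f x * (gp + gm - 2 * g x)
     + (fp - f x) * (gp - g x) + (fm - f x) * (gm - g x) by ring.
  have h1 := ler_pM (normr_ge0 _) (normr_ge0 _) (f2 x v) (g0 x).
  have h2 := ler_pM (normr_ge0 _) (normr_ge0 _) (f0 x) (g2 x v).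
  have h3 := ler_pM (normr_ge0 _) (normr_ge0 _) (f1 x v) (g1 x v).
  have h4 := ler_pM (normr_ge0 _) (normr_ge0 _) (f1 x (- v)) (g1 x (- v)).
  rewrite normrN in h4.
  rewrite -/fp -/fm -/gp -/gm -!normrM in h1 h2 h3 h4.
  move: h1 h2 h3 h4; set A := (_ - _) * g x; set B := f x * _.
  set C := _ * (gp - _); set D := _ * (gm - _) => h1 h2 h3 h4.
  have := ler_normD (A + B + C) D; have := ler_normD (A + B) C.
  by have := ler_normD A B; lra.
Qed.

(** The bounds 2 on the first derivative and 36 on the second follow from the
    factorial bounds on [flat_exp]. *)
Lemma second_order_bounded_flat_exp i (a c : R) : `|a| <= 1 ->
  second_order_bounded 100 (fun x : 'rV[R]_d => flat_exp 0 (c + a * x ord0 i)).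
Proof.
move=> a1.
have dE (x : R) : is_derive x (1 : R) (flat_exp 0) (flat_exp 2 x).
  by apply: (is_derive_eq (is_derive_flat_exp 0 x)); rewrite mul0r subr0.
have dF (x : R) := is_derive_flat_exp 2 x.
have bF (x : R) : `|flat_exp 2 x| <= 2 by exact: flat_exp_bounded.
have bG (x : R) : `|flat_exp 4 x - 2 * flat_exp 3 x| <= 36.
  have h4 : `|flat_exp 4 x| <= 24 by exact: flat_exp_bounded.
  have h3 : `|flat_exp 3 x| <= 6 by exact: flat_exp_bounded.
  by rewrite (le_trans (ler_normB _ _))// normrM ger0_norm//; lra.
have av (v : 'rV[R]_d) : `|a * v ord0 i| <= `|v|.
  rewrite normrM -[leRHS]mul1r ler_pM//; exact: rV_coord_le_norm.
split => //.
- move=> x; have h : `|flat_exp 0 (c + a * x ord0 i)| <= 1 by exact: flat_exp_bounded.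
  by rewrite (le_trans h)// ler1n.
- move=> x v.
  have -> : c + a * (x + v) ord0 i = (c + a * x ord0 i) + a * v ord0 i.
    by rewrite mxE; ring.
  rewrite (le_trans (derive_lipschitz dE bF _ _))//.
  by have := av v; have := normr_ge0 v; lra.
- move=> x v.
  have -> : c + a * (x + v) ord0 i = (c + a * x ord0 i) + a * v ord0 i.
    by rewrite mxE; ring.
  have -> : c + a * (x - v) ord0 i = (c + a * x ord0 i) - a * v ord0 i.
    by rewrite !mxE; ring.
  rewrite (le_trans (derive_second_difference dE dF bG _ _))//.
  have : `|a * v ord0 i| ^+ 2 <= `|v| ^+ 2 by rewrite lerXn2r ?nnegrE.
  by have := sqr_ge0 `|v|; lra.
Qed.

End second_order.

(** * Smooth cutoffs *)

Section cutoff.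
Context {R : realType} {d : nat}.
Implicit Types (c x v : 'rV[R]_d) (r : R).
Local Notation mu := (lebesgue_rV d).

Lemma Ck_on_prod k (I : Type) (s : seq I) (F : I -> 'rV[R]_d -> R) :
  (forall i, Ck_on k setT (F i)) ->
  Ck_on k setT (fun x => \prod_(i <- s) F i x).
Proof.
move=> CF; elim: s => [|i s IH].
  rewrite (_ : (fun x => _) = cst 1); first exact: Ck_on_cst.
  by apply/funext => x; rewrite big_nil.
rewrite (_ : (fun x => _) = (fun x => F i x * \prod_(i <- s) F i x)).
  exact: Ck_onM.
by apply/funext => x; rewrite big_cons.
Qed.

Lemma second_order_bounded_prod (I : Type) (s : seq I) (F : I -> 'rV[R]_d -> R) :
  (forall i, exists K, second_order_bounded K (F i)) ->
  exists K, second_order_bounded K (fun x => \prod_(i <- s) F i x).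
Proof.
move=> CF; elim: s => [|i s [K1 H1]].
  exists `|1|; rewrite (_ : (fun x => _) = cst 1).
    exact: second_order_bounded_cst.
  by apply/funext => x; rewrite big_nil.
have [K2 H2] := CF i; exists (4 * (K2 * K1)).
rewrite (_ : (fun x => _) = (fun x => F i x * \prod_(i <- s) F i x)).
  exact: second_order_boundedM.
by apply/funext => x; rewrite big_cons.
Qed.

(** A smooth function, positive in the box of centre c and radius r and zero
    outside; the affine arguments are written c + a x to match the derivative
    lemmas of [flat_exp]. *)
Definition cutoff r c x : R := \prod_(i < d)
  (flat_exp 0 ((r + c ord0 i) + (- 1) * x ord0 i) *
   flat_exp 0 ((r - c ord0 i) + 1 * x ord0 i)).

Lemma cutoff_ge0 r c x : 0 <= cutoff r c x.
Proof. by apply: prodr_ge0 => i _; rewrite mulr_ge0 ?flat_exp_ge0. Qed.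

Lemma cutoff_support r c x : 0 < r -> ~ rV_box c r x -> cutoff r c x = 0.
Proof.
move=> r0 /existsNP[i /negP]; rewrite -leNgt => H.
rewrite /cutoff (bigD1 i)//=.
have [h|h] := leP 0 (x ord0 i - c ord0 i).
  rewrite ger0_norm// in H.
  by rewrite [X in X * _ * _]flat_exp_npos ?mul0r//; lra.
rewrite ltr0_norm// in H.
by rewrite [X in _ * X * _]flat_exp_npos ?mulr0 ?mul0r//; lra.
Qed.

Lemma cutoff_shift r c x v : cutoff r c (x - v) = cutoff r (c + v) x.
Proof.
by apply: eq_bigr => i _; rewrite !mxE; congr (flat_exp 0 _ * flat_exp 0 _); ring.
Qed.

Lemma smooth_cutoff r c : smooth_on setT (cutoff r c).
Proof.
by move=> k; apply: Ck_on_prod => i; apply: Ck_onM; exact: Ck_on_flat_exp_coord.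
Qed.

Lemma continuous_cutoff r c : continuous (cutoff r c).
Proof. by move=> x; have [H _] := smooth_cutoff r c 0; apply: H; rewrite inE. Qed.

Lemma test_function_cutoff r c : 0 < r -> test_function (cutoff r c).
Proof.
move=> r0; split; first exact: smooth_cutoff.
exists (closed_ball c r); first exact: (@compact_rV_ball _ _ c r).
move=> x nx; apply: cutoff_support => // bx; apply: nx.
by apply: subset_closed_ball; rewrite -rV_boxE.
Qed.

Lemma second_order_bounded_cutoff r c : exists K, second_order_bounded K (cutoff r c).
Proof.
apply: second_order_bounded_prod => i; exists (4 * (100 * 100)).
by apply: second_order_boundedM; apply: second_order_bounded_flat_exp; rewrite ?normrN normr1.
Qed.

Lemma measurable_cutoff r c : measurable_fun setT (cutoff r c).
Proof. by apply: continuous_measurable_rV; exact: continuous_cutoff. Qed.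

Lemma lebesgue_rV_box_lty c r : 0 < r -> (mu (rV_box c r) < +oo)%E.
Proof. by move=> r0; rewrite lebesgue_rV_box// ltry. Qed.

Lemma integrable_cutoff r c : 0 < r -> mu.-integrable setT (EFin \o cutoff r c).
Proof.
move=> r0; have [K [K0 bK _ _]] := second_order_bounded_cutoff r c.
apply: (@integrable_finite_support _ _ _ _ _ (rV_box c r) K) => //.
- exact: measurable_rV_box.
- exact: lebesgue_rV_box_lty.
- exact: measurable_cutoff.
- by move=> x; exact: cutoff_support r0.
Qed.

Lemma integral_cutoff_gt0 r c : 0 < r -> 0 < \int[mu]_x cutoff r c x.
Proof.
move=> r0; set e : R := flat_exp 0 (r / 2).
have r2 : 0 < r / 2 by rewrite divr_gt0.
have e0 : 0 < e by exact: flat_exp_gt0.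
have ee0 : 0 <= (e * e) ^+ d by rewrite exprn_ge0 ?mulr_ge0 ?ltW.
have fE (y : R) : r / 2 <= y -> e <= flat_exp 0 y.
  move=> ry; have y0 : 0 < y by exact: lt_le_trans ry.
  rewrite /e /flat_exp r2 y0 !expr0 !mul1r ler_expR lerN2.
  by rewrite lef_pV2.
have LI : mu.-integrable setT (EFin \o (fun x => (e * e) ^+ d * \1_(rV_box c (r / 2)) x)).
  apply: (@integrable_finite_support _ _ _ _ _ (rV_box c (r / 2)) ((e * e) ^+ d)) => //.
  - exact: measurable_rV_box.
  - exact: lebesgue_rV_box_lty.
  - by apply: measurable_funM => //; apply: measurable_indic; exact: measurable_rV_box.
  - move=> x; rewrite indicE normrM (ger0_norm ee0) ler_piMr//.
    by rewrite normr_nat lern1 leq_b1.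
  - by move=> x nx; rewrite indicE memNset ?mulr0.
have H : \int[mu]_x ((e * e) ^+ d * \1_(rV_box c (r / 2)) x) <= \int[mu]_x cutoff r c x.
  apply: le_Rintegral => //; first exact: integrable_cutoff r0.
  move=> x _; rewrite indicE; have [|_] := boolP (x \in _); last first.
    by rewrite mulr0 cutoff_ge0.
  rewrite inE => Hx; rewrite mulr1 /cutoff -[in X in X <= _](card_ord d) -prodr_const.
  apply: ler_prod => i _; apply/andP; split; first by rewrite mulr_ge0 ?ltW.
  have := Hx i; rewrite ltr_norml => /andP[h1 h2].
  by apply: ler_pM; rewrite ?(ltW e0)//; apply: fE; lra.
apply: lt_le_trans H; rewrite /Rintegral.
under eq_integral do rewrite EFinM.
rewrite ge0_integralZl//; last first.
  by apply/measurable_EFinP; apply: measurable_indic; exact: measurable_rV_box.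
rewrite integral_indic//; last exact: measurable_rV_box.
rewrite setIT [X in fine (_ * X)%E](_ : _ = ((r / 2 *+ 2) ^+ d)%:E).
  by rewrite -EFinM /= mulr_gt0 ?exprn_gt0 ?mulr_gt0// mulrn_wgt0.
exact: lebesgue_rV_box.
Qed.

End cutoff.

(** * Multipliers of integrable functions and superpositions of heat kernels *)

Section sigma_finite_product.
Context {R : realType} {d1 d2 : measure_display}
  {X : measurableType d1} {T : measurableType d2}
  (mu : {sigma_finite_measure set X -> \bar R})
  (P : {sigma_finite_measure set T -> \bar R}).

(** The product measure again, declared sigma-finite so that it can itself serve
    as a space of parameters and be a factor of a further product. *)
Definition sfprod : set (X * T) -> \bar R := (mu \x P)%E.

HB.instance Definition _ := Measure.on sfprod.

Let sfprod_sigma_finite : sigma_finite setT sfprod.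
Proof.
have /sigma_finiteP[F [TF ndF Foo]] := sigma_finiteT mu.
have /sigma_finiteP[G [TG ndG Goo]] := sigma_finiteT P.
exists (fun k => F k `*` G k).
  apply/esym; rewrite -subTset => -[x t] _.
  have [k _ Fk] : (\bigcup_i F i) x by rewrite -TF.
  have [l _ Gl] : (\bigcup_i G i) t by rewrite -TG.
  exists (maxn k l) => //; split.
  - by move: Fk; exact/subsetPset/ndF/leq_maxl.
  - by move: Gl; exact/subsetPset/ndG/leq_maxr.
move=> k; have [mF Fk] := Foo k; have [mG Gk] := Goo k.
split; first exact: measurableX.
by rewrite /sfprod product_measure1E// lte_mul_pinfty// ge0_fin_numE.
Qed.

HB.instance Definition _ := Measure_isSigmaFinite.Build _ _ _
  sfprod sfprod_sigma_finite.

End sigma_finite_product.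

Section product_Rintegral.
Context {R : realType} {d1 d2 : measure_display}
  {X : measurableType d1} {T : measurableType d2}
  (mu : {sigma_finite_measure set X -> \bar R})
  (P : {sigma_finite_measure set T -> \bar R}).

Lemma Rintegral_prod (k : X * T -> R) :
  (mu \x P)%E.-integrable setT (EFin \o k) ->
  \int[(mu \x P)%E]_p k p = \int[mu]_x (\int[P]_t k (x, t)).
Proof.
move=> Lk; rewrite [LHS]/Rintegral -(integral12_prod_meas1 Lk) /Rintegral.
congr fine; apply: ae_eq_integral => //.
- exact: measurable_fubini_F Lk.
- apply/measurable_EFinP.
  exact: integrable_measurable (integrable_superposition Lk).
- have := ae_integrable1 Lk; apply: filterS => x Lx _ /=.
  by rewrite /fubini_F EFin_Rintegral.
Qed.

Lemma integrable_prod_swap (k : X * T -> R) :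
  (mu \x P)%E.-integrable setT (EFin \o k) ->
  (P \x mu)%E.-integrable setT (EFin \o (fun p => k (p.2, p.1))).
Proof.
move=> Lk; have mk := integrable_measurable Lk.
apply/integrable12ltyP.
  by apply/measurable_EFinP; apply: measurableT_comp mk _; exact: measurable_fun_pair.
have /integrable21ltyP := Lk; apply; exact/measurable_EFinP.
Qed.

(** Tonelli's theorem, with a bound on the slices that is only required to be
    integrable in the parameter. *)
Lemma integrable_prod_bound (k : X * T -> R) (b : T -> R) :
  measurable_fun setT k ->
  (forall t, mu.-integrable setT (EFin \o (fun x => k (x, t)))) ->
  (forall t, \int[mu]_x `|k (x, t)| <= b t) -> P.-integrable setT (EFin \o b) ->
  (mu \x P)%E.-integrable setT (EFin \o k).
Proof.
move=> mk Lk kb Lb; apply/integrable21ltyP; first exact/measurable_EFinP.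
have b0 t : 0 <= b t by apply: le_trans (kb t); exact: Rintegral_ge0.
have /integrableP[_] := Lb; apply: le_lt_trans.
apply: ge0_le_integral => //.
- by move=> t _; exact: integral_ge0.
- apply: (measurable_fun_fubini_tonelli_G (fun p => `|(EFin \o k) p|%E)) => //.
  by apply: measurableT_comp => //; exact/measurable_EFinP.
- by apply: measurableT_comp => //; exact: measurable_int Lb.
- move=> t _; rewrite /= ger0_norm//.
  apply: (@le_trans _ _ (\int[mu]_x `|k (x, t)|)%:E); last by rewrite lee_fin.
  by rewrite EFin_Rintegral//; exact: integrable_norm (Lk t).
Qed.

Lemma integrable_prod_mul (u : X -> R) (w : T -> R) :
  mu.-integrable setT (EFin \o u) -> P.-integrable setT (EFin \o w) ->
  (mu \x P)%E.-integrable setT (EFin \o (fun p => u p.1 * w p.2)).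
Proof.
move=> Lu Lw; have mu' := integrable_measurable Lu.
have mw := integrable_measurable Lw.
apply: (@integrable_prod_bound _ (fun t => (\int[mu]_x `|u x|) * `|w t|)) => //.
- by apply: measurable_funM; [exact: measurableT_comp mu' _|exact: measurableT_comp mw _].
- move=> t; have := integrable_scale (w t) Lu.
  by apply: eq_integrable => // x _ /=; rewrite mulrC.
- move=> t; under eq_Rintegral do rewrite normrM /=.
  by rewrite RintegralZr//; exact: integrable_norm.
- exact: integrable_scale _ (integrable_norm Lw).
Qed.

End product_Rintegral.

Section symbols.
Context {R : realType} {d : nat}.
Local Notation X := 'rV[R]_d.
Local Notation mu := (@lebesgue_rV R d).
Implicit Types (f g h : X -> R) (m : X -> R) (xi x v : X).

(** The identity of Fourier transforms on real phases: phi = 0 and phi = - pi/2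
    give the real and imaginary parts, and the other phases make the class
    stable under translations without complex numbers. *)
Definition multiplies m f h := forall xi (phi : R),
  \int[mu]_x (cos (dotrV xi x + phi) * h x) =
  m xi * \int[mu]_x (cos (dotrV xi x + phi) * f x).

Lemma measurable_cos_phase xi phi :
  measurable_fun setT (fun x : X => cos (dotrV xi x + phi)).
Proof.
apply: measurableT_comp; last by apply: measurable_funD => //; exact: measurable_dotrV.
by apply: continuous_measurable_fun; exact: continuous_cos.
Qed.

Lemma multiplies_fourier m f h : mu.-integrable setT (EFin \o f) ->
  mu.-integrable setT (EFin \o h) -> multiplies m f h ->
  fourier_multiplier_L1 m f h.
Proof.
move=> Lf Lh H; split => // xi; rewrite /fourier.
have E g : \int[mu]_x (g x * cos (dotrV xi x)) =
    \int[mu]_x (cos (dotrV xi x + 0) * g x).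
  by apply: eq_Rintegral => x _; rewrite addr0 mulrC.
have F g : \int[mu]_x (g x * sin (dotrV xi x)) =
    \int[mu]_x (cos (dotrV xi x + (- (pi / 2))) * g x).
  by apply: eq_Rintegral => x _; rewrite cosBpihalf mulrC.
rewrite !E !F !H; apply/eqP; rewrite eq_complex /=.
by rewrite !mul0r subr0 addr0 mulrN !eqxx.
Qed.

Lemma integral_phase_shift f xi (phi : R) v :
  mu.-integrable setT (EFin \o f) ->
  \int[mu]_x (cos (dotrV xi x + phi) * f (x - v)) =
  \int[mu]_x (cos (dotrV xi x + (dotrV xi v + phi)) * f x).
Proof.
move=> Lf; have mf := integrable_measurable Lf.
rewrite -(integral_rV_shift v (F := fun x => _ * f (x - v))); last first.
  apply: measurable_funM; first exact: measurable_cos_phase.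
  by apply: measurableT_comp mf _; exact: measurable_rVD.
apply: eq_Rintegral => x _; rewrite addrK; congr (cos _ * _).
by rewrite addrA; congr (_ + _); rewrite /dotrV -big_split; apply: eq_bigr => i _; rewrite mxE mulrDr.
Qed.

(** Averaging over x - v and x + v multiplies the Fourier transform by
    cos(xi . v). *)
Lemma integral_phase_sym f xi (phi : R) v : mu.-integrable setT (EFin \o f) ->
  \int[mu]_x (cos (dotrV xi x + phi) * f (x - v)) +
  \int[mu]_x (cos (dotrV xi x + phi) * f (x + v)) =
  2 * cos (dotrV xi v) * \int[mu]_x (cos (dotrV xi x + phi) * f x).
Proof.
move=> Lf; rewrite -[in X in _ + X](opprK v) !integral_phase_shift//.
have L psi : mu.-integrable setT (EFin \o (fun x => cos (dotrV xi x + psi) * f x)).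
  apply: (integrable_bounded_mul (M := 1)) => //; first exact: measurable_cos_phase.
  by move=> x; exact: cos_max.
rewrite -RintegralD// -RintegralZl//; apply: eq_Rintegral => x _.
have -> : dotrV xi (- v) = - dotrV xi v.
  by rewrite /dotrV -sumrN; apply: eq_bigr => i _; rewrite mxE mulrN.
rewrite !(addrCA (dotrV xi x)) (cosD (dotrV xi v)) (cosD (- dotrV xi v)).
by rewrite cosN sinN; ring.
Qed.

End symbols.

Section heat_superposition.
Context {R : realType} {d : nat}.
Local Notation X := 'rV[R]_d.
Local Notation mu := (@lebesgue_rV R d).
Context {dT : measure_display} {T : measurableType dT}
  (P : {sigma_finite_measure set T -> \bar R}).
Variables (a b s : T -> R) (f : X -> R).
Hypothesis (ma : measurable_fun setT a) (mb : measurable_fun setT b)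
  (ms : measurable_fun setT s) (Lf : mu.-integrable setT (EFin \o f)).

(** Integrating over z with the Gaussian weight turns the symmetric average over
    x - s z and x + s z into a Gaussian average of width s: the kernel stands for
    a(t) f + b(t) e^{(s(t)^2/4) Laplacian} f, to be integrated over t. *)
Definition heat_kernel (p : X * (T * X)) : R :=
  let: (x, (t, z)) := p in
  gauss_rV z * (a t * f x + b t / 2 * (f (x - s t *: z) + f (x + s t *: z))).

Let mf := integrable_measurable Lf.

Lemma measurable_heat_kernel : measurable_fun setT heat_kernel.
Proof.
rewrite (_ : heat_kernel = fun p => gauss_rV p.2.2 * (a p.2.1 * f p.1 +
  b p.2.1 / 2 * (f (p.1 - s p.2.1 *: p.2.2) + f (p.1 + s p.2.1 *: p.2.2)))); last first.
  by apply/funext => -[x [t z]].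
have m22 : measurable_fun setT (fun p : X * (T * X) => p.2.2).
  exact: measurableT_comp (@measurable_snd _ _ _ _) (@measurable_snd _ _ _ _).
have m21 : measurable_fun setT (fun p : X * (T * X) => p.2.1).
  exact: measurableT_comp (@measurable_fst _ _ _ _) (@measurable_snd _ _ _ _).
have mV (c : R) : measurable_fun setT (fun p : X * (T * X) => p.1 + (c * s p.2.1) *: p.2.2).
  apply: measurable_fun_rV => i.
  rewrite (_ : _ \o _ = fun p => rV_coord i p.1 + c * s p.2.1 * rV_coord i p.2.2).
    apply: measurable_funD.
      exact: measurableT_comp (measurable_rV_coord i) _.
    apply: measurable_funM; last exact: measurableT_comp (measurable_rV_coord i) _.
    by apply: measurable_funM => //; exact: measurableT_comp ms _.
  by apply/funext => p; rewrite /rV_coord /= !mxE.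
have mf1 := measurableT_comp mf (mV (-1)); have mf2 := measurableT_comp mf (mV 1).
apply: measurable_funM.
  apply: measurableT_comp m22; exact: integrable_measurable (integrable_gauss_rV d).
apply: measurable_funD.
  apply: measurable_funM; first exact: measurableT_comp ma m21.
  exact: measurableT_comp mf _.
apply: measurable_funM.
  by apply: measurable_funM => //; exact: measurableT_comp mb m21.
apply: measurable_funD.
  move: mf1; congr measurable_fun; apply/funext => p /=.
  by rewrite mulN1r scaleNr.
by move: mf2; congr measurable_fun; apply/funext => p /=; rewrite mul1r.
Qed.

Lemma integrable_heat_kernel_slice tz :
  mu.-integrable setT (EFin \o (fun x => heat_kernel (x, tz))).
Proof.
case: tz => t z /=; apply: integrable_scale; apply: integrable_add.
  exact: integrable_scale.
apply: integrable_scale; apply: integrable_add; exact: integrable_rV_shift.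
Qed.

Hypothesis Lk : (mu \x sfprod P mu)%E.-integrable setT (EFin \o heat_kernel).

Definition heat_average (x : X) : R := \int[sfprod P mu]_tz heat_kernel (x, tz).

Lemma integrable_heat_average : mu.-integrable setT (EFin \o heat_average).
Proof. exact: (integrable_superposition Lk). Qed.

Lemma integral_heat_average (F : X -> R) (M : R) : measurable_fun setT F ->
  (forall x, `|F x| <= M) ->
  \int[mu]_x (F x * heat_average x) =
  \int[P]_t (\int[mu]_z (gauss_rV z * (a t * \int[mu]_x (F x * f x) +
    b t / 2 * (\int[mu]_x (F x * f (x - s t *: z)) +
               \int[mu]_x (F x * f (x + s t *: z)))))).
Proof.
move=> mF FM; rewrite (integral_superposition_mul Lk mF FM).
pose k' := fun p : X * (T * X) => F p.1 * heat_kernel p.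
have Lk' : (mu \x sfprod P mu)%E.-integrable setT (EFin \o k').
  apply: (integrable_bounded_mul (M := M)) => //; exact: measurableT_comp.
have LG := integrable_superposition (integrable_prod_swap Lk').
have := Rintegral_prod LG; rewrite /k' /= => ->.
apply: eq_Rintegral => t _; apply: eq_Rintegral => z _.
have LF g : mu.-integrable setT (EFin \o g) ->
    mu.-integrable setT (EFin \o (fun x => F x * g x)).
  by move=> Lg; apply: (integrable_bounded_mul (M := M)).
have L1 := LF _ Lf.
have L2 := LF _ (integrable_rV_shift (- (s t *: z)) Lf).
have L3 := LF _ (integrable_rV_shift (s t *: z) Lf).
rewrite -RintegralD// -!RintegralZl//; last exact: integrable_add.
rewrite -RintegralD//; last 2 first.
- exact: integrable_scale.
- by apply: integrable_scale; exact: integrable_add.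
rewrite -RintegralZl//; last first.
  by apply: integrable_add; apply: integrable_scale => //; exact: integrable_add.
by apply: eq_Rintegral => x _; rewrite /heat_kernel; ring.
Qed.

(** The Gaussian average over z of cos(s xi . z) is e^{-s^2 |xi|^2/4}. *)
Lemma multiplies_heat_average :
  (forall r, 0 <= r -> P.-integrable setT
    (EFin \o (fun t => a t + b t * expR (- (s t ^+ 2 / 4 * r))))) ->
  multiplies
  (fun xi => \int[P]_t (a t + b t * expR (- (s t ^+ 2 / 4 * dotrV xi xi))))
  f heat_average.
Proof.
move=> Lab xi phi.
have mc := measurable_cos_phase xi phi.
have bc x : `|cos (dotrV xi x + phi)| <= 1 by exact: cos_max.
have E : \int[mu]_x (cos (dotrV xi x + phi) * heat_average x) =
   \int[P]_t (\int[mu]_x (cos (dotrV xi x + phi) * f x) *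
     (a t + b t * expR (- (s t ^+ 2 / 4 * dotrV xi xi)))).
  rewrite (integral_heat_average mc bc); apply: eq_Rintegral => t _.
  set I := \int[mu]_x (_ * f x).
  transitivity (\int[mu]_z (I * a t * gauss_rV z +
      I * b t * (gauss_rV z * cos (dotrV (s t *: xi) z + 0)))).
    apply: eq_Rintegral => z _; rewrite integral_phase_sym// -/I addr0.
    have -> : dotrV xi (s t *: z) = dotrV (s t *: xi) z.
      by apply: eq_bigr => i _; rewrite !mxE; ring.
    by field.
  have [L1 I1] := integrable_gauss_rV_cos (s t *: xi) 0.
  have L0 := @integrable_gauss_rV R d.
  rewrite RintegralD//; [|exact: integrable_scale|exact: integrable_scale].
  rewrite !RintegralZl// I1 integral_gauss_rV cos0 mulr1 mul1r.
  have -> : dotrV (s t *: xi) (s t *: xi) = s t ^+ 2 * dotrV xi xi.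
    by rewrite /dotrV big_distrr; apply: eq_bigr => i _; rewrite !mxE /=; ring.
  rewrite mulrDr mulrA; congr (_ + _ * expR (- _)).
  by rewrite mulrAC.
rewrite E; transitivity (\int[P]_t ((a t + b t *
    expR (- (s t ^+ 2 / 4 * dotrV xi xi))) *
    \int[mu]_x (cos (dotrV xi x + phi) * f x))).
  by apply: eq_Rintegral => t _; rewrite mulrC.
by apply: RintegralZr => //; apply: Lab; exact: dotrV_ge0.
Qed.

End heat_superposition.

(** * Averaging symbols and extremal symbols *)

Section symbol_classes.
Context {R : realType} {d : nat}.
Local Notation X := 'rV[R]_d.
Local Notation mu := (@lebesgue_rV R d).
Implicit Types (f g h : X -> R) (m : X -> R) (xi x v : X).

(** Preservation of positivity is the property of convolution with a finite
    positive measure that is used; it spares the measure itself. *)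
Definition averaging_symbol m := forall f, mu.-integrable setT (EFin \o f) ->
  (forall x, 0 <= f x) ->
  exists g, [/\ mu.-integrable setT (EFin \o g), forall x, 0 <= g x &
    multiplies m f g].

(** The multiplier is applied to the cutoff and tested against f: the last
    clause says that it is nonnegative on the average of f over the cutoff when
    this average is nonnegative and maximal among its translates. *)
Definition extremal_symbol m := forall (r : R) (c : X), 0 < r ->
  exists h, [/\ mu.-integrable setT (EFin \o h), multiplies m (cutoff r c) h &
    forall f (M : R), measurable_fun setT f -> (forall x, `|f x| <= M) ->
      0 <= \int[mu]_x (f x * cutoff r c x) ->
      (forall v, \int[mu]_x (f x * cutoff r c (x - v)) <= \int[mu]_x (f x * cutoff r c x)) ->
      0 <= \int[mu]_x (f x * h x)].

(** The value of the Fourier transforms at xi = 0. *)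
Lemma multiplies_mass m f g : multiplies m f g ->
  \int[mu]_x g x = m 0 * \int[mu]_x f x.
Proof.
move=> H; have := H 0 0.
have E u : \int[mu]_x (cos (dotrV 0 x + 0) * u x) = \int[mu]_x u x.
  apply: eq_Rintegral => x _.
  by rewrite [dotrV _ _]big1 ?addr0 ?cos0 ?mul1r// => i _; rewrite mxE mul0r.
by rewrite !E.
Qed.

Lemma eq_multiplies m1 m2 f g : m1 =1 m2 -> multiplies m1 f g -> multiplies m2 f g.
Proof. by move=> E H xi phi; rewrite H E. Qed.

Lemma eq_averaging m1 m2 : m1 =1 m2 -> averaging_symbol m1 -> averaging_symbol m2.
Proof.
by move=> E H f Lf f0; have [g [Lg g0 mg]] := H f Lf f0; exists g; split => //; exact: eq_multiplies mg.
Qed.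

Lemma eq_extremal m1 m2 : m1 =1 m2 -> extremal_symbol m1 -> extremal_symbol m2.
Proof.
move=> E H r c r0; have [h [Lh mh ph]] := H r c r0; exists h; split => //.
exact: eq_multiplies mh.
Qed.

Lemma averaging_cst (c : R) : 0 <= c -> averaging_symbol (fun=> c).
Proof.
move=> c0 f Lf f0; exists (fun x => c * f x); split.
- exact: integrable_scale.
- by move=> x; rewrite mulr_ge0.
- move=> xi phi; under eq_Rintegral do rewrite mulrCA.
  rewrite RintegralZl//; apply: (integrable_bounded_mul (M := 1)) => //.
    exact: measurable_cos_phase.
  by move=> x; exact: cos_max.
Qed.

Lemma averaging_mul m1 m2 : averaging_symbol m1 -> averaging_symbol m2 ->
  averaging_symbol (fun xi => m1 xi * m2 xi).
Proof.
move=> H1 H2 f Lf f0; have [g [Lg g0 mg]] := H2 f Lf f0.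
have [h [Lh h0 mh]] := H1 g Lg g0; exists h; split => // xi phi.
by rewrite mh mg mulrA.
Qed.

Lemma extremal0 : extremal_symbol (fun=> 0).
Proof.
move=> r c r0; exists (cst 0); split.
- exact: integrable0.
- move=> xi phi; rewrite mul0r; under eq_Rintegral do rewrite mulr0.
  by rewrite Rintegral_cst// mul0r.
- by move=> f M _ _ _ _; apply: Rintegral_ge0 => x _; rewrite /= mulr0.
Qed.

Lemma extremal_add m1 m2 : extremal_symbol m1 -> extremal_symbol m2 ->
  extremal_symbol (fun xi => m1 xi + m2 xi).
Proof.
move=> H1 H2 r c r0; have [h1 [L1 mh1 ph1]] := H1 r c r0.
have [h2 [L2 mh2 ph2]] := H2 r c r0.
have E (F : X -> R) (M : R) : measurable_fun setT F -> (forall x, `|F x| <= M) ->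
   \int[mu]_x (F x * (h1 x + h2 x)) =
   \int[mu]_x (F x * h1 x) + \int[mu]_x (F x * h2 x).
  move=> mF FM; rewrite -RintegralD//; last 2 first.
  - exact: (integrable_bounded_mul (M := M)).
  - exact: (integrable_bounded_mul (M := M)).
  by apply: eq_Rintegral => x _; rewrite mulrDr.
exists (fun x => h1 x + h2 x); split.
- exact: integrable_add.
- move=> xi phi; rewrite (E _ 1) ?mh1 ?mh2 ?mulrDl//.
    exact: measurable_cos_phase.
  by move=> x; exact: cos_max.
- move=> f M mf fM f0 fv; rewrite (E _ M)// addr_ge0//.
    exact: ph1 f0 fv.
  exact: ph2 f0 fv.
Qed.

End symbol_classes.

Section heat_symbols.
Context {R : realType} {d : nat}.
Local Notation X := 'rV[R]_d.
Local Notation mu := (@lebesgue_rV R d).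
Context {dT : measure_display} {T : measurableType dT}
  (P : {sigma_finite_measure set T -> \bar R}).
Variables (w s : T -> R).
Hypothesis (mw : measurable_fun setT w) (w0 : forall t, 0 <= w t)
  (ms : measurable_fun setT s).

Lemma Rintegral_shift_sym (f : X -> R) v : mu.-integrable setT (EFin \o f) ->
  \int[mu]_x (f (x - v) + f (x + v)) = 2 * \int[mu]_x f x.
Proof.
move=> Lf; have mf := integrable_measurable Lf.
rewrite RintegralD//; [|exact: integrable_rV_shift|exact: integrable_rV_shift].
by rewrite !integral_rV_shift// mulr_natl mulr2n.
Qed.

(** A positive superposition of Gaussian averages is positive. *)
Lemma averaging_heat : P.-integrable setT (EFin \o w) ->
  averaging_symbol (fun xi : X =>
    \int[P]_t (w t * expR (- (s t ^+ 2 / 4 * dotrV xi xi)))).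
Proof.
move=> Lw f Lf f0; have mf := integrable_measurable Lf.
have k0 p : 0 <= heat_kernel (cst 0) w s f p.
  case: p => x [t z]; rewrite /heat_kernel /= mul0r add0r.
  by rewrite !mulr_ge0 ?gauss_rV_ge0 ?addr_ge0.
have Lk : (mu \x sfprod P mu)%E.-integrable setT
    (EFin \o heat_kernel (cst 0) w s f).
  apply: (@integrable_prod_bound _ _ _ _ _ _ _ _
     (fun p => ((\int[mu]_x f x) * w p.1) * gauss_rV p.2)).
  - exact: measurable_heat_kernel.
  - by move=> t; exact: integrable_heat_kernel_slice.
  - move=> [t z]; under eq_Rintegral do rewrite ger0_norm//.
    rewrite /heat_kernel /=; under eq_Rintegral do rewrite mul0r add0r mulrA.
    rewrite RintegralZl//; last first.
      by apply: integrable_add; exact: integrable_rV_shift.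
    by rewrite Rintegral_shift_sym// le_eqVlt; apply/orP; left; apply/eqP; field.
  - exact: (integrable_prod_mul (integrable_scale (\int[mu]_x f x) Lw)
      (@integrable_gauss_rV R d)).
exists (heat_average P (cst 0) w s f); split.
- exact: integrable_heat_average.
- by move=> x; apply: Rintegral_ge0.
- have Lab r : 0 <= r -> P.-integrable setT
      (EFin \o (fun t => cst 0 t + w t * expR (- (s t ^+ 2 / 4 * r)))).
    move=> r0; apply: integrable_dominated Lw.
      apply: measurable_funD => //; apply: measurable_funM => //.
      apply: measurableT_comp => //; apply: measurableT_comp => //.
      by apply: measurable_funM => //; apply: measurable_funM => //; exact: measurable_funX.
    move=> t; rewrite add0r normrM ger0_norm// ler_piMr// ger0_norm ?expR_ge0//.
    by rewrite -expR0 ler_expR oppr_le0 mulr_ge0 ?divr_ge0 ?sqr_ge0.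
  have H := multiplies_heat_average Lf Lk Lab.
  by apply: eq_multiplies H => xi; apply: eq_Rintegral => t _; rewrite add0r.
Qed.

(** From e^{-u} <= 1/(1 + u), the function 1 - e^{-k lam} of k is comparable
    with min(1, k); only the order of growth in k matters. *)
Lemma min1_expR_le (lam k : R) : 0 < lam -> 0 <= k ->
  Num.min 1 k <= (1 + lam) / lam * (1 - expR (- (k * lam))).
Proof.
move=> l0 k0; have y0 : 0 <= k * lam by rewrite mulr_ge0// ltW.
have y1 : 0 < 1 + k * lam by rewrite ltr_wpDr.
have H : k * lam / (1 + k * lam) <= 1 - expR (- (k * lam)).
  have : expR (- (k * lam)) <= (1 + k * lam)^-1.
    by rewrite expRN lef_pV2 ?posrE ?expR_gt0// expR_ge1Dx.
  have -> : k * lam / (1 + k * lam) = 1 - (1 + k * lam)^-1.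
    by field; rewrite gt_eqF.
  by rewrite lerD2l lerN2.
have L0 : 0 <= (1 + lam) / lam by rewrite divr_ge0 ?addr_ge0 ?ltW.
apply: le_trans (ler_wpM2l L0 H).
have -> : (1 + lam) / lam * (k * lam / (1 + k * lam)) =
    (1 + lam) * k / (1 + k * lam) by field; rewrite !gt_eqF.
rewrite ler_pdivlMr// minEle; case: ifPn => [h|]; first by nra.
by rewrite -ltNge => h; nra.
Qed.

Lemma one_minus_expR_le (k y : R) : 0 <= k -> 0 <= y ->
  1 - expR (- (k * y)) <= (1 + y) * Num.min 1 k.
Proof.
move=> k0 y0; have h1 := expR_ge1Dx (- (k * y)); have h2 := expR_ge0 (- (k * y)).
by rewrite minEle; case: ifPn => [h|]; nra.
Qed.

Variable lam : R.
Hypothesis (lam0 : 0 < lam) (Lw : P.-integrable setT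
  (EFin \o (fun t => w t * (1 - expR (- (s t ^+ 2 / 4 * lam)))))).

Let kap t := s t ^+ 2 / 4.
Let eps t := expR (- (kap t * lam)).
Let kap0 t : 0 <= kap t. Proof. by rewrite divr_ge0 ?sqr_ge0. Qed.
Let eps0 t : 0 <= eps t. Proof. exact: expR_ge0. Qed.
Let eps1 t : eps t <= 1.
Proof. by rewrite -expR0 ler_expR oppr_le0 mulr_ge0// ltW. Qed.
Let mkap : measurable_fun setT kap.
Proof. by apply: measurable_funM => //; exact: measurable_funX. Qed.
Let meps : measurable_fun setT eps.
Proof.
by apply: measurableT_comp => //; apply: measurableT_comp => //; exact: measurable_funM.
Qed.

(** The function u = psi - (psi(. - v) + psi(. + v))/2 has integral 0, so its L^1
    norm is twice the integral of its positive part, and u is at most 0 outside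
    the support of psi.  The bound on second differences thus only has to be
    integrated over the support, whatever the size of v. *)
Lemma second_difference_L1 (r : R) (c v : X) (K : R) : 0 < r ->
  second_order_bounded K (cutoff r c) ->
  \int[mu]_x `|cutoff r c x - (cutoff r c (x - v) + cutoff r c (x + v)) / 2| <=
   K * (r *+ 2) ^+ d * `|v| ^+ 2.
Proof.
move=> r0 [K0 _ _ H2]; set psi := cutoff r c.
have Lpsi : mu.-integrable setT (EFin \o psi) by exact: integrable_cutoff.
pose u x := psi x - 2^-1 * (psi (x - v) + psi (x + v)).
have Ls : mu.-integrable setT (EFin \o (fun x => psi (x - v) + psi (x + v))).
  by apply: integrable_add; exact: integrable_rV_shift.
have Lu : mu.-integrable setT (EFin \o u).
  by apply: integrable_sub => //; exact: integrable_scale.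
have Iu : \int[mu]_x u x = 0.
  rewrite RintegralB//; last exact: integrable_scale.
  by rewrite RintegralZl// Rintegral_shift_sym// mulrA mulVf// mul1r subrr.
have bmu : (mu (rV_box c r) < +oo)%E by exact: lebesgue_rV_box_lty.
have mb : measurable (rV_box c r) by exact: measurable_rV_box.
have Lb : mu.-integrable setT (EFin \o (fun x => K * `|v| ^+ 2 * \1_(rV_box c r) x)).
  apply: integrable_scale.
  apply: (@integrable_finite_support _ _ _ _ _ (rV_box c r) 1) => //.
  - by move=> x; rewrite indicE normr_nat lern1 leq_b1.
  - by move=> x nx; rewrite indicE memNset.
have -> : K * (r *+ 2) ^+ d * `|v| ^+ 2 =
    \int[mu]_x (K * `|v| ^+ 2 * \1_(rV_box c r) x - u x).
  rewrite RintegralB// Iu subr0.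
  rewrite RintegralZl//; last first.
    apply: (@integrable_finite_support _ _ _ _ _ (rV_box c r) 1) => //.
    - by move=> x; rewrite indicE normr_nat lern1 leq_b1.
    - by move=> x nx; rewrite indicE memNset.
  rewrite mulrAC; congr (_ * _); rewrite /Rintegral integral_indic// setIT.
  rewrite [X in fine X](_ : _ = ((r *+ 2) ^+ d)%:E)//.
  exact: lebesgue_rV_box.
apply: le_Rintegral => //.
- have := integrable_norm Lu; apply: eq_integrable => // x _ /=.
  by rewrite /u [_ / 2]mulrC.
- exact: integrable_sub.
move=> x _; rewrite [_ / 2]mulrC -/(u x) indicE.
have [ux|ux] := leP 0 (u x); last first.
  by rewrite ltr0_norm// lerDr mulr_ge0// mulr_ge0// exprn_ge0.
have [|] := boolP (x \in _).
  move=> _; rewrite mulr1 ger0_norm//.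
  have := H2 x v; rewrite -/psi ler_norml => /andP[h _].
  have Kv : 0 <= K * `|v| ^+ 2 by rewrite mulr_ge0// exprn_ge0.
  by rewrite /u; lra.
rewrite notin_setE => nx; rewrite mulr0 sub0r ger0_norm//.
have : u x <= 0.
  rewrite /u [psi x]cutoff_support// sub0r oppr_le0 mulr_ge0// addr_ge0//; exact: cutoff_ge0.
by lra.
Qed.

(** The maximum norm is at most the Euclidean norm. *)
Lemma rV_norm_sqr_le (z : X) : `|z| ^+ 2 <= dotrV z z.
Proof.
have S0 := dotrV_ge0 z.
rewrite -[X in _ <= X]sqr_sqrtr// lerXn2r ?nnegrE ?sqrtr_ge0//.
apply/(rV_norm_leP _ (sqrtr_ge0 _)) => i.
rewrite -sqrtr_sqr ler_wsqrtr// /dotrV (bigD1 i)//= expr2 lerDl.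
by apply: sumr_ge0 => j _; rewrite -expr2 sqr_ge0.
Qed.

(** The symbols 1 - e^{-k lam} e^{-k |xi|^2}, with k = s^2/4, are integrated
    against w, which may have infinite mass; what is integrable is
    w (1 - e^{-k lam}), of order w min(1, k).  For large k the L^1 norm of the
    multiplier applied to the cutoff is bounded; for small k the second difference of the cutoff gives a
    factor k.  At a nonnegative maximal average, psi - e^{-k lam} times a
    symmetric average of translates of psi is tested to something nonnegative. *)
Lemma extremal_heat : extremal_symbol (fun xi : X =>
  \int[P]_t (w t * (1 - expR (- (s t ^+ 2 / 4 * (lam + dotrV xi xi)))))).
Proof.
move=> r c r0; set psi := cutoff r c.
have [K HK] := second_order_bounded_cutoff r c; have [K0 _ _ _] := HK.
have Lpsi : mu.-integrable setT (EFin \o psi) by exact: integrable_cutoff.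
have psi0 x : 0 <= psi x by exact: cutoff_ge0.
set I := \int[mu]_x psi x.
have I0 : 0 <= I by exact: Rintegral_ge0.
pose b t := - (w t * eps t).
have mb : measurable_fun setT b by apply: measurableT_comp => //; exact: measurable_funM.
(* the first summand serves for small k, the second one for large k *)
pose C1 := 4 * (K * (r *+ 2) ^+ d) + 2 * I.
have Kr : 0 <= K * (r *+ 2) ^+ d by rewrite mulr_ge0// exprn_ge0// mulrn_wge0 ?ltW.
have C10 : 0 <= C1 by rewrite /C1; lra.
pose L := (1 + lam) / lam.
have L0 : 0 <= L by rewrite /L divr_ge0 ?addr_ge0 ?(ltW lam0).
have symI v : \int[mu]_x `|psi x - (psi (x - v) + psi (x + v)) / 2| <= 2 * I.
  have Ls : mu.-integrable setT (EFin \o (fun x => psi (x - v) + psi (x + v))).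
    by apply: integrable_add; exact: integrable_rV_shift.
  apply: (@le_trans _ _ (\int[mu]_x (psi x + 2^-1 * (psi (x - v) + psi (x + v))))).
    apply: le_Rintegral => //.
    - have := integrable_norm (integrable_sub Lpsi (integrable_scale 2^-1 Ls)).
      by apply: eq_integrable => // x _ /=; rewrite [_ / 2]mulrC.
    - by apply: integrable_add => //; exact: integrable_scale.
    move=> x _; rewrite [_ / 2]mulrC (le_trans (ler_normB _ _))//.
    by rewrite !ger0_norm// ?mulr_ge0 ?addr_ge0.
  rewrite RintegralD//; last exact: integrable_scale.
  by rewrite RintegralZl// Rintegral_shift_sym// -/I; lra.
have sym t z : \int[mu]_x `|psi x - (psi (x - s t *: z) + psi (x + s t *: z)) / 2| <=
    C1 * (1 + dotrV z z) * (L * (1 - eps t)).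
  have mn := min1_expR_le lam0 (kap0 t).
  have S0 := dotrV_ge0 z.
  apply: (@le_trans _ _ (C1 * (1 + dotrV z z) * Num.min 1 (kap t))); last first.
    by apply: ler_wpM2l => //; rewrite mulr_ge0// addr_ge0.
  rewrite minEle; case: ifPn => _.
    by rewrite mulr1 (le_trans (symI _))// /C1; nra.
  apply: le_trans (second_difference_L1 _ _ HK) _ => //.
  have zz := rV_norm_sqr_le z.
  have -> : `|s t *: z| ^+ 2 = 4 * kap t * `|z| ^+ 2.
    by rewrite normrZ exprMn real_normK ?num_real// /kap; congr (_ * _); field.
  have h1 := ler_wpM2l (mulr_ge0 Kr (kap0 t)) zz.
  have h2 := mulr_ge0 (mulr_ge0 Kr (kap0 t)) ler01.
  have h3 := mulr_ge0 (mulr_ge0 I0 (kap0 t)) (addr_ge0 ler01 S0).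
  by rewrite /C1; lra.
have Lk : (mu \x sfprod P mu)%E.-integrable setT (EFin \o heat_kernel w b s psi).
  pose B := C1 * L + I.
  have B0 : 0 <= B by rewrite /B addr_ge0 ?(mulr_ge0 C10 L0).
  apply: (@integrable_prod_bound _ _ _ _ _ _ _ _
     (fun p => (w p.1 * (1 - eps p.1)) * (B * (gauss_rV p.2 + dotrV p.2 p.2 * gauss_rV p.2)))).
  - exact: measurable_heat_kernel.
  - by move=> t; exact: integrable_heat_kernel_slice.
  - move=> [t z] /=.
    pose u x := psi x - (psi (x - s t *: z) + psi (x + s t *: z)) / 2.
    have Lu : mu.-integrable setT (EFin \o u).
      have Ls : mu.-integrable setT (EFin \o
         (fun x => psi (x - s t *: z) + psi (x + s t *: z))).
        by apply: integrable_add; exact: integrable_rV_shift.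
      have := integrable_sub Lpsi (integrable_scale 2^-1 Ls).
      by apply: eq_integrable => // x _ /=; rewrite /u [_ / 2]mulrC.
    apply: (@le_trans _ _ (\int[mu]_x (gauss_rV z * w t * (1 - eps t) * psi x +
       gauss_rV z * w t * `|u x|))).
      apply: le_Rintegral => //.
      - exact: integrable_norm (integrable_heat_kernel_slice _ _ _ _ (t, z)).
      - apply: integrable_add; first exact: integrable_scale.
        by apply: integrable_scale; exact: integrable_norm.
      move=> x _.
      have -> : gauss_rV z * (w t * psi x + b t / 2 *
           (psi (x - s t *: z) + psi (x + s t *: z))) =
         gauss_rV z * w t * (1 - eps t) * psi x + gauss_rV z * w t * eps t * u x.
        by rewrite /b /u; field.
      have G0 : 0 <= gauss_rV z * w t by rewrite mulr_ge0 ?gauss_rV_ge0.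
      rewrite (le_trans (ler_normD _ _))// lerD//.
        by rewrite ger0_norm// !mulr_ge0 ?subr_ge0 ?gauss_rV_ge0.
      rewrite normrM ler_wpM2r// ger0_norm ?mulr_ge0 ?gauss_rV_ge0//.
      by rewrite ler_piMr.
    rewrite RintegralD//; last 2 first.
    - exact: integrable_scale.
    - by apply: integrable_scale; exact: integrable_norm.
    rewrite !RintegralZl//; last exact: integrable_norm.
    have S0 := dotrV_ge0 z.
    have G0 : 0 <= gauss_rV z * w t by rewrite mulr_ge0 ?gauss_rV_ge0.
    have E0 : 0 <= 1 - eps t by rewrite subr_ge0.
    have h1 := ler_wpM2l G0 (sym t z).
    have h2 := mulr_ge0 (mulr_ge0 G0 E0) (mulr_ge0 I0 S0).
    by rewrite -/I /B; rewrite -/(u) in h1; lra.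
  - exact: (integrable_prod_mul Lw (integrable_scale B (integrable_add
      (@integrable_gauss_rV R d) (@integrable_gauss_rV_sqr R d)))).
exists (heat_average P w b s psi); split.
- exact: integrable_heat_average.
- have Lab y : 0 <= y -> P.-integrable setT
      (EFin \o (fun t => w t + b t * expR (- (s t ^+ 2 / 4 * y)))).
    move=> y0; apply: integrable_dominated (integrable_scale ((1 + (lam + y)) * L) Lw).
      apply: measurable_funD => //; apply: measurable_funM => //.
      by apply: measurableT_comp => //; apply: measurableT_comp => //; apply: measurable_funM.
    move=> t; rewrite /b /eps mulNr -[w t * _ * _]mulrA -/(kap t) -expRD -opprD -mulrDr.
    rewrite -[X in X - _]mulr1 -mulrBr normrM (ger0_norm (w0 t)) mulrCA.
    rewrite ler_wpM2l// ger0_norm; last first.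
      by rewrite subr_ge0 -expR0 ler_expR oppr_le0 mulr_ge0// addr_ge0// ltW.
    rewrite (le_trans (one_minus_expR_le (kap0 t) _)) ?addr_ge0 ?(ltW lam0)//.
    rewrite -mulrA ler_wpM2l ?addr_ge0 ?(ltW lam0)//.
    exact: min1_expR_le.
  have H := multiplies_heat_average Lpsi Lk Lab.
  apply: eq_multiplies H => xi; apply: eq_Rintegral => t _.
  by rewrite /b /eps mulNr -[w t * _ * _]mulrA -/(kap t) -expRD mulrBr mulr1 -opprD -mulrDr.
- move=> f M mf fM f0 fv; rewrite (integral_heat_average Lpsi Lk mf fM).
  apply: Rintegral_ge0 => t _; apply: Rintegral_ge0 => z _.
  rewrite mulr_ge0 ?gauss_rV_ge0//.
  set J := \int[mu]_x (f x * psi x) in f0 fv *.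
  have v1 := fv (s t *: z); have := fv (- (s t *: z)).
  have -> : \int[mu]_x (f x * cutoff r c (x - - (s t *: z))) =
    \int[mu]_x (f x * psi (x + s t *: z)).
    by apply: eq_Rintegral => x _; rewrite opprK.
  rewrite -/psi in v1; move: v1.
  set A1 := \int[mu]_x _; set A2 := \int[mu]_x _ => v1 v2.
  have we : 0 <= w t * eps t by rewrite mulr_ge0.
  have h1 := ler_wpM2l we v1; have h2 := ler_wpM2l we v2.
  have h3 := mulr_ge0 (mulr_ge0 (w0 t) (_ : 0 <= 1 - eps t)) f0.
  rewrite subr_ge0 in h3; have := h3 (eps1 t).
  by rewrite /b; lra.
Qed.

End heat_symbols.

(** * Second derivatives as extremal symbols *)

Section dominated.
Context {R : realType} {dT : measure_display} {T : measurableType dT}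
  (mu : {measure set T -> \bar R}).

Lemma cvg_Rintegral_dominated (f_ : nat -> T -> R) (f g : T -> R) :
  (forall n, measurable_fun setT (f_ n)) ->
  (forall x, f_ n x @[n --> \oo] --> f x) ->
  (forall n x, `|f_ n x| <= g x) -> mu.-integrable setT (EFin \o g) ->
  mu.-integrable setT (EFin \o f) /\
  \int[mu]_x f_ n x @[n --> \oo] --> \int[mu]_x f x.
Proof.
move=> mf_ ff fg Lg.
have mEf n : measurable_fun setT (EFin \o f_ n) by exact/measurable_EFinP.
have cE x : [set: T] x -> (EFin \o f_ n) x @[n --> \oo] --> (EFin \o f) x.
  by move=> _; apply: cvg_EFin; [exact: nearW|exact: ff].
have bE n x : [set: T] x -> (`|(EFin \o f_ n) x| <= (EFin \o g) x)%E.
  by move=> _; rewrite lee_fin; exact: fg.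
have mf : measurable_fun setT (EFin \o f).
  by apply: emeasurable_fun_cvg mEf cE.
have [Lf _ H] := dominated_convergence measurableT mEf mf (aeW _ cE) Lg
  (aeW _ (fun x n => bE n x)).
split => //; rewrite /Rintegral; apply: fine_cvg.
by rewrite fineK//; exact: integrable_fin_num.
Qed.

End dominated.

Section second_derivative.
Context {R : realType}.

(** The mean value theorem is applied twice to the remainder
    p(t) + p(-t) - p''(0) t^2, so that continuity of p'' at 0 suffices. *)
Lemma cvg_second_difference (p dp ddp : R -> R) :
  (forall t, is_derive t (1 : R) p (dp t)) ->
  (forall t, is_derive t (1 : R) dp (ddp t)) -> {for 0, continuous ddp} ->
  n.+1%:R ^+ 2 * (p (n.+1%:R^-1) + p (- n.+1%:R^-1) - 2 * p 0) @[n --> \oo]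
    --> ddp 0.
Proof.
move=> d1 d2 c2; apply/cvgrPdist_le => e e0.
have e2 : 0 < e / 2 by rewrite divr_gt0.
have /cvgrPdist_le /(_ _ e2)/nbhs_ballP[r /= r0 Hr] := c2.
near=> n; set u : R := n.+1%:R^-1.
have u0 : 0 < u by rewrite invr_gt0.
have ur : u < r.
  rewrite -[r]invrK ltf_pV2 ?posrE ?invr_gt0//.
  apply: (lt_le_trans (Num.Theory.truncnS_gt _)); rewrite ler_nat ltnS.
  by near: n; exact: nbhs_infty_ge.
have dN (g dg : R -> R) t : (forall t, is_derive t (1 : R) g (dg t)) ->
    is_derive t (1 : R) (fun t => g (- t)) (- dg (- t)).
  move=> dg'; have := @is_derive_subl R g 0 t (dg (- t)).
  by rewrite sub0r => /(_ (dg' _)); under eq_fun do rewrite sub0r.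
(* the remainder [q] has [q' 0 = 0] and [q'' 0 = 0] *)
pose q t := p t + p (- t) - ddp 0 * t ^+ 2.
pose dq t := dp t - dp (- t) - 2 * ddp 0 * t.
have dq1 t : is_derive t (1 : R) q (dq t).
  have h := dN p dp t d1; have h' := d1 t.
  apply: trigger_derive; rewrite /GRing.scale /= /dq; ring.
have dq2 t : is_derive t (1 : R) dq (ddp t + ddp (- t) - 2 * ddp 0).
  have h := dN dp ddp t d2; have h' := d2 t.
  apply: trigger_derive; rewrite /GRing.scale /=; ring.
have [c cu qc] := MVT_from0 u dq1.
have [c' cc' dqc] := MVT_from0 c dq2.
have near0 t : `|t| <= u -> `|ddp 0 - ddp t| <= e / 2.
  by move=> tu; apply: Hr; rewrite /ball/= sub0r normrN (le_lt_trans tu).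
have c'u : `|c'| <= u by rewrite (le_trans cc')// (le_trans cu)// gtr0_norm.
have B : `|dq c| <= e * u.
  have -> : dq c = (ddp c' + ddp (- c') - 2 * ddp 0) * c.
    by rewrite -dqc {3}/dq oppr0 subrr mulr0 !subr0.
  rewrite normrM; apply: ler_pM => //; last by rewrite (le_trans cu)// gtr0_norm.
  have h1 := near0 _ c'u; have h2 : `|ddp 0 - ddp (- c')| <= e / 2.
    by apply: near0; rewrite normrN.
  have -> : ddp c' + ddp (- c') - 2 * ddp 0 =
    - (ddp 0 - ddp c') - (ddp 0 - ddp (- c')) by ring.
  by rewrite (le_trans (ler_normB _ _))// normrN; lra.
have Q : p u + p (- u) - 2 * p 0 - ddp 0 * u ^+ 2 = dq c * u.
  by rewrite -qc /q oppr0 expr0n mulr0; ring.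
have -> : ddp 0 - n.+1%:R ^+ 2 * (p u + p (- u) - 2 * p 0) = - (dq c * u^-1).
  have -> : p u + p (- u) - 2 * p 0 = dq c * u + ddp 0 * u ^+ 2 by rewrite -Q; ring.
  have -> : n.+1%:R = u^-1 :> R by rewrite invrK.
  by field; rewrite gt_eqF.
rewrite normrN normrM normfV (gtr0_norm u0).
by rewrite ler_pdivrMr.
Unshelve. all: end_near. Qed.

End second_derivative.

Section along_line.
Context {R : realType} {V : normedModType R}.

Lemma is_derive_along (f df : V -> R) (w : V) :
  (forall p, is_derive p w f (df p)) -> forall (x : V) (t : R),
  is_derive t (1 : R) (fun t => f (x + t *: w)) (df (x + t *: w)).
Proof. by move=> D x t; apply/is_derive_line. Qed.

Lemma C2_second_derivative (f : V -> R) (w : V) : Ck_on 2 setT f ->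
  exists df ddf : V -> R, [/\ forall p, is_derive p w f (df p),
    forall p, is_derive p w df (ddf p) & continuous ddf].
Proof.
move=> [_ /(_ w)[D1 [_ /(_ w)[D2 [C2 _]]]]].
exists ('D_w f), ('D_w ('D_w f)); split.
- by move=> p; exact: (DeriveDef (D1 p I) erefl).
- by move=> p; exact: (DeriveDef (D2 p I) erefl).
- by move=> p; apply: C2; rewrite inE.
Qed.

End along_line.

Section coordinate_symbol.
Context {R : realType} {d : nat}.
Local Notation X := 'rV[R]_d.
Local Notation mu := (@lebesgue_rV R d).

(** The multiplier xi_i^2 is minus the second derivative in the direction e_i,
    the limit of the negated second differences.  These are bounded by a
    multiple of the indicator of a box, so that dominated convergence passes
    both the Fourier identity and the sign to the limit; each second difference
    of averages has the right sign at a maximal average. *)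
Lemma extremal_coord_sqr (i : 'I_d) : extremal_symbol (fun xi : X => xi ord0 i ^+ 2).
Proof.
move=> r c r0; set psi := cutoff r c.
have [K [K0 bK _ HK]] := second_order_bounded_cutoff r c.
have Lpsi : mu.-integrable setT (EFin \o psi) by exact: integrable_cutoff.
have mpsi : measurable_fun setT psi by exact: measurable_cutoff.
pose e : X := delta_mx ord0 i.
have e1 : `|e| <= 1.
  apply/(rV_norm_leP _ ler01) => j; rewrite !mxE eqxx /=.
  by case: (j == i); rewrite ?normr1 ?normr0.
have [dpsi [ddpsi [D1 D2 C2]]] := C2_second_derivative e (smooth_cutoff r c 2).
pose h x := - ddpsi x.
pose u n : R := n.+1%:R^-1.
pose hn n x := - (n.+1%:R ^+ 2 * (psi (x + u n *: e) + psi (x - u n *: e) - 2 * psi x)).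
have u0 n : 0 < u n by rewrite invr_gt0.
have u1 n : u n <= 1 by rewrite invf_le1 ?ler1n.
have hn_h x : hn n x @[n --> \oo] --> h x.
  apply: cvgN.
  have cc : {for 0, continuous (fun t : R => ddpsi (x + t *: e))}.
    apply: (@continuous_comp _ _ _ (fun t : R => x + t *: e) ddpsi); last exact: C2.
    apply: cvgD; first exact: cvg_cst.
    by apply: cvgZl; exact: cvg_id.
  have := cvg_second_difference (is_derive_along D1 x) (is_derive_along D2 x) cc.
  rewrite scale0r addr0; under [X in X @ _ --> _ -> _]eq_fun do rewrite scaleNr.
  exact.
pose g x := K * \1_(rV_box c (r + 1)) x.
have r10 : 0 < r + 1 by rewrite addr_gt0.
have mbox := measurable_rV_box c (r + 1).
have Lg : mu.-integrable setT (EFin \o g).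
  apply: integrable_scale.
  apply: (@integrable_finite_support _ _ _ _ _ (rV_box c (r + 1)) 1) => //.
  - exact: lebesgue_rV_box_lty.
  - by move=> x; rewrite indicE normr_nat lern1 leq_b1.
  - by move=> x nx; rewrite indicE memNset.
have mhn n : measurable_fun setT (hn n).
  have m1 := measurableT_comp mpsi (measurable_rVD (u n *: e)).
  have m2 := measurableT_comp mpsi (measurable_rVD (- (u n *: e))).
  apply: measurable_funN; apply: measurable_funM => //; apply: measurable_funB.
    exact: measurable_funD.
  exact: measurable_funM.
have hn_g n x : `|hn n x| <= g x.
  have due j : `|(u n *: e) ord0 j| <= 1.
    rewrite (le_trans (rV_coord_le_norm _ _))// normrZ gtr0_norm//.
    by rewrite mulr_ile1 // ltW.
  rewrite /g indicE; have [|] := boolP (x \in _) => [_|].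
    rewrite mulr1 normrN normrM ger0_norm ?exprn_ge0// mulrC.
    have -> : n.+1%:R = (u n)^-1 :> R by rewrite /u invrK.
    rewrite exprVn ler_pdivrMr ?exprn_gt0//.
    apply: le_trans (HK x (u n *: e)) _; rewrite ler_wpM2l//.
    have uu := ltW (u0 n).
    by rewrite lerXn2r ?nnegrE// normrZ gtr0_norm// ler_piMr.
  rewrite notin_setE => /existsNP[j /negP]; rewrite -leNgt => Hj.
  have out (y : X) : `|y ord0 j - x ord0 j| <= 1 -> psi y = 0.
    move=> yx; apply: cutoff_support => // /(_ j) Hy.
    have := ler_normD (x ord0 j - y ord0 j) (y ord0 j - c ord0 j).
    rewrite addrA subrK (distrC (x ord0 j) (y ord0 j)); lra.
  rewrite /hn !out ?subrr ?normr0//.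
  - by rewrite addr0 mulr0 subrr mulr0 oppr0 normr0 mulr0.
  - by have := due j; rewrite !mxE addrAC subrr add0r normrN.
  - by have := due j; rewrite !mxE addrAC subrr add0r.
have [Lh _] := cvg_Rintegral_dominated mhn hn_h hn_g Lg.
have lim (F : X -> R) (M : R) : measurable_fun setT F -> (forall x, `|F x| <= M) ->
    \int[mu]_x (F x * hn n x) @[n --> \oo] --> \int[mu]_x (F x * h x).
  move=> mF FM.
  apply: (proj2 (cvg_Rintegral_dominated (g := fun x => M * g x) _ _ _ _)).
  - by move=> n; exact: measurable_funM.
  - by move=> x; apply: cvgMr; exact: hn_h.
  - by move=> n x; rewrite normrM ler_pM.
  - exact: integrable_scale.
have intn (F : X -> R) (M : R) n : measurable_fun setT F -> (forall x, `|F x| <= M) ->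
    \int[mu]_x (F x * hn n x) = n.+1%:R ^+ 2 * (2 * \int[mu]_x (F x * psi x) -
      (\int[mu]_x (F x * psi (x - u n *: e)) + \int[mu]_x (F x * psi (x + u n *: e)))).
  move=> mF FM.
  have LF (k : X -> R) : mu.-integrable setT (EFin \o k) ->
      mu.-integrable setT (EFin \o (fun x => F x * k x)).
    by move=> Lk; exact: (integrable_bounded_mul (M := M)).
  have L0 := LF _ Lpsi.
  have L1 := LF _ (integrable_rV_shift (- (u n *: e)) Lpsi).
  have L2 := LF _ (integrable_rV_shift (u n *: e) Lpsi).
  rewrite -RintegralD// -RintegralZl// -RintegralB//; last 2 first.
  - exact: integrable_scale.
  - exact: integrable_add.
  rewrite -RintegralZl//; last first.
    by apply: integrable_sub; [exact: integrable_scale|exact: integrable_add].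
  by apply: eq_Rintegral => x _; rewrite /hn; ring.
exists h; split => //.
- move=> xi phi.
  have mc := measurable_cos_phase xi phi.
  have bc x : `|cos (dotrV xi x + phi)| <= 1 by exact: cos_max.
  have H := lim _ _ mc bc.
  set I := \int[mu]_x (cos _ * psi x).
  have de n : dotrV xi (u n *: e) = xi ord0 i * u n.
    rewrite /dotrV (bigD1 i)//= big1 ?addr0; last first.
      by move=> j ji; rewrite !mxE (negbTE ji) andbF mulr0 mulr0.
    by rewrite !mxE !eqxx mulr1.
  pose a := xi ord0 i.
  have d1 (t : R) : is_derive t (1 : R) (fun t => cos (a * t)) (- (a * sin (a * t))).
    by apply: trigger_derive; rewrite /GRing.scale /=; ring.
  have d2 (t : R) : is_derive t (1 : R) (fun t => - (a * sin (a * t))) (- (a ^+ 2 * cos (a * t))).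
    by apply: trigger_derive; rewrite /GRing.scale /=; ring.
  have c2 : {for 0, continuous (fun t : R => - (a ^+ 2 * cos (a * t)))}.
    apply: differentiable_continuous; apply/derivable1_diffP.
    exact: ex_derive.
  have H3 := cvgM (cvg_cst (- I)) (cvg_second_difference d1 d2 c2).
  have E : (fun n => \int[mu]_x (cos (dotrV xi x + phi) * hn n x)) =
      (fun n => - I * (n.+1%:R ^+ 2 * (cos (a * u n) + cos (a * - u n) - 2 * cos (a * 0)))).
    apply/funext => n; rewrite (intn _ _ _ mc bc) integral_phase_sym// -/I de.
    by rewrite mulr0 cos0 mulrN cosN -/a; ring.
  rewrite E in H; rewrite (cvg_unique _ H (H3 _ _))// mulr0 cos0.
  by rewrite -/a; ring.
- move=> f M mf fM f0 fv; have H := lim _ _ mf fM.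
  apply: (cvgr_to_ge H); apply: nearW => n; rewrite (intn _ _ _ mf fM).
  rewrite mulr_ge0 ?exprn_ge0//.
  have h1 : \int[mu]_x (f x * psi (x - u n *: e)) <= \int[mu]_x (f x * psi x).
    exact: fv.
  have h2 : \int[mu]_x (f x * psi (x + u n *: e)) <= \int[mu]_x (f x * psi x).
    by rewrite -{1}(opprK (u n *: e)); exact: fv.
  by rewrite subr_ge0 mulr_natl mulr2n lerD.
Unshelve. all: end_near. Qed.

End coordinate_symbol.

(** * Powers as integrals of exponentials *)

Section exponential_integrals.
Context {R : realType}.
Local Notation leb := (@lebesgue_measure R).

(** The two halves are exponential densities up to a factor. *)
Lemma integrable_expR_abs (del : R) : 0 < del ->
  leb.-integrable setT (EFin \o (fun v : R => expR (- (del * `|v|)))).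
Proof.
move=> del0.
have cf : continuous (fun v : R => expR (- (del * `|v|))).
  move=> v; apply: (@continuous_comp _ _ _ (fun v : R => - (del * `|v|)) expR).
    by apply: cvgN; apply: cvgM; [exact: cvg_cst|exact: norm_continuous].
  exact: continuous_expR.
have mf := continuous_measurable_fun cf.
apply: ge0_integrable => //.
have f0 (v : R) : 0 <= expR (- (del * `|v|)) by exact: expR_ge0.
have fN (v : R) : expR (- (del * `|v|)) = expR (- (del * `|- v|)) by rewrite normrN.
rewrite (ge0_symfun_integralT f0 cf fN) lte_mul_pinfty//.
pose g : R -> R := (fun v => expR (- (del * `|v|))) \_ `[0, +oo[.
have Lg : leb.-integrable setT (EFin \o g).
  apply: integrable_dominated (integrable_scale del^-1 (integrable_exponential_pdf del0)).
    by apply/(measurable_restrictT _ _).1 => //; exact: measurable_funTS.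
  move=> x; rewrite /g patchE; case: ifPn; last first.
    by rewrite normr0 mulr_ge0 ?invr_ge0 ?exponential_pdf_ge0 ?ltW.
  rewrite inE /= in_itv/= andbT => x0.
  rewrite (_ : exponential_pdf del x = del * expR (- del * x)); last exact: exponential_pdfE.
  rewrite mulrA mulVf ?gt_eqF// mul1r.
  by rewrite ger0_norm ?expR_ge0// ger0_norm// mulNr.
have := integrable_lty measurableT Lg; apply: le_lt_trans.
rewrite (_ : [set x | _] = `[0, +oo[%classic); last first.
  by apply/seteqP; split => x /=; rewrite in_itv/= andbT.
rewrite le_eqVlt; apply/orP; left; apply/eqP; rewrite [LHS]integral_mkcond.
by apply: eq_integral => x _; rewrite restrict_EFin.
Qed.

Lemma Rintegral_gt0 (f : R -> R) : leb.-integrable setT (EFin \o f) ->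
  (forall v, 0 < f v) -> 0 < \int[leb]_v f v.
Proof.
move=> Lf f0; rewrite lt_neqAle Rintegral_ge0 ?andbT; last by move=> v _; exact: ltW.
apply/eqP => I0; have mf := measurable_int leb Lf.
have : (\int[leb]_(v in setT) `|(EFin \o f) v| = 0)%E.
  transitivity (\int[leb]_v f v)%:E; last by rewrite -I0.
  rewrite EFin_Rintegral//; apply: eq_integral => v _ /=.
  by rewrite ger0_norm// ltW.
move=> /(ae_eq_integral_abs _ measurableT mf)[N [mN N0 H]].
have NT : N = setT.
  rewrite -subTset => v _; apply: H => /= /(_ I)[] fv.
  by have := f0 v; rewrite fv ltxx.
have := @lebesgue_measure_itv R `[0, 1].
rewrite /= lte_fin ltr01 oppr0 adde0 => E.
have h : (leb `[0%R, 1%R]%classic <= leb N)%E by rewrite NT le_measure ?inE.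
by move: h; rewrite [X in (X <= _)%E]E [X in (_ <= X)%E]N0 lee_fin ler10.
Qed.

(** With k = e^v and dv = dk/k, this is the integrand k^{-c} e^{-ky} for c < 0 and
    k^{-c} (1 - e^{-ky}) for c > 0.  Both signs are in one formula so that it is
    jointly measurable in c and v. *)
Definition pow_kernel (c y v : R) : R :=
  expR (- (c * v)) * `|\1_`]0, +oo[%classic c - expR (- (y * expR v))|.

Lemma pow_kernel_ge0 c y v : 0 <= pow_kernel c y v.
Proof. by rewrite mulr_ge0 ?expR_ge0. Qed.

Lemma pow_kernel_pos c y v : 0 < c -> 0 <= y ->
  pow_kernel c y v = expR (- (c * v)) * (1 - expR (- (y * expR v))).
Proof.
move=> c0 y0; rewrite /pow_kernel indicE mem_set /=; last by rewrite in_itv/= c0.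
by rewrite ger0_norm// subr_ge0 -expR0 ler_expR oppr_le0 mulr_ge0 ?expR_ge0.
Qed.

Lemma pow_kernel_neg c y v : c < 0 ->
  pow_kernel c y v = expR (- (c * v)) * expR (- (y * expR v)).
Proof.
move=> c0; rewrite /pow_kernel indicE memNset /=; last first.
  by rewrite in_itv/= andbT; apply/negP; rewrite -leNgt ltW.
by rewrite sub0r normrN ger0_norm ?expR_ge0.
Qed.

Lemma pow_kernel_gt0 c y v : c != 0 -> 0 < y -> 0 < pow_kernel c y v.
Proof.
move=> c0 y0; case/lt_total/orP: c0 => c0.
  by rewrite pow_kernel_neg// mulr_gt0 ?expR_gt0.
rewrite pow_kernel_pos ?ltW// mulr_gt0 ?expR_gt0// subr_gt0.
by rewrite -[ltRHS]expR0 ltr_expR oppr_lt0 mulr_gt0 ?expR_gt0.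
Qed.

Lemma measurable_pow_kernel (dT : measure_display) (T : measurableType dT)
    (y : R) (c v : T -> R) : measurable_fun setT c -> measurable_fun setT v ->
  measurable_fun setT (fun t => pow_kernel (c t) y (v t)).
Proof.
move=> mc mv; apply: measurable_funM.
  apply: measurableT_comp => //; apply: measurableT_comp => //.
  exact: measurable_funM.
apply: measurableT_comp => //; apply: measurable_funB.
  have mi : measurable_fun setT (\1_(`]0, +oo[%classic : set R) : R -> R).
    by apply: measurable_indic.
  exact: measurableT_comp mi mc.
apply: measurableT_comp => //; apply: measurableT_comp => //.
by apply: measurable_funM => //; exact: measurableT_comp.
Qed.

Lemma measurable_pow_kernel1 (c y : R) : measurable_fun setT (pow_kernel c y).
Proof.
exact: (measurable_pow_kernel y (@measurable_cst _ _ R R setT c) (@measurable_id _ R setT)).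
Qed.

(** For 0 < c < 1 the integrand is at most e^{-cv} for v >= 0 and e^{(1-c)v} for
    v < 0.  For c < 0 it is at most e^{-cv} for v < 0, while for v >= 0 the double
    exponential wins: e^v >= A (1 + v - ln A), the tangent line at ln A with
    A = 1 - c, leaves a factor e^{-v}. *)
Lemma integrable_pow_kernel1 (c : R) : c != 0 -> c < 1 ->
  leb.-integrable setT (EFin \o pow_kernel c 1).
Proof.
move=> c0 c1; case/lt_total/orP: c0 => c0; last first.
  have d0 : 0 < Num.min c (1 - c) by rewrite lt_min c0 subr_gt0.
  apply: integrable_dominated (integrable_expR_abs d0).
    exact: measurable_pow_kernel1.
  move=> v; rewrite ger0_norm ?pow_kernel_ge0// pow_kernel_pos// mul1r.
  have e1 : 0 < expR (- expR v) by exact: expR_gt0.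
  have [v0|v0] := leP 0 v.
    apply: (@le_trans _ _ (expR (- (c * v)))).
      by rewrite ler_piMr ?expR_ge0// lerBlDr lerDl ltW.
    by rewrite ler_expR lerN2 ger0_norm// ler_wpM2r// ge_min lexx.
  apply: (@le_trans _ _ (expR (- (c * v)) * expR v)).
    by rewrite ler_wpM2l ?expR_ge0// lerBlDr -lerBlDl expR_ge1Dx.
  rewrite -expRD ler_expR ltr0_norm//.
  have : Num.min c (1 - c) <= 1 - c by rewrite ge_min lexx orbT.
  by nra.
have d0 : 0 < Num.min (- c) 1 by rewrite lt_min oppr_gt0 c0 ltr01.
pose A := 1 - c; have A0 : 0 < A by rewrite /A; lra.
pose B := 1 + expR (A * ln A - A).
have B1 : 1 <= B by rewrite lerDl expR_ge0.
apply: integrable_dominated (integrable_scale B (integrable_expR_abs d0)).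
  exact: measurable_pow_kernel1.
move=> v; rewrite ger0_norm ?pow_kernel_ge0// pow_kernel_neg// mul1r.
have [v0|v0] := leP 0 v; last first.
  apply: (@le_trans _ _ (expR (- (c * v)))).
    rewrite ler_piMr ?expR_ge0// -[leRHS]expR0 ler_expR oppr_le0; exact: expR_ge0.
  apply: (@le_trans _ _ (1 * expR (- (Num.min (- c) 1 * `|v|)))); last first.
    by rewrite ler_wpM2r ?expR_ge0.
  rewrite mul1r ler_expR ltr0_norm//.
  have : Num.min (- c) 1 <= - c by rewrite ge_min lexx.
  by nra.
have H : A * (1 + v - ln A) <= expR v.
  have := expR_ge1Dx (v - ln A); rewrite expRB lnK ?posrE// ler_pdivlMr//.
  by rewrite mulrC addrA.
apply: (@le_trans _ _ (expR (A * ln A - A) * expR (- v))).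
  by rewrite -!expRD ler_expR; move: H; rewrite /A; nra.
apply: (@le_trans _ _ (B * expR (- v))).
  by rewrite ler_wpM2r ?expR_ge0// lerDr.
rewrite ler_wpM2l ?(le_trans ler01)// ler_expR lerN2 ger0_norm//.
have : Num.min (- c) 1 <= 1 by rewrite ge_min lexx orbT.
by nra.
Qed.

(** Gamma(-c) for c < 0 and Gamma(1 - c)/c for 0 < c < 1. *)
Definition pow_const (c : R) : R := \int[leb]_v pow_kernel c 1 v.

Lemma pow_const_gt0 c : c != 0 -> c < 1 -> 0 < pow_const c.
Proof.
move=> c0 c1; apply: Rintegral_gt0; first exact: integrable_pow_kernel1.
by move=> v; exact: pow_kernel_gt0.
Qed.

Lemma measurable_pow_const : measurable_fun setT pow_const.
Proof.
apply: (measurableT_comp (@measurable_fun_fine R)).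
apply: (measurable_fun_fubini_tonelli_G (m1 := leb)
  (fun p : measurableTypeR R * measurableTypeR R => (pow_kernel p.2 1 p.1)%:E)).
  by apply/measurable_EFinP; apply: measurable_pow_kernel; [exact: measurable_snd|exact: measurable_fst].
by move=> p; rewrite lee_fin pow_kernel_ge0.
Qed.

Lemma pow_kernel_shift (c y v : R) : 0 < y ->
  pow_kernel c y v = y `^ c * pow_kernel c 1 (v + ln y).
Proof.
move=> y0; rewrite /pow_kernel mulrA expRD lnK ?posrE// mul1r [expR v * y]mulrC.
congr (_ * _); rewrite /powR gt_eqF// -expRD; congr expR; ring.
Qed.

(** In logarithmic scale the dependence on y is a translation by ln y, by
    [pow_kernel_shift]. *)
Lemma integral_pow_kernel (c y : R) : c != 0 -> c < 1 -> 0 < y ->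
  leb.-integrable setT (EFin \o pow_kernel c y) /\
  \int[leb]_v pow_kernel c y v = y `^ c * pow_const c.
Proof.
move=> c0 c1 y0.
have L1 := integrable_pow_kernel1 c0 c1.
have E : (\int[leb]_v (pow_kernel c y v)%:E = (y `^ c * pow_const c)%:E)%E.
  have m1 : measurable_fun setT (fun v : measurableTypeR R => (pow_kernel c 1 (v + ln y))%:E).
    apply/measurable_EFinP; apply: measurableT_comp (measurable_pow_kernel1 c 1) _.
    exact: measurable_shift1.
  have p1 (v : measurableTypeR R) : [set: measurableTypeR R] v ->
      (0 <= (pow_kernel c 1 (v + ln y))%:E)%E by rewrite lee_fin pow_kernel_ge0.
  under eq_integral do rewrite pow_kernel_shift// EFinM.
  rewrite (ge0_integralZl _ measurableT m1 p1); last by rewrite lee_fin powR_ge0.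
  rewrite EFinM; congr (_ * _)%E; rewrite (EFin_Rintegral L1).
  apply: (ge0_integral_shift1 (ln y) (f := fun v => (pow_kernel c 1 v)%:E)).
    by apply/measurable_EFinP; exact: measurable_pow_kernel1.
  by move=> v; rewrite lee_fin pow_kernel_ge0.
split; last by rewrite /Rintegral E.
apply: ge0_integrable; first exact: measurable_pow_kernel1.
  by move=> v; exact: pow_kernel_ge0.
by rewrite E ltry.
Qed.

End exponential_integrals.

(** * Powers and logarithms of the shifted Laplacian *)

Section power_symbols.
Context {R : realType} {d : nat}.
Local Notation X := 'rV[R]_d.
Local Notation leb := (@lebesgue_measure R).
Variable lam : R.
Hypothesis lam1 : 1 < lam.

Let lam0 : 0 < lam. Proof. exact: lt_trans lam1. Qed.

(** The width s for which the heat time s^2/4 is e^v. *)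
Definition heat_scale (v : R) : R := 2 * expR (v / 2).

Lemma heat_scale_sqr v : heat_scale v ^+ 2 / 4 = expR v.
Proof.
have e2 : expR (v / 2) ^+ 2 = expR v by rewrite expr2 -expRD -splitr.
by rewrite /heat_scale exprMn e2; field.
Qed.

Lemma measurable_heat_scale : measurable_fun setT heat_scale.
Proof.
apply: measurable_funM => //; apply: measurableT_comp => //.
exact: measurable_funM.
Qed.

Lemma integral_pow_kernel_ge0 (a y : R) : 0 < a < 1 -> 0 <= y ->
  leb.-integrable setT (EFin \o pow_kernel a y) /\
  \int[leb]_v pow_kernel a y v = y `^ a * pow_const a.
Proof.
move=> /andP[a0 a1]; rewrite le_eqVlt => /predU1P[<-|y0]; last first.
  by apply: integral_pow_kernel => //; rewrite gt_eqF.
have E v : pow_kernel a 0 v = 0.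
  by rewrite pow_kernel_pos// mul0r oppr0 expR0 subrr mulr0.
split.
  have := @integrable0 _ _ _ (leb : {measure set _ -> \bar R}) setT.
  by apply: eq_integrable => // v _ /=; rewrite E.
under eq_Rintegral do rewrite E.
by rewrite Rintegral_cst// mul0r powR0 ?mul0r// gt_eqF.
Qed.

(** With y = lam + s, y^a - s^a is the integral over k of k^{-a} dk/k times
    e^{-ks} - e^{-ky} = (1 - e^{-k lam}) e^{-ks}, whose weight is integrable, up to a constant. *)
Lemma averaging_power_difference (a : R) : 0 <= a <= 1 ->
  averaging_symbol (fun xi : X =>
    (lam + dotrV xi xi) `^ a - dotrV xi xi `^ a).
Proof.
move=> /andP[]; rewrite le_eqVlt => /predU1P[<- _|a0].
  apply: eq_averaging (averaging_cst (le_refl (0 : R))) => xi.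
  by rewrite !powRr0 subrr.
rewrite le_eqVlt => /predU1P[->|a1].
  apply: eq_averaging (averaging_cst (ltW lam0)) => xi.
  rewrite !powRr1 ?addr_ge0 ?dotrV_ge0 ?(ltW lam0)//.
  by rewrite addrK.
have N0 : 0 < pow_const a by apply: pow_const_gt0 => //; rewrite gt_eqF.
have a01 : 0 < a < 1 by rewrite a0 a1.
have [Llam _] := integral_pow_kernel_ge0 a01 (ltW lam0).
pose w v := (pow_const a)^-1 * pow_kernel a lam v.
have Lw : leb.-integrable setT (EFin \o w) by exact: integrable_scale.
have mw : measurable_fun setT w by exact: integrable_measurable Lw.
have w0 v : 0 <= w v by rewrite mulr_ge0 ?pow_kernel_ge0 ?invr_ge0 ?(ltW N0).
apply: (eq_averaging _ (averaging_heat (P := leb) mw w0 measurable_heat_scale Lw)) => xi.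
set s := dotrV xi xi; have s0 : 0 <= s by exact: dotrV_ge0.
have y0 : 0 <= lam + s by rewrite addr_ge0 ?(ltW lam0).
have [L1 I1] := integral_pow_kernel_ge0 a01 y0.
have [L2 I2] := integral_pow_kernel_ge0 a01 s0.
transitivity (\int[leb]_v ((pow_const a)^-1 * (pow_kernel a (lam + s) v - pow_kernel a s v))).
  apply: eq_Rintegral => v _; rewrite heat_scale_sqr /w.
  rewrite !pow_kernel_pos ?(ltW lam0)// -mulrA; congr (_ * _).
  have -> : expR (- ((lam + s) * expR v)) = expR (- (lam * expR v)) * expR (- (s * expR v)).
    by rewrite -expRD; congr expR; ring.
  by rewrite [expR v * s]mulrC; ring.
rewrite RintegralZl//; last exact: integrable_sub.
by rewrite RintegralB// I1 I2 -mulrBl mulrC mulfK// gt_eqF.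
Qed.

Lemma extremal_power (a : R) : 0 < a < 1 ->
  extremal_symbol (fun xi : X => (lam + dotrV xi xi) `^ a).
Proof.
move=> a01; have /andP[a0 a1] := a01.
have N0 : 0 < pow_const a by apply: pow_const_gt0 => //; rewrite gt_eqF.
have [Llam _] := integral_pow_kernel_ge0 a01 (ltW lam0).
pose w v := (pow_const a)^-1 * expR (- (a * v)).
have mw : measurable_fun setT w.
  by apply: measurable_funM => //; apply: measurableT_comp => //; apply: measurableT_comp => //; exact: measurable_funM.
have w0 v : 0 <= w v by rewrite mulr_ge0 ?expR_ge0 ?invr_ge0 ?(ltW N0).
have Ew y v : 0 <= y -> w v * (1 - expR (- (heat_scale v ^+ 2 / 4 * y))) =
    (pow_const a)^-1 * pow_kernel a y v.
  by move=> y0; rewrite pow_kernel_pos// heat_scale_sqr /w -mulrA [expR v * y]mulrC.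
have Lw : leb.-integrable setT
    (EFin \o (fun v => w v * (1 - expR (- (heat_scale v ^+ 2 / 4 * lam))))).
  have := integrable_scale (pow_const a)^-1 Llam.
  by apply: eq_integrable => // v _; rewrite /= Ew// ltW.
apply: (eq_extremal _ (extremal_heat (P := leb) mw w0 measurable_heat_scale lam0 Lw)) => xi.
have y0 : 0 <= lam + dotrV xi xi by rewrite addr_ge0 ?dotrV_ge0 ?(ltW lam0).
have [L1 I1] := integral_pow_kernel_ge0 a01 y0.
transitivity (\int[leb]_v ((pow_const a)^-1 * pow_kernel a (lam + dotrV xi xi) v)).
  by apply: eq_Rintegral => v _; rewrite Ew.
by rewrite (RintegralZl _ measurableT L1) I1 mulrC mulfK// gt_eqF.
Qed.

Section logarithm.
Variables (a beta : R).
Hypotheses (a01 : 0 <= a <= 1) (beta0 : 0 < beta).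

Let c (r : R) : R := a - expR r.
Let G := pow_const (- beta).
Let betaN : - beta != 0. Proof. by rewrite oppr_eq0 gt_eqF. Qed.
Let beta1 : - beta < 1. Proof. by rewrite (lt_trans _ ltr01)// oppr_lt0. Qed.
Let G0 : 0 < G. Proof. exact: pow_const_gt0. Qed.
Let c1 r : c r < 1.
Proof. by have := expR_gt0 r; case/andP: a01 => ? ? ?; rewrite /c; lra. Qed.

(** With u = e^r and du/u = dr, this is the integrand of
    y^a (ln y)^{-beta} = G^{-1} int u^beta y^{a-u} du/u; the representation of
    powers is used a first time here, with exponent - beta and base ln y. *)
Definition log_density (y r : R) : R :=
  G^-1 * (y `^ a * pow_kernel (- beta) (ln y) r).

Lemma integral_log_density y : 1 < y ->
  leb.-integrable setT (EFin \o log_density y) /\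
  \int[leb]_r log_density y r = y `^ a / ln y `^ beta.
Proof.
move=> y1; have l0 : 0 < ln y by rewrite ln_gt0.
have [L1 I1] := integral_pow_kernel betaN beta1 l0.
split; first by apply: integrable_scale; exact: integrable_scale.
rewrite RintegralZl//; last exact: integrable_scale.
rewrite RintegralZl// I1 powRN -/G [X in _ * (_ * X)]mulrC mulrCA mulKf//.
by rewrite gt_eqF.
Qed.

Lemma log_densityE y r : 1 < y ->
  log_density y r = G^-1 * expR (beta * r) * y `^ c r.
Proof.
move=> y1; have y0 : 0 < y by exact: lt_trans y1.
rewrite /log_density pow_kernel_neg ?oppr_lt0// mulNr opprK -mulrA; congr (_ * _).
rewrite /powR gt_eqF// -!expRD; congr expR; rewrite /c; ring.
Qed.

Let mc : measurable_fun setT c.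
Proof. exact: measurable_funB. Qed.

Section logarithm_weight.
Variable A : set R.
Hypotheses (mA : measurable A) (A0 : ~ A 0).

(** The representation of y^{c(r)} is inserted in the Gamma integral: the
    parameter is the pair (v, r), and the set A selects the sign of the exponent
    c(r). *)
Definition log_weight (p : measurableTypeR R * measurableTypeR R) : R :=
  \1_A (c p.2) * (G^-1 * expR (beta * p.2)) * (pow_const (c p.2))^-1 *
  expR (- (c p.2 * p.1)).

Definition log_kernel y (p : measurableTypeR R * measurableTypeR R) : R :=
  \1_A (c p.2) * (G^-1 * expR (beta * p.2)) * (pow_const (c p.2))^-1 *
  pow_kernel (c p.2) y p.1.

Let mc2 : measurable_fun setT
  (fun p : measurableTypeR R * measurableTypeR R => c p.2).
Proof. exact: measurableT_comp mc (@measurable_snd _ _ _ _). Qed.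

Let mcoef : measurable_fun setT
  (fun p : measurableTypeR R * measurableTypeR R =>
    \1_A (c p.2) * (G^-1 * expR (beta * p.2)) * (pow_const (c p.2))^-1).
Proof.
have mi : measurable_fun setT (\1_A : R -> R) by exact: measurable_indic.
apply: measurable_funM; last first.
  have mN : measurable_fun setT (fun x : R => (pow_const x)^-1).
    rewrite (_ : (fun x => _) = (fun x => pow_const x `^ (- 1))).
      exact: (measurableT_comp (measurable_powR (- 1)) measurable_pow_const).
    apply/funext => x; rewrite powR_inv1//.
    by apply: Rintegral_ge0 => v _; exact: pow_kernel_ge0.
  exact: measurableT_comp mN mc2.
apply: measurable_funM; first exact: measurableT_comp mi mc2.
apply: measurable_funM => //; apply: measurableT_comp => //.
exact: measurable_funM.
Qed.

Lemma measurable_log_weight : measurable_fun setT log_weight.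
Proof.
apply: measurable_funM => //; apply: measurableT_comp => //; apply: measurableT_comp => //.
exact: measurable_funM.
Qed.

Let A_neq0 r : A (c r) -> c r != 0.
Proof. by move=> Ac; apply/eqP => c0; apply: A0; rewrite -c0. Qed.

Lemma log_weight_ge0 p : 0 <= log_weight p.
Proof.
rewrite /log_weight indicE; have [|_] := boolP (_ \in _); last by rewrite !mul0r.
rewrite inE => /A_neq0 cN; have N0 := pow_const_gt0 cN (c1 p.2).
by rewrite !mulr_ge0 ?expR_ge0 ?invr_ge0 ?ltW.
Qed.

(** Tonelli's theorem: integrating over v first gives back the power y^{c(r)}. *)
Lemma integral_log_kernel y : 1 < y ->
  (sfprod leb leb).-integrable setT (EFin \o log_kernel y) /\
  \int[sfprod leb leb]_p log_kernel y p =
  \int[leb]_r (\1_A (c r) * log_density y r).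
Proof.
move=> y1; have y0 : 0 < y by exact: lt_trans y1.
have slice r : leb.-integrable setT (EFin \o (fun v => log_kernel y (v, r))) /\
    \int[leb]_v log_kernel y (v, r) = \1_A (c r) * log_density y r.
  rewrite /log_kernel /= indicE; have [|_] := boolP (_ \in _); last first.
    split.
      have := @integrable0 _ _ _ (leb : {measure set _ -> \bar R}) setT.
      by apply: eq_integrable => // v _ /=; rewrite !mul0r.
    under eq_Rintegral do rewrite !mul0r.
    by rewrite Rintegral_cst// !mul0r.
  rewrite inE => /A_neq0 cN; have [L1 I1] := integral_pow_kernel cN (c1 r) y0.
  split; first exact: integrable_scale.
  rewrite (RintegralZl _ measurableT L1) I1 log_densityE// !mul1r -!mulrA; congr (_ * (_ * _)).
  by rewrite mulrCA mulVf ?mulr1// gt_eqF// pow_const_gt0.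
have k0 p : 0 <= log_kernel y p.
  rewrite /log_kernel indicE; have [|_] := boolP (_ \in _); last by rewrite !mul0r.
  rewrite inE => /A_neq0 cN; have N0 := pow_const_gt0 cN (c1 p.2).
  have Gn : 0 <= G^-1 by rewrite invr_ge0 ltW.
  have Nn : 0 <= (pow_const (c p.2))^-1 by rewrite invr_ge0 ltW.
  apply: mulr_ge0; last exact: pow_kernel_ge0.
  by rewrite mulr_ge0 ?mulr_ge0 ?expR_ge0.
have mk : measurable_fun setT (log_kernel y).
  apply: measurable_funM; first exact: mcoef.
  by apply: measurable_pow_kernel; [exact: mc2|exact: measurable_fst].
have [LB _] := integral_log_density y1.
have Lk : (sfprod leb leb).-integrable setT (EFin \o log_kernel y).
  apply: (integrable_prod_bound (mu := leb) (P := leb)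
    (b := fun r : measurableTypeR R => \1_A (c r) * log_density y r)) => //.
  - by move=> r; case: (slice r).
  - move=> r; case: (slice r) => _ <-.
    by rewrite le_eqVlt; apply/orP; left; apply/eqP; apply: eq_Rintegral => v _; rewrite ger0_norm.
  - apply: (integrable_bounded_mul (M := 1)) => //.
      have mi : measurable_fun setT (\1_A : R -> R) by exact: measurable_indic.
      exact: measurableT_comp mi mc.
    by move=> r; rewrite indicE normr_nat lern1 leq_b1.
split => //; rewrite (Rintegral_prod Lk) (integral_superposition Lk).
by apply: eq_Rintegral => r _; case: (slice r).
Qed.

End logarithm_weight.

(** The exponents in ]0, 1[ contribute 1 - e^{-ky} with a positive weight. *)
Lemma extremal_log_density : extremal_symbol (fun xi : X =>
  \int[leb]_r (\1_(`]0, +oo[%classic : set R) (c r) * log_density (lam + dotrV xi xi) r)).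
Proof.
pose A : set R := `]0, +oo[%classic.
have mA : measurable A by exact: measurable_itv.
have A0 : ~ A 0 by rewrite /A /= in_itv/= ltxx.
have Ew y p : 0 <= y -> log_weight A p *
    (1 - expR (- (heat_scale p.1 ^+ 2 / 4 * y))) =
    log_kernel A y p.
  move=> y0; rewrite heat_scale_sqr /log_weight /log_kernel indicE.
  have [|_] := boolP (_ \in _); last by rewrite !mul0r.
  rewrite inE /A /= in_itv/= andbT => cp.
  by rewrite pow_kernel_pos// [expR _ * y]mulrC; ring.
have [Llam _] := integral_log_kernel mA A0 lam1.
have Lw : (sfprod leb leb).-integrable setT
   (EFin \o (fun p => log_weight A p * (1 - expR (- (heat_scale p.1 ^+ 2 / 4 * lam))))).
  by apply: eq_integrable Llam => // p _; rewrite /= Ew// ltW.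
have ms : measurable_fun setT
  (fun p : measurableTypeR R * measurableTypeR R => heat_scale p.1).
  exact: measurableT_comp measurable_heat_scale (@measurable_fst _ _ _ _).
apply: (eq_extremal _ (extremal_heat (P := sfprod leb leb) (measurable_log_weight mA) (log_weight_ge0 A0)
  ms lam0 Lw)) => xi.
have y1 : 1 < lam + dotrV xi xi by rewrite ltr_wpDr ?dotrV_ge0.
have [_ <-] := integral_log_kernel mA A0 y1.
by apply: eq_Rintegral => p _; rewrite Ew// (le_trans ler01)// ltW.
Qed.

(** The negative exponents contribute e^{-k lam} e^{-k |xi|^2} with a positive
    weight, which is integrable because lam > 1. *)
Lemma averaging_log_density : averaging_symbol (fun xi : X =>
  \int[leb]_r (\1_(`]-oo, 0[%classic : set R) (c r) * log_density (lam + dotrV xi xi) r)).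
Proof.
pose A : set R := `]-oo, 0[%classic.
have mA : measurable A by exact: measurable_itv.
have A0 : ~ A 0 by rewrite /A /= in_itv/= ltxx.
have Ew y p : log_weight A p * expR (- (heat_scale p.1 ^+ 2 / 4 * y)) =
    log_kernel A y p.
  rewrite heat_scale_sqr /log_weight /log_kernel indicE.
  have [|_] := boolP (_ \in _); last by rewrite !mul0r.
  rewrite inE /A /= in_itv/= => cp.
  by rewrite pow_kernel_neg// [expR _ * y]mulrC; ring.
have [Lw _] := integral_log_kernel mA A0 lam1.
have ms : measurable_fun setT
  (fun p : measurableTypeR R * measurableTypeR R => heat_scale p.1).
  exact: measurableT_comp measurable_heat_scale (@measurable_fst _ _ _ _).
have k0 p : 0 <= log_kernel A lam p.
  by rewrite -Ew mulr_ge0 ?expR_ge0// log_weight_ge0.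
have mk := integrable_measurable Lw.
apply: (eq_averaging _ (averaging_heat (P := sfprod leb leb) mk k0 ms Lw)) => xi.
have y1 : 1 < lam + dotrV xi xi by rewrite ltr_wpDr ?dotrV_ge0.
have [_ <-] := integral_log_kernel mA A0 y1.
apply: eq_Rintegral => p _; rewrite -!Ew -mulrA -expRD; congr (_ * expR _).
by ring.
Qed.

(** The exponent c(r) = a - e^r vanishes at most at one point r = ln a, a null
    set. *)
Lemma log_density_split y : 1 < y ->
  \int[leb]_r (\1_(`]0, +oo[%classic : set R) (c r) * log_density y r) +
  \int[leb]_r (\1_(`]-oo, 0[%classic : set R) (c r) * log_density y r) =
  y `^ a / ln y `^ beta.
Proof.
move=> y1; have [LB <-] := integral_log_density y1.
have L (A : set R) : measurable A ->
    leb.-integrable setT (EFin \o (fun r => \1_A (c r) * log_density y r)).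
  move=> mA; apply: (integrable_bounded_mul (M := 1)) => //.
    have mi : measurable_fun setT (\1_A : R -> R) by exact: measurable_indic.
    exact: measurableT_comp mi mc.
  by move=> r; rewrite indicE normr_nat lern1 leq_b1.
have Lp := L `]0, +oo[%classic (measurable_itv _).
have Ln := L `]-oo, 0[%classic (measurable_itv _).
rewrite -RintegralD//.
rewrite /Rintegral; congr fine; apply: ae_eq_integral => //.
- by apply/measurable_EFinP; exact: integrable_measurable (integrable_add Lp Ln).
- exact: measurable_int LB.
exists [set ln a]; split; [exact: measurable_set1|exact: lebesgue_measure_set1|].
move=> r /= H; apply: contrapT => ra; apply: H => _; congr EFin.
have cr : c r != 0.
  by apply/eqP => /eqP; rewrite subr_eq0 => /eqP E; apply: ra; rewrite E expRK.
rewrite -mulrDl !indicE; case/lt_total/orP: cr => cr.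
  rewrite memNset /= ?in_itv/= ?andbT; last by apply/negP; rewrite -leNgt ltW.
  by rewrite mem_set /= ?in_itv/= ?cr// add0r mul1r.
rewrite mem_set /= ?in_itv/= ?cr// memNset /= ?in_itv/= ?addr0 ?mul1r//.
by apply/negP; rewrite -leNgt ltW.
Qed.

End logarithm.

End power_symbols.

(** * Decomposition of the symbol *)

Section A1_decomposition.
Context {R : realType} {d : nat}.
Local Notation X := 'rV[R]_d.

Lemma extremal_dotrV : extremal_symbol (fun xi : X => dotrV xi xi).
Proof.
suff H (s : seq 'I_d) : extremal_symbol (fun xi : X => \sum_(i <- s) xi ord0 i ^+ 2).
  apply: (eq_extremal _ (H (index_enum 'I_d))) => xi.
  by apply: eq_bigr => i _; rewrite expr2.
elim: s => [|i s IH].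
  by apply: (eq_extremal _ extremal0) => xi; rewrite big_nil.
apply: (eq_extremal _ (extremal_add (extremal_coord_sqr i) IH)) => xi.
by rewrite big_cons.
Qed.

(** For a = 0 every exponent c(r) = - e^r is negative. *)
Lemma averaging_log_inverse (beta lam : R) : 0 <= beta -> 1 < lam ->
  averaging_symbol (fun xi : X => (ln (lam + dotrV xi xi) `^ beta)^-1).
Proof.
rewrite le_eqVlt => /predU1P[<-|b0] lam1.
  apply: (eq_averaging _ (averaging_cst ler01)) => xi.
  by rewrite powRr0 invr1.
have a01 : 0 <= (0 : R) <= 1 by rewrite lexx ler01.
apply: (eq_averaging _ (averaging_log_density lam1 a01 b0)) => xi.
have y1 : 1 < lam + dotrV xi xi by rewrite ltr_wpDr ?dotrV_ge0.
have [_ H] := integral_log_density 0 b0 y1.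
rewrite powRr0 mul1r in H; rewrite -H; apply: eq_Rintegral => r _.
by rewrite indicE mem_set ?mul1r//= in_itv/= sub0r oppr_lt0 expR_gt0.
Qed.

(** With s = |xi|^2 and y = lam + s: for beta > 0 the three symbols are the
    positive exponents and the negative exponents of y^a (ln y)^{-beta}, and
    (y^a - s^a) (ln y)^{-beta}.  For beta = 0 the exponents 0 and 1 of s are
    treated apart, as their representations degenerate. *)
Lemma A1_symbol_decomposition (gamma beta lam : R) :
  0 <= gamma <= 2 -> 0 <= beta -> 1 < lam ->
  exists m1 m2 m3 : X -> R, [/\ extremal_symbol m1, averaging_symbol m2,
    averaging_symbol m3 & forall xi,
    A1_symbol gamma beta lam xi = m1 xi + m2 xi - m3 xi].
Proof.
move=> /andP[g0 g2] b0 lam1; set a := gamma / 2.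
have a01 : 0 <= a <= 1 by rewrite /a; apply/andP; split; lra.
have AE (xi : X) : A1_symbol gamma beta lam xi =
    dotrV xi xi `^ a / ln (lam + dotrV xi xi) `^ beta.
  have s0 : 0 <= dotrV xi xi by exact: dotrV_ge0.
  rewrite /A1_symbol /enorm sqr_sqrtr// -powR12_sqrt// -powRrM; congr (_ `^ _ / _).
  by rewrite mulrC.
have D := averaging_power_difference lam1 a01 (d := d).
have L := averaging_log_inverse b0 lam1.
have DL := averaging_mul D L.
have c0 : averaging_symbol (fun=> 0 : R) := @averaging_cst R d 0 (lexx 0).
move: (b0); rewrite le_eqVlt => /predU1P[b00|bpos]; last first.
  have P := extremal_log_density lam1 a01 bpos (d := d).
  have N := averaging_log_density lam1 a01 bpos (d := d).
  refine (ex_intro _ _ (ex_intro _ _ (ex_intro _ _ (And4 P N DL _)))) => xi.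
  have y1 : 1 < lam + dotrV xi xi by rewrite ltr_wpDr ?dotrV_ge0.
  rewrite AE (log_density_split a bpos y1) /=.
  by ring.
have AE0 (xi : X) : A1_symbol gamma beta lam xi = dotrV xi xi `^ a.
  by rewrite AE -b00 powRr0 divr1.
have /andP[] := a01; rewrite le_eqVlt => /predU1P[a0 _|a0].
  exists (fun=> 0), (fun=> 1), (fun=> 0); split => //.
  - exact: extremal0.
  - exact: averaging_cst ler01.
  - by move=> xi; rewrite AE0 -a0 powRr0 add0r subr0.
rewrite le_eqVlt => /predU1P[a1|a1].
  exists (fun xi => dotrV xi xi), (fun=> 0), (fun=> 0); split => //.
  - exact: extremal_dotrV.
  - by move=> xi; rewrite AE0 a1 powRr1 ?dotrV_ge0// addr0 subr0.
have a01' : 0 < a < 1 by rewrite a0 a1.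
have P := extremal_power lam1 a01' (d := d).
refine (ex_intro _ _ (ex_intro _ _ (ex_intro _ _ (And4 P c0 D _)))) => xi.
by rewrite AE0 /=; ring.
Qed.

End A1_decomposition.

(** * Local averages *)

Section local_averages.
Context {R : realType} {d : nat}.
Local Notation X := 'rV[R]_d.
Local Notation mu := (@lebesgue_rV R d).
Implicit Types (f g : X -> R) (c v x z : X) (r k : R).

Lemma bounded_on_box f c r : 0 < r -> continuous f ->
  exists2 B, 0 <= B & forall x, rV_box c r x -> `|f x| <= B.
Proof.
move=> r0 cf.
have cn : continuous (fun x => `|f x|) by move=> x; exact: (cvg_norm (cf x)).
have [||z zc zm] := @compact_EVT_max X R (fun x => `|f x|) (closed_ball c r) _
  (@compact_rV_ball _ _ c r).
- by exists c; exact: closed_ballxx.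
- by apply: continuous_subspaceT; exact: cn.
exists `|f z| => // x bx; apply: zm; rewrite inE.
by apply: subset_closed_ball; rewrite -rV_boxE.
Qed.

Lemma integrable_mul_cutoff f c r : 0 < r -> continuous f ->
  mu.-integrable setT (EFin \o (fun x => f x * cutoff r c x)).
Proof.
move=> r0 cf; have [K [K0 bK _ _]] := second_order_bounded_cutoff r c.
have [B B0 bB] := bounded_on_box c r0 cf.
apply: (@integrable_finite_support _ _ _ _ _ (rV_box c r) (B * K)) => //.
- exact: measurable_rV_box.
- exact: lebesgue_rV_box_lty.
- apply: measurable_funM; last exact: measurable_cutoff.
  exact: continuous_measurable_rV.
- move=> x; have [bx|nx] := pselect (rV_box c r x).
    by rewrite normrM ler_pM// bB.
  by rewrite cutoff_support// mulr0 normr0 mulr_ge0.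
- by move=> x nx; rewrite cutoff_support// mulr0.
Qed.

Lemma integral_cutoffC c r : \int[mu]_x cutoff r c x = \int[mu]_x cutoff r 0 x.
Proof.
rewrite -(integral_rV_shift (- c) (measurable_cutoff (d := d) r 0)).
by apply: eq_Rintegral => x _; rewrite cutoff_shift add0r.
Qed.

Lemma local_average_le f c r k : 0 < r -> continuous f ->
  (forall x, rV_box c r x -> f x <= k) ->
  \int[mu]_x (f x * cutoff r c x) <= k * \int[mu]_x cutoff r 0 x.
Proof.
move=> r0 cf fk; rewrite -(integral_cutoffC c) -(RintegralZl k measurableT (integrable_cutoff c r0)).
apply: le_Rintegral => //.
- exact: integrable_mul_cutoff.
- by apply: integrable_scale; exact: integrable_cutoff.
move=> x _; have [bx|nx] := pselect (rV_box c r x).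
  by rewrite ler_wpM2r ?cutoff_ge0// fk.
by rewrite cutoff_support// !mulr0.
Qed.

Lemma local_average_ge f c r k : 0 < r -> continuous f ->
  (forall x, rV_box c r x -> k <= f x) ->
  k * \int[mu]_x cutoff r 0 x <= \int[mu]_x (f x * cutoff r c x).
Proof.
move=> r0 cf fk; rewrite -(integral_cutoffC c) -(RintegralZl k measurableT (integrable_cutoff c r0)).
apply: le_Rintegral => //.
- by apply: integrable_scale; exact: integrable_cutoff.
- exact: integrable_mul_cutoff.
move=> x _; have [bx|nx] := pselect (rV_box c r x).
  by rewrite ler_wpM2r ?cutoff_ge0// fk.
by rewrite cutoff_support// !mulr0.
Qed.

(** Moving the centre by less than 1 changes the cutoff by a Lipschitz amount
    inside a box of radius r + 1 and not at all outside. *)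
Lemma continuous_local_average f (M : R) r : 0 < r -> continuous f ->
  (forall x, `|f x| <= M) ->
  continuous (fun c => \int[mu]_x (f x * cutoff r c x)).
Proof.
move=> r0 cf fM c.
have M0 : 0 <= M := le_trans (normr_ge0 _) (fM 0).
have [K [K0 _ H1 _]] := second_order_bounded_cutoff r (0 : X).
have r1 : 0 < r + 1 by rewrite addr_gt0.
pose L := M * K * ((r + 1) *+ 2) ^+ d.
have L0 : 0 <= L by rewrite /L !mulr_ge0// exprn_ge0// mulrn_wge0// ltW.
suff H c' : `|c - c'| < 1 -> `|\int[mu]_x (f x * cutoff r c x) -
    \int[mu]_x (f x * cutoff r c' x)| <= L * `|c - c'|.
  apply: (proj2 (@cvgrPdist_le R R^o X (nbhs c) _ _ _)) => /= e e0.
  apply/nbhs_ballP; exists (Num.min 1 (e / (L + 1))).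
    by rewrite /= lt_min ltr01 divr_gt0// ltr_wpDl.
  move=> c'; rewrite -ball_normE /ball_ /= lt_min => /andP[h1 h2].
  rewrite (le_trans (H _ h1))//.
  have L1 : 0 < L + 1 by rewrite ltr_wpDl.
  move: h2; rewrite ltr_pdivlMr// => h2; have := normr_ge0 (c - c'); nra.
move=> h1.
have I1 := @integrable_mul_cutoff f c r r0 cf.
have I2 := @integrable_mul_cutoff f c' r r0 cf.
have mb : measurable (rV_box c (r + 1)) by exact: measurable_rV_box.
have bmu := @lebesgue_rV_box_lty R d c (r + 1) r1.
have Lb : mu.-integrable setT (EFin \o (fun x => \1_(rV_box c (r + 1)) x : R)).
  apply: (@integrable_finite_support _ _ _ _ _ (rV_box c (r + 1)) 1) => //.
  - exact: measurable_indic.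
  - by move=> x; rewrite indicE normr_nat lern1 leq_b1.
  - by move=> x nx; rewrite indicE memNset.
rewrite -RintegralB//.
apply: le_trans (le_normr_Rintegral _ _) _ => //; first exact: integrable_sub.
have -> : L * `|c - c'| =
    \int[mu]_x (M * (K * `|c - c'|) * \1_(rV_box c (r + 1)) x).
  rewrite (RintegralZl _ measurableT Lb) /Rintegral integral_indic// setIT.
  rewrite [X in fine X](_ : _ = (((r + 1) *+ 2) ^+ d)%:E) /=.
    by rewrite /L; ring.
  exact: lebesgue_rV_box.
apply: le_Rintegral => //.
- by apply: integrable_norm; exact: integrable_sub.
- exact: integrable_scale.
move=> x _; rewrite -mulrBr normrM indicE.
have [bx|nx] := pselect (rV_box c (r + 1) x).
  rewrite mem_set// mulr1 ler_pM//.
  have := H1 (x - c) (c - c').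
  by rewrite addrA subrK !cutoff_shift !add0r distrC.
rewrite memNset// mulr0.
have -> : cutoff r c x = 0.
  by apply: cutoff_support => // bx; apply: nx => i; rewrite (lt_trans (bx i))// ltrDl.
rewrite cutoff_support ?subr0 ?normr0 ?mulr0// => bx; apply: nx => i.
have -> : x ord0 i - c ord0 i = (x ord0 i - c' ord0 i) - (c - c') ord0 i.
  by rewrite !mxE; ring.
rewrite (le_lt_trans (ler_normB _ _))// ltrD//.
by apply: le_lt_trans h1; exact: rV_coord_le_norm.
Qed.

End local_averages.

(** * The maximum principle for the multiplier *)

Section maximum_principle.
Context {R : realType} {d : nat}.
Local Notation X := 'rV[R]_d.
Local Notation mu := (@lebesgue_rV R d).
Implicit Types (f g m : X -> R) (c v x z xi : X) (r k M : R).

Lemma enorm_ge_norm x : `|x| <= enorm x.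
Proof. by rewrite /enorm -[leLHS]normr_id -sqrtr_sqr ler_wsqrtr// rV_norm_sqr_le. Qed.

(** The mass is a ratio of integrals of nonnegative functions. *)
Lemma averaging_mass_ge0 m : averaging_symbol m -> 0 <= m 0.
Proof.
move=> Hm; have [h [Lh h0 mh]] := Hm _ (integrable_cutoff (0 : X) (@ltr01 R))
  (cutoff_ge0 (d := d) 1 0).
have I0 := @integral_cutoff_gt0 R d 1 0 ltr01.
have : 0 <= m 0 * \int[mu]_x cutoff 1 0 x.
  by rewrite -(multiplies_mass mh); exact: Rintegral_ge0.
by rewrite pmulr_lge0.
Qed.

(** Transposition moves the multiplier to the cutoff, as h1 + h2 - h3.  The
    first term is nonnegative against f by extremality; the two others are
    bounded by M times the mass of h2 and h3. *)
Lemma multiplier_at_local_average_max m m1 m2 m3 f g M r z :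
  extremal_symbol m1 -> averaging_symbol m2 -> averaging_symbol m3 ->
  (forall xi, m xi = m1 xi + m2 xi - m3 xi) ->
  continuous f -> (forall x, `|f x| <= M) -> fourier_multiplier m f g -> 0 < r ->
  0 <= \int[mu]_x (f x * cutoff r z x) ->
  (forall v, \int[mu]_x (f x * cutoff r v x) <= \int[mu]_x (f x * cutoff r z x)) ->
  - (m2 0 + m3 0) * M * \int[mu]_x cutoff r 0 x <= \int[mu]_x (g x * cutoff r z x).
Proof.
move=> E1 A2 A3 mE cf fM [_ Hg] r0 J0 Jmax.
have mf := continuous_measurable_rV cf.
have Lpsi := @integrable_cutoff R d r z r0.
have [h1 [L1 M1 P1]] := E1 r z r0.
have [h2 [L2 p2 M2]] := A2 _ Lpsi (cutoff_ge0 r z).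
have [h3 [L3 p3 M3]] := A3 _ Lpsi (cutoff_ge0 r z).
have Lfh (h : X -> R) : mu.-integrable setT (EFin \o h) ->
    mu.-integrable setT (EFin \o (fun x => f x * h x)).
  by move=> Lh; exact: (integrable_bounded_mul (M := M)).
have split (u : X -> R) : measurable_fun setT u -> (exists B, forall x, `|u x| <= B) ->
    \int[mu]_x (u x * (h1 x + h2 x - h3 x)) =
    \int[mu]_x (u x * h1 x) + \int[mu]_x (u x * h2 x) - \int[mu]_x (u x * h3 x).
  move=> mu0 [B uB].
  have Lu (h : X -> R) : mu.-integrable setT (EFin \o h) ->
      mu.-integrable setT (EFin \o (fun x => u x * h x)).
    by move=> Lh; exact: (integrable_bounded_mul (M := B)).
  have H1 := Lu _ L1; have H2 := Lu _ L2; have H3 := Lu _ L3.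
  rewrite -RintegralD// -RintegralB//; last exact: integrable_add.
  by apply: eq_Rintegral => x _; ring.
have Lh : mu.-integrable setT (EFin \o (fun x => h1 x + h2 x - h3 x)).
  by apply: integrable_sub => //; exact: integrable_add.
have Mh : multiplies m (cutoff r z) (fun x => h1 x + h2 x - h3 x).
  move=> xi phi; rewrite split ?M1 ?M2 ?M3 ?mE; first by ring.
    exact: measurable_cos_phase.
  by exists 1 => x; exact: cos_max.
rewrite (Hg _ _ (test_function_cutoff z r0) (multiplies_fourier Lpsi Lh Mh)).
rewrite split//; last by exists M.
have H1 : 0 <= \int[mu]_x (f x * h1 x).
  apply: (P1 f M mf fM J0) => v; apply: le_trans (Jmax (z + v)).
  rewrite le_eqVlt; apply/orP; left; apply/eqP.
  by apply: eq_Rintegral => x _; rewrite cutoff_shift.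
have bnd (h n : X -> R) : mu.-integrable setT (EFin \o h) -> (forall x, 0 <= h x) ->
    multiplies n (cutoff r z) h ->
    `|\int[mu]_x (f x * h x)| <= n 0 * M * \int[mu]_x cutoff r 0 x.
  move=> L h0 Mn; rewrite (le_trans (le_normr_Rintegral _ (Lfh _ L)))//.
  rewrite -mulrA mulrCA -(integral_cutoffC z) -(multiplies_mass Mn).
  rewrite -(RintegralZl M measurableT L); apply: le_Rintegral => //.
  - exact: integrable_norm (Lfh _ L).
  - exact: integrable_scale.
  by move=> x _; rewrite normrM (ger0_norm (h0 x)) ler_wpM2r.
have := bnd _ _ L2 p2 M2; have := bnd _ _ L3 p3 M3.
rewrite !ler_norml => /andP[_ b3] /andP[b2 _].
move: H1 b2 b3; set a1 := Rintegral _ _ _; set a2 := Rintegral _ _ _.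
set a3 := Rintegral _ _ _; set I := Rintegral _ _ _; lra.
Qed.

(** Averages centred far away are at most M/4, while the average at x0 is at least
    M/2: the maximum over a large ball is a maximum over the whole space. *)
Lemma local_average_max f M r x0 : continuous f -> 0 < M -> (forall x, `|f x| <= M) -> 0 < r ->
  (forall x, rV_box x0 r x -> M / 2 <= f x) ->
  forall B, (forall x, B <= enorm x -> `|f x| < M / 4) ->
  exists2 z, closed_ball 0 (`|B| + r) z &
    forall v, \int[mu]_x (f x * cutoff r v x) <= \int[mu]_x (f x * cutoff r z x).
Proof.
move=> cf M0 fM r0 fx0 B fB.
have I0 := @integral_cutoff_gt0 R d r 0 r0.
have Jx0 := local_average_ge r0 cf fx0.
have B0 : 0 < `|B| + r by rewrite ltr_wpDl.
have Jfar v : ~ closed_ball 0 (`|B| + r) v ->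
    \int[mu]_x (f x * cutoff r v x) <= M / 4 * \int[mu]_x cutoff r 0 x.
  rewrite closed_ballE// /closed_ball_ /= sub0r normrN => /negP; rewrite -ltNge => vB.
  apply: local_average_le => // x; rewrite rV_boxE// -ball_normE /ball_ /= => xv.
  apply/ltW/(le_lt_trans (ler_norm _))/fB.
  apply: le_trans (enorm_ge_norm x).
  have := ler_norm B; have := ler_normD (v - x) x; rewrite subrK; lra.
have [||z zB zm] := @compact_EVT_max X R (fun v => \int[mu]_x (f x * cutoff r v x))
   (closed_ball 0 (`|B| + r)) _ (@compact_rV_ball _ _ _ _).
- by exists 0; exact: closed_ballxx.
- by apply: continuous_subspaceT; exact: continuous_local_average.
rewrite inE in zB; exists z; first exact: zB.
move=> v.
have [vB|vB] := pselect (closed_ball 0 (`|B| + r) v); first by apply: zm; rewrite inE.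
apply: le_trans (zm x0 _); last first.
  rewrite inE; apply: contrapT => /Jfar; move: Jx0 I0.
  by set J := Rintegral _ _ _; set I := Rintegral _ _ _; nra.
apply: le_trans (Jfar v vB) (le_trans _ Jx0).
by move: I0; set I := Rintegral _ _ _; nra.
Qed.

(** If the conclusion fails, every point p has either f(p) < M or
    g(p) < - (m2 0 + m3 0) M, and by continuity a small average centred near p
    either is smaller than the one at x0 or violates
    [multiplier_at_local_average_max].  A compact set of centres is covered
    uniformly in the radius, so no small average is maximal, against
    [local_average_max].  The point found may differ from x0. *)
Lemma multiplier_at_max m m1 m2 m3 f g M x0 :
  extremal_symbol m1 -> averaging_symbol m2 -> averaging_symbol m3 ->
  (forall xi, m xi = m1 xi + m2 xi - m3 xi) ->
  continuous f -> vanishes_at_infinity f -> fourier_multiplier m f g ->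
  0 < M -> (forall x, `|f x| <= M) -> f x0 = M ->
  exists2 x1, f x1 = M & - (m2 0 + m3 0) * M <= g x1.
Proof.
move=> E1 A2 A3 mE cf f0 fg M0 fM fx0; apply: contrapT => none.
have cg : continuous g by case: fg.
have M4 : 0 < M / 4 by rewrite divr_gt0.
have [B fB] := f0 _ M4.
(* radius and distance at most e/2 keep the box inside the ball of radius e *)
have near_le (u : X -> R) (q : X) (k : R) : continuous u -> u q < k -> exists2 e : R, 0 < e &
    forall r z, 0 < r < e -> `|q - z| < e -> forall x, rV_box z r x -> u x <= k.
  move=> cu uk.
  have /nbhs_ballP[e /= e0 He] : nbhs q [set x | u x < k].
    by have := cu q [set y | y < k]; apply; exact: lt_nbhsl.
  exists (e / 2); first by rewrite divr_gt0.
  move=> r z /andP[r0 re] qz x; rewrite rV_boxE// -ball_normE /ball_ /= => zx.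
  apply/ltW/He; rewrite -ball_normE /ball_ /=.
  have := ler_normD (q - z) (z - x); rewrite addrA subrK; lra.
have bad (p : X) : exists2 e : R, 0 < e & forall r z, 0 < r < e -> `|p - z| < e ->
    ~ (0 <= \int[mu]_x (f x * cutoff r z x) /\
       forall v, \int[mu]_x (f x * cutoff r v x) <= \int[mu]_x (f x * cutoff r z x)).
  have [fp|fp] := ltP (f p) M.
    have [e1 e10 H1] := near_le f p ((f p + M) / 2) cf ltac:(lra).
    have cNf : continuous (fun x => - f x) by move=> x; exact: (cvgN (cf x)).
    have [e2 e20 H2] := near_le (fun x => - f x) x0 (- ((f p + 3 * M) / 4)) cNf ltac:(by rewrite /= fx0; lra).
    exists (Num.min e1 e2); first by rewrite lt_min e10.
    move=> r z /andP[r0]; rewrite !lt_min => /andP[r1 r2] /andP[z1 _] [_ Jmax].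
    have J1 : \int[mu]_x (f x * cutoff r z x) <= (f p + M) / 2 * \int[mu]_x cutoff r 0 x.
      by apply: local_average_le => //; apply: H1; rewrite ?r0.
    have J2 : (f p + 3 * M) / 4 * \int[mu]_x cutoff r 0 x <= \int[mu]_x (f x * cutoff r x0 x).
      apply: local_average_ge => // x bx; rewrite -lerN2.
      by apply: (H2 r x0) bx; rewrite ?r0// subrr normr0.
    have := Jmax x0; have I0 := @integral_cutoff_gt0 R d r 0 r0.
    move: J1 J2 I0; set I := \int[mu]_x cutoff r 0 x.
    set J := Rintegral _ _ _; set J' := Rintegral _ _ _; nra.
  have {}fp : f p = M by apply/le_anti; rewrite fp andbT (le_trans (ler_norm _)).
  have gp : g p < - (m2 0 + m3 0) * M.
    by rewrite ltNge; apply/negP => gp; apply: none; exists p.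
  set C := - (m2 0 + m3 0) * M in gp.
  have [e e0 H] := near_le g p ((g p + C) / 2) cg ltac:(lra).
  exists e => // r z re pz [J0 Jmax]; have /andP[r0 _] := re.
  have J1 : \int[mu]_x (g x * cutoff r z x) <= (g p + C) / 2 * \int[mu]_x cutoff r 0 x.
    by apply: local_average_le => //; exact: H.
  have := multiplier_at_local_average_max E1 A2 A3 mE cf fM fg r0 J0 Jmax.
  have I0 := @integral_cutoff_gt0 R d r 0 r0.
  move: J1 I0; rewrite -/C; set I := \int[mu]_x cutoff r 0 x.
  set J := Rintegral _ _ _; nra.
have Hnear : \forall r \near 0^'+, closed_ball 0 (`|B| + 1) `<=` [set z |
    0 < r -> ~ (0 <= \int[mu]_x (f x * cutoff r z x) /\
       forall v, \int[mu]_x (f x * cutoff r v x) <= \int[mu]_x (f x * cutoff r z x))].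
  have /compact_near_coveringP := @compact_rV_ball R d 0 (`|B| + 1).
  move=> /(_ _ (0^'+ : set_system R) (fun r z => 0 < r ->
    ~ (0 <= \int[mu]_x (f x * cutoff r z x) /\
       forall v, \int[mu]_x (f x * cutoff r v x) <= \int[mu]_x (f x * cutoff r z x)))).
  apply => p _; have [e e0 He] := bad p.
  exists (ball p e, [set r : R | r < e]).
    by split; [exact: nbhsx_ballx | exact: nbhs_right_lt].
  move=> [z r] /= [pz re] r0; apply: He; rewrite ?r0//.
  by move: pz; rewrite -ball_normE.
have [e e0 He] : exists2 e : R, 0 < e &
    forall r, 0 < r < e -> forall x, rV_box x0 r x -> M / 2 <= f x.
  have cNf : continuous (fun x => - f x) by move=> x; exact: (cvgN (cf x)).
  have [e e0 H] := near_le (fun x => - f x) x0 (- (M / 2)) cNf ltac:(by rewrite /= fx0; lra).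
  exists e => // r re x bx; rewrite -lerN2.
  by apply: (H r x0) bx; rewrite ?subrr ?normr0.
have : \forall r \near (0 : R)^'+, False; last by move/filter_ex => -[].
near=> r.
have r0 : 0 < r by near: r; exact: nbhs_right_gt.
have re : 0 < r < e by rewrite r0; near: r; exact: nbhs_right_lt.
have r1 : r < 1 by near: r; exact: nbhs_right_lt.
have [z zB Jz] := local_average_max cf M0 fM r0 (He r re) fB.
have : closed_ball 0 (`|B| + 1) z.
  move: zB; rewrite !closed_ballE ?ltr_wpDl// /closed_ball_ /= => zB.
  by rewrite (le_trans zB)// lerD2l ltW.
move: z zB Jz => z _ Jz zB.
have : ~ (0 <= \int[mu]_x (f x * cutoff r z x) /\
  forall v, \int[mu]_x (f x * cutoff r v x) <= \int[mu]_x (f x * cutoff r z x)).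
  by move: z zB {Jz} r0; near: r; apply: filterS Hnear => r H z /H.
apply; split => //; apply: le_trans (Jz x0).
apply: le_trans (local_average_ge r0 cf (He r re)).
by rewrite mulr_ge0 ?divr_ge0 ?(ltW M0)// ltW// integral_cutoff_gt0.
Unshelve. all: by end_near.
Qed.

End maximum_principle.

(** * The supremum norm *)

Section sup_norm.
Context {R : realType} {d : nat}.
Local Notation X := 'rV[R]_d.
Local Notation mu := (@lebesgue_rV R d).
Implicit Types (f : X -> R) (x : X).

Lemma lebesgue_rV_gt0 : (0 < mu [set: X])%E.
Proof.
apply: (@lt_le_trans _ _ (mu (rV_box 0 1))); last first.
  by apply: le_measure; rewrite ?inE//; exact: measurable_rV_box.
rewrite [ltRHS](_ : _ = ((1 *+ 2) ^+ d)%:E); last exact: lebesgue_rV_box.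
by rewrite lte_fin exprn_gt0.
Qed.

Lemma Linfty_normE f : Linfty_norm f = ess_sup mu (fun x => `|f x|%:E).
Proof. by rewrite /Linfty_norm unlock /= ifT ?lebesgue_rV_gt0. Qed.

Lemma Linfty_norm_le f (B : R) : (forall x, `|f x| <= B) -> (Linfty_norm f <= B%:E)%E.
Proof.
move=> fB; rewrite Linfty_normE; apply/ess_supP; apply: aeW => x.
by rewrite lee_fin.
Qed.

(** For continuous f the set where |f| exceeds a smaller value contains a box, of
    positive measure. *)
Lemma le_Linfty_norm f x : continuous f -> (`|f x|%:E <= Linfty_norm f)%E.
Proof.
move=> cf; rewrite leNgt; apply/negP => lt.
have A0 : (0 <= Linfty_norm f)%E by exact: Lnorm_ge0.
have [a a0 aE] : exists2 a : R, 0 <= a & Linfty_norm f = a%:E.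
  move: lt A0; case: (Linfty_norm f) => [a _ a0||]//; by exists a.
rewrite aE lte_fin in lt.
have cn : continuous (fun x => `|f x|) by move=> y; exact: (cvg_norm (cf y)).
have /nbhs_ballP[e /= e0 He] : nbhs x [set y | a < `|f y|].
  by have := cn x [set y | a < y]; apply; exact: lt_nbhsr.
have [N [mN N0 HN]] := ess_sup_ge mu (fun x => `|f x|%:E).
have bN : rV_box x e `<=` N.
  move=> y; rewrite rV_boxE// => /He /= ay; apply: HN => /= H.
  by move: H; rewrite -Linfty_normE aE lee_fin leNgt ay.
have : (mu (rV_box x e) <= mu N)%E.
  by apply: le_measure; rewrite ?inE//; exact: measurable_rV_box.
rewrite N0 [leLHS](_ : _ = ((e *+ 2) ^+ d)%:E); last exact: lebesgue_rV_box.
by apply/negP; rewrite -ltNge lte_fin exprn_gt0// mulrn_wgt0.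
Qed.

(** Decay confines the points where |f| exceeds |f(a)| > 0 to a ball. *)
Lemma norm_max_attained f : continuous f -> vanishes_at_infinity f ->
  exists x0, forall x, `|f x| <= `|f x0|.
Proof.
move=> cf f0; have [allz|] := pselect (forall x, f x = 0).
  by exists 0 => x; rewrite !allz.
move=> /existsNP[a /eqP fa].
have fa0 : 0 < `|f a| by rewrite normr_gt0.
have [B fB] := f0 _ fa0.
have B0 : 0 < `|B| + 1 by rewrite ltr_wpDl.
have cn : continuous (fun x => `|f x|) by move=> y; exact: (cvg_norm (cf y)).
have far x : ~ closed_ball 0 (`|B| + 1) x -> `|f x| < `|f a|.
  rewrite closed_ballE// /closed_ball_ /= sub0r normrN => /negP; rewrite -ltNge => vB.
  apply: fB; have := enorm_ge_norm x; have := ler_norm B; lra.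
have [||z zB zm] := @compact_EVT_max X R (fun x => `|f x|)
   (closed_ball 0 (`|B| + 1)) _ (@compact_rV_ball _ _ _ _).
- by exists 0; exact: closed_ballxx.
- by apply: continuous_subspaceT; exact: cn.
have aB : closed_ball 0 (`|B| + 1) a.
  by apply: contrapT => /far; rewrite ltxx.
exists z => x.
have [xB|xB] := pselect (closed_ball 0 (`|B| + 1) x); first by apply: zm; rewrite inE.
by rewrite (le_trans (ltW (far _ xB)))// zm// inE.
Qed.

End sup_norm.

Section one_sided_max.
Context {R : realType}.

(** The difference quotients from the left are nonnegative. *)
Lemma left_max_derive_ge0 (f : R -> R) (t0 df e : R) : 0 < e ->
  is_derive t0 1 f df -> (forall s, t0 - e < s < t0 -> f s <= f t0) -> 0 <= df.
Proof.
move=> e0 [D <-] fmax; rewrite /derive cvg_at_leftE//; apply: limr_ge.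
  rewrite -(cvg_at_leftE (fun h => h^-1 *: ((f \o shift t0) _ - f t0)))//.
  apply: cvg_trans D; apply: cvg_app.
  move=> A [r r0 Ar]; exists r => // x xr xgt0; apply: Ar => //.
  exact/ltr0_neq0.
near=> h.
have h0 : h < 0 by near: h; exact: nbhs_left_lt.
have he : - e < h by near: h; apply: nbhs_left_gt; rewrite oppr_lt0.
apply: mulr_le0; first by rewrite invr_le0 ltW.
by rewrite subr_le0 /= [_%:A]mulr1; apply: fmax; apply/andP; split; rewrite /shift; lra.
Unshelve. all: by end_near. Qed.

End one_sided_max.

(** * Slices of a smooth function of time and space *)

Section slices.
Context {R : realType} {d : nat}.
Local Notation X := 'rV[R]_d.
Variable theta : R -> X -> R.
Implicit Types (t sg h : R) (x w : X).
Hypothesis smooth_theta :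
  smooth_on [set p : R * X | 0 < p.1] (fun p => theta p.1 p.2).

Lemma continuous_slice t : 0 < t -> continuous (theta t).
Proof.
move=> t0 x; have [cF _] := smooth_theta 0.
have cx : {for (t, x), continuous (fun p : R * X => theta p.1 p.2)}.
  by apply: cF; rewrite inE.
have := @cvg_comp _ _ _ (fun y => (t, y)) (fun p : R * X => theta p.1 p.2)
  (nbhs x) (nbhs (t, x)) _ _ cx.
apply.
exact: (cvg_pair (cvg_cst t) cvg_id).
Qed.

Lemma is_derive_time t x : 0 < t -> is_derive t 1 (theta ^~ x) (derive1 (theta ^~ x) t).
Proof.
move=> t0; have [_ /(_ (1, 0))[dF _]] := smooth_theta 1.
pose df := 'D_(1, 0) (fun p : R * X => theta p.1 p.2) (t, x).
have : is_derive ((0, x) + t *: (1, 0) : R * X) (1, 0) (fun p : R * X => theta p.1 p.2) df.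
  have -> : (0, x) + t *: (1, 0) = (t, x) :> R * X.
    by congr pair; rewrite /= ?add0r ?scaler0 ?addr0 // [_ *: _]mulr1.
  by apply: DeriveDef => //; exact: dF.
move/is_derive_line => H.
have E : (fun h : R => theta ((0, x) + h *: (1, 0) : R * X).1
    ((0, x) + h *: (1, 0) : R * X).2) = theta ^~ x.
  by apply/funext => h /=; rewrite add0r scaler0 addr0 [_ *: _]mulr1.
rewrite E in H; case: H => H1 H2; apply: DeriveDef => //.
by rewrite derive1E.
Qed.

Lemma derivable_line t x w h : 0 < t ->
  derivable (fun s : R => theta t (x + s *: w)) h 1.
Proof.
move=> t0; have [_ /(_ (0, w))[dF _]] := smooth_theta 1.
pose df := 'D_(0, w) (fun p : R * X => theta p.1 p.2) ((t, x) + h *: (0, w)).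
have : is_derive ((t, x) + h *: (0, w) : R * X) (0, w) (fun p : R * X => theta p.1 p.2) df.
  by apply: DeriveDef => //; apply: dF; rewrite /= scaler0 addr0.
move/is_derive_line => H.
have E : (fun s : R => theta ((t, x) + s *: (0, w) : R * X).1
    ((t, x) + s *: (0, w) : R * X).2) = (fun s : R => theta t (x + s *: w)).
  by apply/funext => s /=; rewrite scaler0 addr0.
by rewrite E in H; case: H.
Qed.

Lemma derive_at_max t x w (sg : R) : 0 < t -> sg != 0 ->
  (forall y, sg * theta t y <= sg * theta t x) -> 'D_w (theta t) x = 0.
Proof.
move=> t0 sg0 Hmax.
have D h := @derivable_line t x w h t0.
have : is_derive (0 : R) (1 : R) (fun s : R => sg * theta t (x + s *: w)) 0.
  apply: (@derive1_at_max _ _ (- 1) 1); rewrite ?lerN10 ?in_itv /= ?ltrN10 ?ltr01//.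
    by move=> h _; exact: (derivableM (derivable_cst _ _ _) (D h)).
  by move=> s _; rewrite scale0r addr0.
have H : is_derive (0 : R) (1 : R) (fun s : R => theta t (x + s *: w)) ('D_w (theta t) x).
  have := D 0; move=> D0; have : is_derive (0 : R) (1 : R)
    (fun s : R => theta t (x + s *: w)) ('D_1 (fun s : R => theta t (x + s *: w)) 0).
    exact: DeriveDef.
  move=> H; have := H; move/is_derive_line; rewrite scale0r addr0 => -[_ E].
  by rewrite E.
have H2 := is_deriveM (is_derive_cst sg (0 : R) 1) H.
move=> [_ E]; case: H2 => _; rewrite E scaler0 addr0 => /esym/eqP.
by rewrite mulf_eq0 (negbTE sg0) => /eqP.
Qed.

End slices.

(** * Growth of the supremum norm *)

Section growth.
Context {R : realType} {d : nat}.
Local Notation X := 'rV[R]_d.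
Local Notation mu := (@lebesgue_rV R d).

(** When the positive and the negative parts both have infinite integral, both
    sides are the value of [fine] at an infinity, namely 0. *)
Lemma Rintegral_opp (u : X -> R) : \int[mu]_x (- u x) = - \int[mu]_x u x.
Proof.
rewrite /Rintegral (integralE _ _ (fun x => (- u x)%:E)) (integralE _ _ (fun x => (u x)%:E)).
rewrite (_ : (fun x => (- u x)%:E) = \- (EFin \o u))%E// funeposN funenegN.
have : (0 <= \int[mu]_x ((EFin \o u)^\+ x)%E)%E by exact: integral_ge0.
have : (0 <= \int[mu]_x ((EFin \o u)^\- x)%E)%E by exact: integral_ge0.
rewrite -[fun x => (u x)%:E]/(EFin \o u).
by case: integral => [p||]; case: integral => [q||] //=; rewrite ?oppr0 ?opprB.
Qed.

Lemma fourier_multiplier_sign (m f g : X -> R) (c : R) : `|c| = 1 ->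
  fourier_multiplier m f g ->
  fourier_multiplier m (fun x => c * f x) (fun x => c * g x).
Proof.
move=> c1 [cg H]; split; first by move=> x; exact: (cvgM (cvg_cst c) (cg x)).
have scale (u w : X -> R) : \int[mu]_x (c * u x * w x) = c * \int[mu]_x (u x * w x).
  have [->|->] : c = 1 \/ c = -1.
  - by have [c0|c0] := leP 0 c; [left; rewrite -c1 ger0_norm|right; rewrite -c1 ltr0_norm ?opprK].
  - by rewrite mul1r; apply: eq_Rintegral => x _; rewrite mul1r.
  - rewrite mulN1r -Rintegral_opp; apply: eq_Rintegral => x _.
    by rewrite mulN1r mulNr.
by move=> psi h tpsi mh; rewrite !scale (H _ _ tpsi mh).
Qed.

Lemma is_derive_expR_mul (f : R -> R) (k t df : R) : is_derive t 1 f df ->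
  is_derive t 1 (fun s => expR (- k * s) * f s) (expR (- k * t) * (df - k * f t)).
Proof.
move=> H.
have L : is_derive t 1 (fun s : R => - k * s) (- k).
  apply: (is_derive_eq (is_deriveM (is_derive_cst (- k) t 1) (is_derive_id t 1))).
  by rewrite /GRing.scale /=; ring.
have E := is_derive1_comp (is_derive_expR (- k * t)) L.
apply: (is_derive_eq (is_deriveM E H)).
by rewrite /GRing.scale /=; ring.
Qed.

Variables (nu C1 : R) (m : X -> R).
Hypothesis nu0 : 0 <= nu.
Hypothesis at_max : forall (f g : X -> R) (M : R) x0,
  continuous f -> vanishes_at_infinity f -> fourier_multiplier m f g ->
  0 < M -> (forall x, `|f x| <= M) -> f x0 = M ->
  exists2 x1, f x1 = M & - C1 * M <= g x1.

Variables (v : R -> X -> X) (theta A1theta : R -> X -> R).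
Hypothesis smooth_theta :
  smooth_on [set p : R * X | 0 < p.1] (fun p => theta p.1 p.2).
Hypothesis continuous_theta : forall t : R, 0 <= t -> forall e : R, 0 < e ->
    \forall s \near t, 0 <= s -> forall x, `|theta s x - theta t x| <= e.
Hypothesis theta_A1 : forall t : R, 0 < t -> fourier_multiplier m (theta t) (A1theta t).
Hypothesis equation : forall (t : R) x, 0 < t ->
  derive1 (theta ^~ x) t + advection (v t) (theta t) x + nu * A1theta t x = 0.
Hypothesis theta_infty : forall t : R, 0 <= t -> vanishes_at_infinity (theta t).

Let C := nu * C1 + 1.

(** At time 0, where theta need not be smooth, theta(0) is a uniform limit of
    continuous functions. *)
Lemma continuous_slice_ge0 t : 0 <= t -> continuous (theta t).
Proof.
rewrite le_eqVlt => /predU1P[<-|]; last exact: continuous_slice.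
move=> x; apply: (proj2 (@cvgrPdist_le R R^o X (nbhs x) _ _ _)) => /= e e0.
have e3 : 0 < e / 3 by rewrite divr_gt0.
have [s s0 Hs] : exists2 s : R, 0 < s & forall y, `|theta s y - theta 0 y| <= e / 3.
  have : \forall s \near (0 : R)^'+, 0 < s /\ forall y, `|theta s y - theta 0 y| <= e / 3.
    near=> s.
    have s0 : 0 < s by near: s; exact: nbhs_right_gt.
    split => //; move: (ltW s0); near: s.
    exact: cvg_within (continuous_theta (lexx 0) e3).
  by move/filter_ex => [s []]; exists s.
have Hx : \forall y \near nbhs x, `|theta s x - theta s y| <= e / 3.
  exact: cvgr_dist_le (continuous_slice smooth_theta s0 (x := x)) _ e3.
apply: filterS Hx => y /= Hy.
have h1 := Hs x; have h2 := Hs y.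
rewrite -normrN opprB in h1.
have -> : theta 0 x - theta 0 y =
   (theta 0 x - theta s x) + ((theta s x - theta s y) + (theta s y - theta 0 y)) by ring.
rewrite (le_trans (ler_normD _ _))//.
have := ler_normD (theta s x - theta s y) (theta s y - theta 0 y); lra.
Unshelve. all: by end_near. Qed.

(** At the maximum point x1 given by the maximum principle, the left derivative of
    e^{-Ct} sg theta(t, x1) at t0 is nonnegative.  The equation makes it at most
    e^{-C t0} (nu C1 - C) M, which is negative since C = nu C1 + 1. *)
Lemma weighted_norm_not_maximal (t0 M sg : R) (x0 : X) : 0 < t0 -> 0 < M ->
  `|sg| = 1 -> sg * theta t0 x0 = M ->
  ~ forall s x, 0 <= s <= t0 -> expR (- C * s) * `|theta s x| <= expR (- C * t0) * M.
Proof.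
move=> t00 M0 sg1 sM Hmax.
have sg0 : sg != 0 by rewrite -normr_eq0 sg1 oner_eq0.
have ct : continuous (theta t0) := continuous_slice smooth_theta t00.
have sgle y : sg * y <= `|y|.
  by rewrite -[leRHS]mul1r -sg1 -normrM ler_norm.
have fM x : `|sg * theta t0 x| <= M.
  rewrite normrM sg1 mul1r -(ler_pM2l (expR_gt0 (- C * t0))).
  by apply: Hmax; rewrite ltW//= lexx.
have cf : continuous (fun x => sg * theta t0 x).
  by move=> x; exact: (cvgM (cvg_cst sg) (ct x)).
have f0 : vanishes_at_infinity (fun x => sg * theta t0 x).
  move=> e e0; have [B HB] := theta_infty (ltW t00) e0; exists B => x /HB.
  by rewrite normrM sg1 mul1r.
have [x1 fx1 gx1] := at_max cf f0 (fourier_multiplier_sign sg1 (theta_A1 t00)) M0 fM sM.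
have adv : advection (v t0) (theta t0) x1 = 0.
  apply: big1 => i _.
  rewrite (derive_at_max (sg := sg) smooth_theta (delta_mx ord0 i) t00 sg0) ?mulr0// => y.
  by rewrite fx1 (le_trans (ler_norm _)).
have := equation x1 t00; rewrite adv addr0 => /eqP; rewrite addr_eq0 => /eqP E.
have := is_derive_time smooth_theta x1 t00; rewrite E => D1.
have D2 : is_derive t0 1 (fun s => sg * theta s x1) (sg * - (nu * A1theta t0 x1)).
  apply: (is_derive_eq (is_deriveM (is_derive_cst sg t0 1) D1)).
  by rewrite scaler0 addr0.
have := left_max_derive_ge0 t00 (is_derive_expR_mul C D2).
rewrite fx1 => H; have {}H : 0 <= expR (- C * t0) * (sg * - (nu * A1theta t0 x1) - C * M).
  apply: H => s /andP[s1 s2]; rewrite subrr in s1.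
  apply: le_trans (Hmax s x1 _); last by rewrite !ltW.
  by rewrite ler_wpM2l ?expR_ge0.
rewrite pmulr_rge0 ?expR_gt0// in H.
have := ler_wpM2l nu0 gx1; move: H; rewrite /C.
set A := A1theta t0 x1 => H1 H2.
lra.
Qed.

(** The weighted norm e^{-Ct} |theta(t)| is continuous on [0, T], so it has a
    maximum there, at time 0 by [weighted_norm_not_maximal]. *)
Lemma sup_norm_growth : exists x0, forall t x, 0 <= t ->
  `|theta t x| <= expR (C * t) * `|theta 0 x0|.
Proof.
have [a Ha] : exists a : R -> X, forall t, 0 <= t -> forall x,
    `|theta t x| <= `|theta t (a t)|.
  have /choice[a Ha] : forall t, exists b, 0 <= t -> forall x, `|theta t x| <= `|theta t b|.
    move=> t; have [t0|t0] := leP 0 t; last by exists 0.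
    have [b Hb] := norm_max_attained (continuous_slice_ge0 t0) (theta_infty t0).
    by exists b.
  by exists a.
pose N t := `|theta t (a t)|.
exists (a 0) => T x T0; rewrite -/(N 0).
apply: le_trans (Ha T T0 x) _; rewrite -/(N T).
(* |t| extends the norm to negative times, where theta is not controlled *)
have cN : continuous (fun t : R => N `|t|).
  move=> t; apply: (proj2 (@cvgrPdist_le R R^o R (nbhs t) _ _ _)) => /= e e0.
  have ct : continuous (fun s : R => `|s|) by exact: norm_continuous.
  have Hx := ct t _ (continuous_theta (normr_ge0 t) e0).
  near=> s; have H : forall x, `|theta `|s| x - theta `|t| x| <= e.
    by have := normr_ge0 s; near: s; exact: Hx.
  have h1 := Ha _ (normr_ge0 s) (a `|t|); have h2 := Ha _ (normr_ge0 t) (a `|s|).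
  have h3 := H (a `|t|); have h4 := H (a `|s|).
  rewrite -/(N `|s|) in h1; rewrite -/(N `|t|) in h2.
  have := ler_distD (theta `|s| (a `|t|)) (theta `|t| (a `|t|)) 0.
  have := ler_distD (theta `|t| (a `|s|)) (theta `|s| (a `|s|)) 0.
  rewrite !subr0 => k1 k2; rewrite distrC in k2.
  rewrite /N in h1 h2 *; rewrite ler_norml; lra.
have cG : continuous (fun t : R => expR (- C * t) * N `|t|).
  move=> t; apply: cvgM; last exact: cN.
  apply: (cvg_comp _ _ (cvgM (cvg_cst (- C)) cvg_id)); exact: continuous_expR.
have [t0 t0T Hmax] := EVT_max T0 (continuous_subspaceT cG).
rewrite in_itv /= in t0T; have /andP[t00 t0T'] := t0T.
have HT : expR (- C * T) * N T <= expR (- C * t0) * N t0.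
  have := Hmax T; rewrite in_itv /= T0 lexx => /(_ isT).
  by rewrite !ger0_norm.
suff HN : expR (- C * t0) * N t0 <= N 0.
  rewrite -(ler_pM2l (expR_gt0 (- C * T))) mulrA -expRD mulNr addNr expR0 mul1r.
  by rewrite -mulNr (le_trans HT).
move: t00; rewrite le_eqVlt => /predU1P[<-|t00].
  by rewrite mulr0 expR0 mul1r.
have [N0|N0] := leP (N t0) 0.
  by apply: (@le_trans _ _ 0); rewrite ?normr_ge0// mulr_ge0_le0 ?expR_ge0.
exfalso.
pose sg := Num.sg (theta t0 (a t0)).
have th0 : theta t0 (a t0) != 0 by rewrite -normr_gt0.
apply: (@weighted_norm_not_maximal t0 (N t0) sg (a t0)) => //.
- by rewrite normr_sg th0.
- by rewrite /N normrEsg.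
move=> s y /andP[s0 st].
have := Hmax s; rewrite in_itv /= s0 (le_trans st t0T') => /(_ isT).
rewrite (ger0_norm s0) (ger0_norm (ltW t00)) => H; apply: le_trans H.
by rewrite ler_wpM2l ?expR_ge0 ?Ha.
Unshelve. all: by end_near. Qed.

End growth.

(** * The growth estimate in the essential supremum norm *)

Theorem mainTheorem3 (R : realType) (nu : R) (d : nat) (gamma beta lambda : R) :
  0 <= nu -> (1 <= d)%N -> 0 <= gamma <= 2 -> 0 <= beta -> 1 < lambda ->
  exists2 C : R, 0 < C &
    forall (v : R -> 'rV[R]_d -> 'rV[R]_d) (theta : R -> 'rV[R]_d -> R)
           (theta0 : 'rV[R]_d -> R),
      smooth_solution nu gamma beta lambda v theta theta0 ->
      (forall t : R, 0 <= t -> vanishes_at_infinity (theta t)) ->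
      forall t : R, 0 <= t ->
        (Linfty_norm (theta t) <= (expR (C * t))%:E * Linfty_norm theta0)%E.
Proof.
move=> nu0 _ gamma02 beta0 lambda1.
have [m1 [m2 [m3 [E1 A2 A3 mE]]]] :=
  @A1_symbol_decomposition R d gamma beta lambda gamma02 beta0 lambda1.
have C0 : 0 <= m2 0 + m3 0 by rewrite addr_ge0// averaging_mass_ge0.
exists (nu * (m2 0 + m3 0) + 1); first by rewrite ltr_wpDl// mulr_ge0.
move=> v theta theta0 [smooth cont [A1theta A1E eqn] init] infty t t0.
have at_max f g M x0 := @multiplier_at_max R d _ m1 m2 m3 f g M x0 E1 A2 A3 mE.
have [x0 Hx0] := sup_norm_growth nu0 at_max smooth cont A1E eqn infty.
have -> : theta0 = theta 0 by apply/funext => x; rewrite init.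
apply: le_trans (Linfty_norm_le (fun x => Hx0 t x t0)) _.
rewrite EFinM lee_wpmul2l ?lee_fin ?expR_ge0//.
apply: le_Linfty_norm; exact: continuous_slice_ge0 (lexx 0).
Qed.
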